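(* Let the weight $w$ satisfy conditions (i)–(ii) and let $k\in L^1(0,b)$ satisfy the weighted Sonine condition WSC1 with weight $w$, with associated kernel $K\in L^1(0,b)$ and corresponding function $g$. Let $c$ be a given constant. Then the nonlocal differential equation $$\frac{d}{dt}\int_0^t w(s,t)k(t-s)u(s)\,ds=f(t),\quad t\in(0,b],\qquad \int_0^t w(s,t)k(t-s)u(s)\,ds\Big|_{t=0}=c,$$ is equivalent to the following second-kind Volterra integral equation $$u(t)+\frac{1}{g(t,0)}\int_0^t g_2(y,t-y)u(y)\,dy=c\,\frac{K(t)}{g(t,0)}+\frac{1}{g(t,0)}\int_0^tK(t-y)f(y)\,dy.$$ Suppose in addition that $f\in L^1(0,b)$ and $|g_2(s,t)|\le Qt^{-\sigma}$ for some $0<\sigma<1$, where $Q$ is a positive constant. Then the nonlocal differential equation above (with its initial condition) admits a unique $L^1$ solution.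
   Context: Fix $b>0$. Here $f$ is the given function and $u$ the unknown; an $L^1$ solution is a solution $u\in L^1(0,b)$. For a function $q(x_1,x_2)$ of two variables, $q_2=\partial_{x_2}q$ denotes its partial derivative in the second variable. Conditions on the weight $w(s,t)$: (i) $w(t,t)\neq0$ with $\mu_*\le|w(t,t)|\le\mu^*$ for $t\in[0,b]$, for some $0<\mu_*\le\mu^*$; (ii) $|w_2(s,t)|\le\bar w(t-s)$ for $0\le s\le t\le b$, for some $\bar w\in L^1(0,b)$. WSC1: $k\in L^1(0,b)$ satisfies WSC1 if there exists $K\in L^1(0,b)$ (the associated kernel) such that $$\int_0^t w(s,z+s)K(t-z)k(z)\,dz=g(s,t)\qquad\text{for all } s,t\ge0 \text{ with } 0\le s+t\le b,$$ for some function $g(s,t)$ satisfying (a) $g(s,0)\neq0$ with $\nu_*\le|g(s,0)|\le\nu^*$ for $0\le s\le b$, for some $0<\nu_*\le\nu^*$; (b) $|g_2(s,t)|\le\bar g(t)$ for $0\le s+t\le b$, for some $\bar g\in L^1(0,b)$. *)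

(* Defs.v *)
From HB Require Import structures.
From mathcomp Require Export all_boot all_order all_algebra.
From mathcomp Require Export all_classical all_reals all_analysis.
Export Order.TTheory GRing.Theory Num.Theory.
Export numFieldNormedType.Exports.

Set Implicit Arguments.
Unset Strict Implicit.
Unset Printing Implicit Defensive.

Local Open Scope classical_set_scope.
Local Open Scope ring_scope.

Definition L1 (R : realType) (b : R) (h : R -> R) : Prop :=
  lebesgue_measure.-integrable `]0, b[ (EFin \o h).

(* "The Lebesgue integral of h over D exists and equals v"; the bare [Rintegral]
   is a total function whose value is meaningless when h is not integrable. *)
Definition has_integral (R : realType) (D : set R) (h : R -> R) (v : R) : Prop :=
  lebesgue_measure.-integrable D (EFin \o h) /\
  \int[lebesgue_measure]_(x in D) h x = v.

Definition abs_continuous (R : realType) (a b : R) (F : R -> R) : Prop :=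
  forall e : R, 0 < e -> exists2 d : R, 0 < d &
    forall (n : nat) (x y : 'I_n -> R),
      (forall i, a <= x i /\ x i <= y i /\ y i <= b) ->
      trivIset [set: 'I_n] (fun i => `]x i, y i[%classic) ->
      \sum_(i < n) (y i - x i) < d ->
      \sum_(i < n) `|F (y i) - F (x i)| < e.

(* For a function q of two variables, q_2 (s, t) is [derive1 (q s) t], the
   derivative at t of the section [q s]. *)

(* The bound on w_2 is imposed for s < t only: an integrable majorant may be
   infinite at 0 (e.g. logarithmic), so at t = s only the continuity of the
   section is required.  Joint measurability of w is the standing assumption
   under which the integrals below make sense. *)
Definition weight_conditions (R : realType) (b : R) (w : R -> R -> R) : Prop :=
  [/\ measurable_fun [set p : R * R | 0 <= p.1 /\ p.1 <= p.2 /\ p.2 <= b]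
        (fun p : R * R => w p.1 p.2),
      exists mu_lo mu_hi : R, [/\ 0 < mu_lo, mu_lo <= mu_hi &
        forall t : R, 0 <= t <= b ->
          w t t != 0 /\ mu_lo <= `|w t t| /\ `|w t t| <= mu_hi],
      forall s : R, 0 <= s <= b -> {within `[s, b], continuous (w s)},
      forall s t : R, 0 <= s -> s < t -> t < b -> derivable (w s) t 1 &
      exists2 wbar : R -> R, L1 b wbar &
        forall s t : R, 0 <= s -> s < t -> t < b ->
          `|derive1 (w s) t| <= wbar (t - s)].

(* The identity is imposed for t > 0 only: at t = 0 its left-hand side is an
   integral over an empty set, whereas g (s, 0) <> 0.  The value g (s, 0) is tied
   to the identity by the continuity of [g s] on [0, b - s], and the bound on
   g_2 is imposed for t > 0 (g_2 is typically singular at t = 0). *)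
Definition WSC1 (R : realType) (b : R) (w : R -> R -> R) (k K : R -> R)
    (g : R -> R -> R) : Prop :=
  [/\ [/\ L1 b k, L1 b K &
        forall s t : R, 0 <= s -> 0 < t -> s + t <= b ->
          has_integral `]0, t[ (fun z => w s (z + s) * K (t - z) * k z) (g s t)],
      exists nu_lo nu_hi : R, [/\ 0 < nu_lo, nu_lo <= nu_hi &
        forall s : R, 0 <= s <= b ->
          g s 0 != 0 /\ nu_lo <= `|g s 0| /\ `|g s 0| <= nu_hi],
      forall s : R, 0 <= s <= b -> {within `[0, b - s], continuous (g s)},
      forall s t : R, 0 <= s -> 0 < t -> s + t < b -> derivable (g s) t 1 &
      exists2 gbar : R -> R, L1 b gbar &
        forall s t : R, 0 <= s -> 0 < t -> s + t < b ->
          `|derive1 (g s) t| <= gbar t].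

(* For u in L^1 the integral is defined for almost every t only.  The equation is
   read in the Caratheodory sense: the integral has a version F that is locally
   absolutely continuous on [0, b), with F (0) = c and F' = f almost everywhere. *)
Definition nonlocal_solution (R : realType) (b : R) (w : R -> R -> R)
    (k f : R -> R) (c : R) (u : R -> R) : Prop :=
  exists F : R -> R,
    [/\ forall t : R, 0 < t -> t < b -> abs_continuous 0 t F,
        F 0 = c,
        {ae lebesgue_measure, forall t, `]0, b[%classic t ->
          has_integral `]0, t[ (fun s => w s t * k (t - s) * u s) (F t)} &
        {ae lebesgue_measure, forall t, `]0, b[%classic t ->
          derivable F t 1 /\ derive1 F t = f t}].

Definition volterra_solution (R : realType) (b : R) (g : R -> R -> R)
    (K f : R -> R) (c : R) (u : R -> R) : Prop :=
  {ae lebesgue_measure, forall t, `]0, b[%classic t ->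
    exists I J : R,
      [/\ has_integral `]0, t[ (fun y => derive1 (g y) (t - y) * u y) I,
          has_integral `]0, t[ (fun y => K (t - y) * f y) J &
          u t + 1 / g t 0 * I = c * (K t / g t 0) + 1 / g t 0 * J]}.

(* Main.v *)
(* Let W u (t) be the integral of w(s,t) k(t-s) u(s) over (0,t), and write * for
   convolution on (0,t).  By Fubini and the Sonine condition,
     (K * W u)(t) = int_0^t g(y,t-y) u(y) dy,
   and g(y,t-y) = g(y,0) + int_0^{t-y} g_2(y,.) makes the right-hand side the
   primitive of g(t,0) u(t) + int_0^t g_2(y,t-y) u(y) dy.  Likewise K * (c + 1 * f)
   is the primitive of c K + K * f.  So K convolved with the defect of the integrated
   nonlocal equation is the primitive of the defect of the Volterra equation.
   Differentiating almost everywhere gives one implication; the other one uses that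
   convolution with K is injective, because by the Sonine condition for s = 0
   a further convolution with w(0,.) k reduces K * H = 0 to a homogeneous
   second-kind equation for H.  That a solution of the Volterra equation forces f to
   be locally integrable comes from K not vanishing identically near 0.

   Existence and uniqueness hold for the second-kind equation, whose kernel is
   dominated by a function of t - y in L^1: in the norm of L^1 weighted by exp(-c t),
   c large, its integral operator is a contraction. *)

Require Import Defs.
From mathcomp Require Import measurable_realfun ring lra.

Set Implicit Arguments.
Unset Strict Implicit.
Unset Printing Implicit Defensive.

Local Open Scope classical_set_scope.
Local Open Scope ring_scope.

(** The majorants of [w_2] and [g_2] are merely integrable, hence possibly unbounded near every
    point, so the sections need not be locally Lipschitz and the mean value theorem gives no usable
    bound. The majorant is therefore enlarged to one that, almost everywhere near each point x,
    exceeds the original value at x by a fixed margin; the increments of every section are then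
    bounded by those of one single primitive. This gives a bound on [w] uniform in s, and the
    absolute continuity of the sections of [g].

    The fundamental theorem of calculus for absolutely continuous functions serves both the sections
    of [g] and the version [F] of the integral in the nonlocal problem. Since [f] is only known to
    be measurable, the integrability of the derivative is among its conclusions.

    For the equivalence [f] is integrable at best away from [b], so it is cut at an arbitrary T < b;
    all operators are causal, so nothing changes before T. Functions are extended by zero to the
    line and kernels to the plane, so that integrals over (0,t) become integrals over the line and
    Fubini applies on the plane. *)

Section integrals.
Context {R : realType}.
Notation mu := (@lebesgue_measure R).
Implicit Types (f g h : R -> R) (a b c x y t : R).

(** * Translation and reflection invariance of the integral *)

Lemma lebesgue_measure_shift c (A : set R) : measurable A ->
  mu ((fun x => x + c) @^-1` A) = mu A.
Proof.
move=> mA.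
have mphi : measurable_fun setT (fun x : measurableTypeR R => x + c : measurableTypeR R).
  exact: measurable_funD.
(* A measure that agrees with Lebesgue measure on half-open intervals equals it, so it is enough to
   compare lengths of preimages of intervals. *)
rewrite (@lebesgue_measure_unique _
  (pushforward mu (fun x : measurableTypeR R => x + c : measurableTypeR R)) _ A mA)//.
move=> _ [[p q] _ <-] /=.
rewrite /pushforward.
rewrite (_ : _ @^-1` _ = `]p - c, q - c]%classic); last first.
  by apply/seteqP; split=> z /=; rewrite !in_itv/= ltrBlDr lerBrDr.
rewrite !lebesgue_measure_itv/= !lte_fin ltrD2r.
by rewrite -!EFinB opprB addrA subrK.
Qed.

Lemma lebesgue_measure_reflect c (A : set R) : measurable A ->
  mu ((fun x => c - x) @^-1` A) = mu A.
Proof.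
move=> mA.
have mphi : measurable_fun setT (fun x : measurableTypeR R => c - x : measurableTypeR R).
  exact: measurable_funB.
rewrite (@lebesgue_measure_unique _
  (pushforward mu (fun x : measurableTypeR R => c - x : measurableTypeR R)) _ A mA)//.
move=> _ [[p q] _ <-] /=.
rewrite /pushforward.
(* Reflection moves the closed end to the left; the length is unchanged. *)
rewrite (_ : _ @^-1` _ = `[c - q, c - p[%classic); last first.
  by apply/seteqP; split=> z /=; rewrite !in_itv/= => /andP[? ?]; apply/andP; split; lra.
rewrite !lebesgue_measure_itv/= !lte_fin ltrD2l ltrN2.
by rewrite -!EFinB; congr (if _ then _ else _); congr EFin; ring.
Qed.

Lemma ge0_integral_invariant (phi : R -> R) (f : R -> \bar R) :
  measurable_fun setT phi ->
  (forall A, measurable A -> mu (phi @^-1` A) = mu A) ->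
  measurable_fun setT f -> (forall x, 0 <= f x)%E ->
  (\int[mu]_x f (phi x) = \int[mu]_x f x)%E.
Proof.
move=> mphi muphi mf f0.
have := @ge0_integral_pushforward _ _ (measurableTypeR R) (measurableTypeR R) R phi mphi
  (@lebesgue_measure R) setT f measurableT mf.
rewrite preimage_setT => <-; last by move=> y _; exact: f0.
by apply: eq_measure_integral => A mA _; rewrite -[RHS]muphi.
Qed.

Lemma integral_invariant (phi : R -> R) (f : R -> \bar R) :
  measurable_fun setT phi ->
  (forall A, measurable A -> mu (phi @^-1` A) = mu A) ->
  measurable_fun setT f ->
  (\int[mu]_x f (phi x) = \int[mu]_x f x)%E.
Proof.
move=> mphi muphi mf; rewrite [LHS]integralE [RHS]integralE.
congr (_ - _)%E.
- rewrite -(ge0_integral_invariant mphi muphi (measurable_funepos mf))//.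
  by apply: eq_integral => x _; rewrite !funeposE.
- rewrite -(ge0_integral_invariant mphi muphi (measurable_funeneg mf))//.
  by apply: eq_integral => x _; rewrite !funenegE.
Qed.

Lemma integral_shift c (f : R -> \bar R) : measurable_fun setT f ->
  (\int[mu]_x f (x + c)%R = \int[mu]_x f x)%E.
Proof.
apply: (@integral_invariant (fun x => x + c)).
- exact: measurable_funD.
- exact: lebesgue_measure_shift.
Qed.

Lemma integral_reflect c (f : R -> \bar R) : measurable_fun setT f ->
  (\int[mu]_x f (c - x)%R = \int[mu]_x f x)%E.
Proof.
apply: (@integral_invariant (fun x => c - x)).
- exact: measurable_funB.
- exact: lebesgue_measure_reflect.
Qed.

End integrals.

(** * Integral operators dominated by a convolution kernel *)

Section kernels.
Context {R : realType}.
Notation mu := (@lebesgue_measure R).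
Notation intR f := (mu.-integrable setT (EFin \o f)).
Implicit Types (f g h u v : R -> R) (A B : R -> R -> R) (a b : R -> R) (c x y t : R).

Lemma ae_imply (P Q : R -> Prop) : (forall x, P x -> Q x) ->
  {ae mu, forall x, P x} -> {ae mu, forall x, Q x}.
Proof. exact: (@filterS _ _ (ae_filter_ringOfSetsType mu)). Qed.

Lemma ae_imply2 (P Q S : R -> Prop) : (forall x, P x -> Q x -> S x) ->
  {ae mu, forall x, P x} -> {ae mu, forall x, Q x} -> {ae mu, forall x, S x}.
Proof. exact: (@filterS2 _ _ (ae_filter_ringOfSetsType mu)). Qed.

(** A bound by a function of t - y lets the operator be treated as a convolution, with Young's
    inequality in L^1 as the basic estimate. The bound [a] is automatically nonnegative: take y =
    0. *)
Definition dominated_kernel A a :=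
  [/\ measurable_fun setT (fun p : R * R => A p.1 p.2), intR a &
      forall t y, `|A t y| <= a (t - y)].

Definition kernel_op A u t : R := \int[mu]_y (A t y * u y).

Lemma intR_measurable u : intR u -> measurable_fun setT u.
Proof. by move=> /measurable_int /measurable_EFinP. Qed.

Lemma kernel_measurable A a u : dominated_kernel A a -> intR u ->
  measurable_fun setT (fun p : R * R => (A p.1 p.2 * u p.2)%:E).
Proof.
move=> [mA _ _] iu; apply/measurable_EFinP; apply: measurable_funM => //.
by apply: measurableT_comp => //; exact: intR_measurable.
Qed.

Lemma ge0_measurable_integral1 (f : R -> R -> \bar R) :
  measurable_fun setT (fun p : R * R => f p.1 p.2) ->
  (forall x y, 0 <= f x y)%E ->
  measurable_fun setT (fun y => (\int[mu]_x f x y)%E).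
Proof.
move=> mf f0.
exact: (@measurable_fun_fubini_tonelli_G _ _ (measurableTypeR R)
  (measurableTypeR R) R mu (fun p => f p.1 p.2)).
Qed.

Lemma ge0_measurable_integral2 (f : R -> R -> \bar R) :
  measurable_fun setT (fun p : R * R => f p.1 p.2) ->
  (forall x y, 0 <= f x y)%E ->
  measurable_fun setT (fun x => (\int[mu]_y f x y)%E).
Proof.
move=> mf f0.
exact: (@measurable_fun_fubini_tonelli_F _ _ (measurableTypeR R)
  (measurableTypeR R) R mu (fun p => f p.1 p.2)).
Qed.

Lemma ge0_integral_swap (f : R -> R -> \bar R) :
  measurable_fun setT (fun p : R * R => f p.1 p.2) ->
  (forall x y, 0 <= f x y)%E ->
  (\int[mu]_x \int[mu]_y f x y = \int[mu]_y \int[mu]_x f x y)%E.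
Proof.
move=> mf f0.
exact: (@fubini_tonelli _ _ (measurableTypeR R)
  (measurableTypeR R) R mu mu (fun p => f p.1 p.2)).
Qed.

Lemma measurable_section1 {d} {T : measurableType d} (f : R -> R -> T) y :
  measurable_fun setT (fun p : R * R => f p.1 p.2) ->
  measurable_fun setT (f ^~ y).
Proof. by move=> mf; apply: (measurableT_comp mf (pair2_measurable y)). Qed.

Lemma measurable_section2 {d} {T : measurableType d} (f : R -> R -> T) x :
  measurable_fun setT (fun p : R * R => f p.1 p.2) ->
  measurable_fun setT (f x).
Proof. by move=> mf; apply: (measurableT_comp mf (pair1_measurable x)). Qed.

(** Young's inequality: the t-integration is done first, and translation invariance makes the
    integral of a(t - y) independent of y. *)
Lemma kernel_tonelli A a u : dominated_kernel A a -> intR u ->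
  (\int[mu]_y \int[mu]_t `|(A t y * u y)%:E| <=
   (\int[mu]_t (a t)%:E) * \int[mu]_y `|(u y)%:E|)%E.
Proof.
move=> dA iu; have [mA ia Aa] := dA; have mu_ := intR_measurable iu.
have ma := intR_measurable ia.
have a0 x : 0 <= a x by rewrite -[x]subr0 (le_trans _ (Aa _ _)).
have mAu := kernel_measurable dA iu.
apply: (@le_trans _ _ (\int[mu]_y ((\int[mu]_t (a t)%:E) * `|(u y)%:E|)%E)%E).
  apply: ge0_le_integral => //.
  - by move=> y _; apply: integral_ge0.
  - apply: (@ge0_measurable_integral1 (fun t y => `|(A t y * u y)%:E|%E)) => //.
    exact: measurableT_comp.
  - apply: measurable_funeM; apply: measurableT_comp => //; exact/measurable_EFinP.
  move=> y _.
  rewrite -(@integral_shift _ (- y) (EFin \o a)); last exact/measurable_EFinP.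
  have may : measurable_fun setT (fun t => a (t - y)).
    by apply: measurableT_comp => //; exact: measurable_funD.
  rewrite -ge0_integralZr//; last 2 first.
  - exact/measurable_EFinP.
  - by move=> t _; rewrite /= lee_fin.
  apply: ge0_le_integral => //.
  - apply: measurableT_comp => //.
    exact: (@measurable_section1 _ _ (fun t y => (A t y * u y)%:E)).
  - by apply: emeasurable_funM => //; exact/measurable_EFinP.
  - by move=> t _ /=; rewrite -EFinM lee_fin normrM ler_wpM2r.
rewrite ge0_integralZl//.
- apply: measurableT_comp => //; exact/measurable_EFinP.
- by apply: integral_ge0 => t _; rewrite lee_fin.
Qed.

(** Integrability on the plane, expressed by the iterated integral that the estimates actually
    control; Tonelli makes the order irrelevant. *)
Definition integrable2 (f : R -> R -> R) :=
  measurable_fun setT (fun p : R * R => f p.1 p.2) /\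
  (\int[mu]_x \int[mu]_y `|(f x y)%:E| < +oo)%E.

Lemma integrable2_swap (f : R -> R -> R) :
  integrable2 f -> integrable2 (fun x y => f y x).
Proof.
move=> [mf fi]; split.
  exact: (measurableT_comp mf (measurable_fun_pair measurable_snd measurable_fst)).
rewrite -(@ge0_integral_swap (fun x y => `|(f x y)%:E|%E))//.
by apply: measurableT_comp => //; exact/measurable_EFinP.
Qed.

Lemma integrable2_prod (f : R -> R -> R) : integrable2 f ->
  (mu \x mu)%E.-integrable setT (fun p => (f p.1 p.2)%:E).
Proof.
move=> [mf fi].
by apply: (@integrable12ltyP _ _ (measurableTypeR R) (measurableTypeR R) R mu mu
  (fun p => (f p.1 p.2)%:E) _).2 => //; exact/measurable_EFinP.
Qed.

Lemma integrable2_ae (f : R -> R -> R) : integrable2 f ->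
  {ae mu, forall x, intR (f x)}.
Proof. by move=> /integrable2_prod /ae_integrable1. Qed.

Lemma integrable_fine (F : R -> \bar R) : mu.-integrable setT F ->
  intR (fun x => fine (F x)).
Proof.
move=> iF; have mF := measurable_int _ iF.
apply: le_integrable iF => //.
- by apply/measurable_EFinP; exact: measurableT_comp.
- by move=> x _ /=; case: (F x) => [r| |]//=; rewrite normr0 leey.
Qed.

Lemma Rintegral_fine (F : R -> \bar R) : mu.-integrable setT F ->
  (\int[mu]_x (fine (F x))%:E = \int[mu]_x F x)%E.
Proof.
move=> iF; apply: ae_eq_integral => //.
- exact: measurable_int (integrable_fine iF).
- exact: measurable_int iF.
- by have := integrable_ae measurableT iF; apply: ae_imply => x /(_ I) Fx _; rewrite fineK.
Qed.

(** At least one of the integrals of the positive and negative parts is infinite, so their extended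
    difference is infinite and [fine] sends it to 0. *)
Lemma nonintegrable_Rintegral f : measurable_fun setT f -> ~ intR f ->
  \int[mu]_x f x = 0.
Proof.
move=> mf nif; rewrite /Rintegral integralE.
have mf' : measurable_fun setT (EFin \o f) by exact/measurable_EFinP.
have p0 : (0 <= \int[mu]_x (EFin \o f)^\+ x)%E by exact: integral_ge0.
have n0 : (0 <= \int[mu]_x (EFin \o f)^\- x)%E by exact: integral_ge0.
have : (\int[mu]_x `|(EFin \o f) x| = +oo)%E.
  apply/eqP; rewrite eq_le leey/= leNgt; apply/negP => ioo; apply: nif.
  exact/integrableP.
rewrite (_ : (fun x => _) = (EFin \o f)^\+ \+ (EFin \o f)^\-)%E; last first.
  by rewrite -[RHS]fune_abse.
rewrite ge0_integralD//; last 2 first.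
- exact: measurable_funepos.
- exact: measurable_funeneg.
move: p0 n0; case: (\int[mu]_x (EFin \o f)^\+ x)%E => [p| |]//=;
by case: (\int[mu]_x (EFin \o f)^\- x)%E => [q| |].
Qed.

(* No integrability of [f] is required: when [f] is not integrable both sides are
   the junk value 0. *)
Lemma Rintegral_mulr f c : measurable_fun setT f ->
  \int[mu]_x (f x * c) = (\int[mu]_x f x) * c.
Proof.
move=> mf; have [if_|nif] := pselect (intR f); first by rewrite RintegralZr.
rewrite (nonintegrable_Rintegral mf nif) mul0r.
have [->|c0] := eqVneq c 0.
  by under eq_Rintegral do rewrite mulr0; rewrite /Rintegral integral0.
apply: nonintegrable_Rintegral; first exact: measurable_funM.
move=> ifc; apply: nif.
have := integrableZr measurableT c^-1 ifc.
congr (_.-integrable _ _); apply/funext => x /=.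
by rewrite -EFinM mulfK.
Qed.

Lemma ae_eq_Rintegral f g : measurable_fun setT f -> measurable_fun setT g ->
  {ae mu, forall x, f x = g x} -> \int[mu]_x f x = \int[mu]_x g x.
Proof.
move=> mf mg fg; congr fine; apply: ae_eq_integral => //.
- exact/measurable_EFinP.
- exact/measurable_EFinP.
- by apply: ae_imply fg => x + _ /=; move=> ->.
Qed.

Lemma integrable2_Rintegral (f : R -> R -> R) : integrable2 f ->
  intR (fun x => \int[mu]_y f x y).
Proof. by move=> /integrable2_prod /integrable_fubini_F /integrable_fine. Qed.

Lemma Fubini_Rintegral (f : R -> R -> R) : integrable2 f ->
  \int[mu]_x \int[mu]_y f x y = \int[mu]_y \int[mu]_x f x y.
Proof.
move=> fi; have fp := integrable2_prod fi.
rewrite /Rintegral; congr fine.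
have /integrable_fubini_F iF := integrable2_prod fi.
have /integrable_fubini_F iG := integrable2_prod (integrable2_swap fi).
have /= e1 := Rintegral_fine iF; have /= e2 := Rintegral_fine iG.
rewrite /fubini_F /= in e1 e2; rewrite e1 e2.
exact: (Fubini fp).
Qed.

Lemma kernel_integrable2 A a u : dominated_kernel A a -> intR u ->
  integrable2 (fun t y => A t y * u y).
Proof.
move=> dA iu; apply: (@integrable2_swap (fun y t => A t y * u y)); split.
  apply/measurable_EFinP.
  exact: (measurableT_comp (kernel_measurable dA iu) (measurable_fun_pair measurable_snd measurable_fst)).
apply: le_lt_trans (kernel_tonelli dA iu) _.
have [_ ia _] := dA.
rewrite lte_mul_pinfty//.
- apply: integral_ge0 => t _; rewrite lee_fin.
  by case: dA => _ _ /(_ t 0); rewrite subr0; exact: le_trans.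
- exact: integrable_fin_num.
- by case/integrableP : iu.
Qed.

Lemma kernel_op_ae A a u : dominated_kernel A a -> intR u ->
  {ae mu, forall t, intR (fun y => A t y * u y)}.
Proof. by move=> dA iu; exact: integrable2_ae (kernel_integrable2 dA iu). Qed.

Lemma kernel_op_integrable A a u : dominated_kernel A a -> intR u ->
  intR (kernel_op A u).
Proof. by move=> dA iu; exact: integrable2_Rintegral (kernel_integrable2 dA iu). Qed.

Lemma kernel_op_norm A a u : dominated_kernel A a -> intR u ->
  \int[mu]_t `|kernel_op A u t| <= (\int[mu]_t a t) * \int[mu]_y `|u y|.
Proof.
move=> dA iu; have iAu := kernel_op_integrable dA iu.
have [mA ia Aa] := dA.
rewrite -lee_fin EFinM /Rintegral !fineK; last 3 first.
- exact: integrable_fin_num (integrable_norm iu).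
- exact: integrable_fin_num.
- exact: integrable_fin_num (integrable_norm iAu).
apply: le_trans (kernel_tonelli dA iu).
have [mk _] := kernel_integrable2 dA iu.
have mk' : measurable_fun setT (fun p : R * R => `|(A p.1 p.2 * u p.2)%:E|%E).
  by apply: measurableT_comp => //; exact/measurable_EFinP.
rewrite -(@ge0_integral_swap (fun t y => `|(A t y * u y)%:E|%E))//.
apply: ae_ge0_le_integral => //.
- apply/measurable_EFinP/measurableT_comp => //; exact: intR_measurable.
- by move=> t _; apply: integral_ge0.
- exact: (@ge0_measurable_integral2 (fun t y => `|(A t y * u y)%:E|%E)).
have := kernel_op_ae dA iu; apply: ae_imply => t it _.
rewrite /kernel_op EFin_normr_Rintegral//; exact: le_abse_integral (measurable_int _ it).
Qed.

(** Fubini on the plane for almost every fixed t. The function [v], the integral of |B u|, is in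
    L^1, so [A t y * v y] is integrable in y for almost every t, which is the absolute integrability
    that Fubini asks for. *)
Lemma kernel_op_comp A a B b u :
  dominated_kernel A a -> dominated_kernel B b -> intR u ->
  {ae mu, forall t, [/\ intR (fun y => A t y * kernel_op B u y),
     intR (fun s => (\int[mu]_y (A t y * B y s)) * u s) &
     kernel_op A (kernel_op B u) t = \int[mu]_s ((\int[mu]_y (A t y * B y s)) * u s)]}.
Proof.
move=> dA dB iu; have iBu := kernel_op_integrable dB iu.
have [mA ia Aa] := dA; have [mB ib Bb] := dB.
pose v y := \int[mu]_s `|B y s * u s|.
have dB' : dominated_kernel (fun y s => `|B y s|) b.
  by split=> // [|t y]; [exact: measurableT_comp|rewrite normr_id].
have iu' : intR (fun x => `|u x|) := integrable_norm iu.
have iv : intR v.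
  have := kernel_op_integrable dB' iu'; rewrite /kernel_op.
  by congr (_.-integrable _ (EFin \o _)); apply/funext => y; apply: eq_Rintegral => s _; rewrite normrM.
have ma := @kernel_op_ae A a v dA iv.
have mb := @kernel_op_ae A a _ dA iBu.
have mc := @kernel_op_ae B b _ dB iu.
apply: ae_imply2 ma mb => t ta tb.
have i2 : integrable2 (fun y s => A t y * (B y s * u s)).
  split.
    apply: measurable_funM.
      apply: measurableT_comp => //.
      exact: (@measurable_section2 _ _ A).
    by case: (kernel_integrable2 dB iu).
  have -> : (\int[mu]_x \int[mu]_y `|(A t x * (B x y * u y))%:E| = \int[mu]_x `|(A t x * v x)%:E|)%E.
    apply: ae_eq_integral => //.
    - apply: (@ge0_measurable_integral2 (fun x y => `|(A t x * (B x y * u y))%:E|%E)) => //.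
      apply: measurableT_comp => //; apply/measurable_EFinP.
      apply: measurable_funM.
        by apply: measurableT_comp => //; exact: (@measurable_section2 _ _ A).
      by case: (kernel_integrable2 dB iu).
    - by apply: measurableT_comp => //; exact: measurable_int ta.
    - apply: ae_imply mc => x ix _.
      under eq_integral do rewrite EFinM abseM.
      rewrite ge0_integralZl//; last 1 first.
        by apply: measurableT_comp => //; exact: measurable_int ix.
      rewrite EFinM abseM; congr (_ * _)%E.
      rewrite gee0_abs; last by rewrite lee_fin; apply: Rintegral_ge0 => // s _.
      by rewrite /v /Rintegral fineK//; exact: integrable_fin_num (integrable_norm ix).
  by case/integrableP : ta.
(* For an exceptional s the product of the kernels may fail to be integrable in y; both sides are
   then the default value 0. *)
have ABu s : \int[mu]_y (A t y * (B y s * u s)) = (\int[mu]_y (A t y * B y s)) * u s.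
  rewrite -Rintegral_mulr; first by apply: eq_Rintegral => y _; rewrite mulrA.
  apply: measurable_funM; first exact: (@measurable_section2 _ _ A).
  exact: (@measurable_section1 _ _ B).
have i2' := integrable2_swap i2.
split => //.
  by have := integrable2_Rintegral i2'; under eq_fun do rewrite ABu.
rewrite /kernel_op.
transitivity (\int[mu]_y \int[mu]_s (A t y * (B y s * u s))).
  apply: ae_eq_Rintegral; first exact: intR_measurable tb.
    exact: intR_measurable (integrable2_Rintegral i2).
  by apply: ae_imply mc => y iy; rewrite RintegralZl.
by rewrite (Fubini_Rintegral i2); apply: eq_Rintegral => s _.
Qed.

End kernels.

(** * Contracting integral operators in L^1 *)

Lemma le_mul_eq0 (R : realFieldType) (q x : R) :
  0 <= x -> q < 1 -> x <= q * x -> x <= 0.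
Proof. by move=> *; nra. Qed.

Lemma cvg_norm_le (R : realType) (v : nat -> R) (l M : R) :
  v @ \oo --> l -> (forall n, `|v n| <= M) -> `|l| <= M.
Proof.
move=> vl vM; have cW : `|v n| @[n --> \oo] --> `|l| by exact: cvg_norm vl.
rewrite -(cvg_lim _ cW)//; apply: limr_le.
  by apply/cvg_ex; eexists; exact: cW.
by apply: nearW => n; exact: vM.
Qed.

Section contraction.
Context {R : realType}.
Notation mu := (@lebesgue_measure R).
Notation intR f := (mu.-integrable setT (EFin \o f)).
Implicit Types (f g h u v : R -> R) (A B : R -> R -> R) (a b : R -> R) (c x y t : R).

Lemma Rintegral_norm_eq0 f : intR f -> \int[mu]_x `|f x| = 0 ->
  {ae mu, forall x, f x = 0}.
Proof.
move=> if_ f0.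
have : (\int[mu]_x `|(f x)%:E| = 0)%E.
  by rewrite -[LHS]fineK ?[fine _]f0//; exact: integrable_fin_num (integrable_norm if_).
move=> /(@ae_eq_integral_abs _ _ _ mu setT measurableT _ (measurable_int _ if_)).1.
by apply: ae_imply => x /(_ I) [].
Qed.

Lemma Rintegral_dominated_cvg (F : nat -> R -> R) f g :
  (forall n, measurable_fun setT (F n)) -> measurable_fun setT f ->
  {ae mu, forall x, F ^~ x @ \oo --> f x} -> intR g ->
  {ae mu, forall x, forall n, `|F n x| <= g x} ->
  intR f /\ \int[mu]_x F n x @[n --> \oo] --> \int[mu]_x f x.
Proof.
move=> mF mf Ff ig Fg.
have [|||||ii _ ic] := @dominated_convergence _ _ _ mu setT measurableT
  (fun n => EFin \o F n) (EFin \o f) (EFin \o g).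
- by move=> n; apply/measurable_EFinP; exact: mF.
- exact/measurable_EFinP.
- apply: ae_imply Ff => x Ff _.
  by apply: cvg_EFin; [exact: nearW|exact: Ff].
- exact: ig.
- by apply: ae_imply Fg => x Fg n _ /=; rewrite lee_fin.
split=> //.
apply: fine_cvg; rewrite [X in _ --> X]fineK; last exact: integrable_fin_num.
exact: ic.
Qed.

(** An inequality instead of the fixed-point equation is what the applications supply: it is
    trivially true at points outside the interval, where h vanishes but the equation is not
    asserted. *)
Lemma kernel_contraction_unique A a h : dominated_kernel A a ->
  \int[mu]_x a x < 1 -> intR h ->
  {ae mu, forall t, `|h t| <= `|kernel_op A h t|} -> {ae mu, forall t, h t = 0}.
Proof.
move=> dA a1 ih hle; apply: Rintegral_norm_eq0 => //.
have h0 : 0 <= \int[mu]_x `|h x| by apply: Rintegral_ge0.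
have ioh := kernel_op_integrable dA ih.
have le1 : \int[mu]_x `|h x| <= \int[mu]_x `|kernel_op A h x|.
  rewrite -lee_fin /Rintegral !fineK; last 2 first.
  - exact: integrable_fin_num (integrable_norm ioh).
  - exact: integrable_fin_num (integrable_norm ih).
  apply: ae_ge0_le_integral => //.
  - exact: measurable_int (integrable_norm ih).
  - exact: measurable_int (integrable_norm ioh).
  - by apply: ae_imply hle => x.
have := le_trans le1 (kernel_op_norm dA ih).
by move=> le2; apply/eqP; rewrite eq_le h0 andbT; exact: le_mul_eq0 h0 a1 le2.
Qed.

(** Neumann series. The L^1 norms of the iterates decay geometrically, so the sum [S] of their
    absolute values is integrable; it gives convergence almost everywhere and is the dominating
    function for passing to the limit under the operator. *)
Lemma kernel_contraction_solution A a (phi : R -> R) : dominated_kernel A a ->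
  \int[mu]_x a x < 1 -> intR phi ->
  exists2 u, intR u & {ae mu, forall t, u t = phi t + kernel_op A u t}.
Proof.
move=> dA a1 iphi.
have [mA ia Aa] := dA.
have a0 x : 0 <= a x by rewrite -[x]subr0 (le_trans _ (Aa _ _)).
set q := \int[mu]_x a x in a1.
have q0 : 0 <= q by apply: Rintegral_ge0.
pose U n := iter n (kernel_op A) phi.
have iU n : intR (U n).
  by elim: n => //= n IH; exact: kernel_op_integrable dA IH.
have nU n : \int[mu]_x `|U n x| <= geometric (\int[mu]_x `|phi x|) q n.
  elim: n => [|n IH]; first by rewrite /= expr0 mulr1.
  apply: le_trans (kernel_op_norm dA (iU n)) _.
  by rewrite /= exprS mulrCA ler_wpM2l.
pose S x := (\sum_(0 <= n <oo) `|(U n x)%:E|)%E.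
have mUn n : measurable_fun setT (fun x => `|(U n x)%:E|%E).
  by apply: measurableT_comp => //; exact: measurable_int (iU n).
have mS : measurable_fun setT S by apply: ge0_emeasurable_sum.
have iS : mu.-integrable setT S.
  apply/integrableP; split => //.
  have -> : (\int[mu]_x `|S x| = \sum_(0 <= n <oo) \int[mu]_x `|(U n x)%:E|)%E.
    rewrite -integral_nneseries//; apply: eq_integral => x _.
    by rewrite gee0_abs//; exact: nneseries_ge0.
  apply: le_lt_trans (ltry ((\int[mu]_x `|phi x|) / (1 - q))).
  apply: lime_le; first by apply: is_cvg_nneseries => n _ _; exact: integral_ge0.
  near=> n.
  apply: (@le_trans _ _ (\sum_(0 <= i < n) (geometric (\int[mu]_x `|phi x|) q i)%:E)%E).
    apply: lee_sum => i _; apply: le_trans (_ : _ <= (\int[mu]_x `|U i x|)%:E)%E _.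
      by rewrite /Rintegral fineK//; exact: integrable_fin_num (integrable_norm (iU i)).
    by rewrite lee_fin.
  rewrite sumEFin lee_fin.
  have := @geometric_seriesE R (\int[mu]_x `|phi x|) q (negbT (lt_eqF a1)).
  move=> /(congr1 (fun f : nat -> R => f n)); rewrite /series/= => ->.
  rewrite ler_pM2r ?invr_gt0 ?subr_gt0// ler_piMr//; last by rewrite gerBl exprn_ge0.
  by apply: Rintegral_ge0.
pose s x := fine (S x).
have is_ : intR s := integrable_fine iS.
pose V n x := \sum_(0 <= i < n) U i x.
have SV x : S x \is a fin_num -> (forall n, `|V n x| <= s x) /\ cvgn (V^~ x).
  move=> Sx; have cs : cvgn (series (fun i => `|U i x|)).
    by apply: nnseries_is_cvg => //; move: Sx; rewrite fin_numElt => /andP[].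
  split; last exact: normed_cvg cs.
  move=> n; apply: le_trans (ler_norm_sum _ _ _) _.
  rewrite -lee_fin /s fineK// -sumEFin.
  exact: nneseries_lim_ge.
pose D := [set x | S x \is a fin_num].
have mD : measurable D.
  by rewrite -[D]setTI; exact: emeasurable_fin_num.
have aeD : {ae mu, forall x, D x}.
  by have := integrable_ae measurableT iS; apply: ae_imply => x /(_ I).
(* Cutting the partial sums off where [S] is infinite makes them converge everywhere, so their
   pointwise limit is measurable. *)
pose W n x := V n x * \1_D x.
pose u x := limn (W^~ x).
have mV n : measurable_fun setT (V n).
  by apply: measurable_sum => i; exact: intR_measurable (iU i).
have WD n x : D x -> W n x = V n x by move=> Dx; rewrite /W indicE mem_set// mulr1.
have WND n x : ~ D x -> W n x = 0 by move=> Dx; rewrite /W indicE memNset// mulr0.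
have Wu x : W ^~ x @ \oo --> u x.
  have [Dx|NDx] := pselect (D x).
    have -> : W ^~ x = V ^~ x by apply/funext => n; exact: WD.
    rewrite /u (_ : W ^~ x = V ^~ x); last by apply/funext => n; exact: WD.
    exact: (SV x Dx).2.
  rewrite /u (_ : W ^~ x = cst 0); last by apply/funext => n; exact: WND.
  by rewrite lim_cst//; exact: cvg_cst.
have mW n : measurable_fun setT (W n).
  by apply: measurable_funM => //; exact: measurable_indic.
have mu_ : measurable_fun setT u.
  by apply: (measurable_fun_cvg mW) => x _; exact: Wu.
have s0 x : 0 <= s x by apply: fine_ge0; exact: nneseries_ge0.
have Ws n x : `|W n x| <= s x.
  have [Dx|NDx] := pselect (D x); first by rewrite WD//; exact: (SV x Dx).1.
  by rewrite WND// normr0.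
have iu : intR u.
  apply: le_integrable is_ => //; first exact/measurable_EFinP.
  move=> x _ /=; rewrite lee_fin [leRHS]ger0_norm//.
  exact: cvg_norm_le (Wu x) (fun n => Ws n x).
exists u => //.
have ioUn : {ae mu, forall t, forall n, intR (fun y => A t y * U n y)}.
  by apply: ae_foralln => n; exact: kernel_op_ae dA (iU n).
have ios := kernel_op_ae dA is_.
suff : {ae mu, forall t, D t -> u t = phi t + kernel_op A u t}.
  by apply: ae_imply2 aeD => x Dx; exact.
apply: ae_imply2 ioUn ios => t it its Dt.
(* The operator shifts the partial sums by one index; the limit of this identity is the equation. *)
have oV n : kernel_op A (V n) t = V n.+1 t - phi t.
  elim: n => [|n IH].
    rewrite [in RHS]/V big_nat1 subrr /kernel_op.
    under eq_Rintegral do rewrite /V big_geq// mulr0.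
    by rewrite /Rintegral integral0.
  have iV m : intR (fun y => A t y * V m y).
    have := @integrable_sum _ _ _ mu setT measurableT _ (index_iota 0 m) xpredT _ (fun i _ => it i).
    congr (_.-integrable _ _); apply/funext => y/=.
    by rewrite sumEFin mulr_sumr.
  rewrite /V [RHS]addrC big_nat_recr//= addrA [- _ + _]addrC -IH /kernel_op -RintegralD//.
  by apply: eq_Rintegral => y _; rewrite /V big_nat_recr//= mulrDr.
have [|||||_ cvA] := @Rintegral_dominated_cvg (fun n y => A t y * V n y) (fun y => A t y * u y)
  (fun y => `|A t y * s y|).
- move=> n; apply: measurable_funM => //; exact: (@measurable_section2 _ _ _ A).
- by apply: measurable_funM => //; exact: (@measurable_section2 _ _ _ A).
- apply: ae_imply aeD => y Dy; apply: cvgMl_tmp.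
  have -> : V ^~ y = W ^~ y by apply/funext => n; rewrite WD.
  exact: Wu.
- exact: integrable_norm its.
- apply: ae_imply aeD => y Dy n; rewrite !normrM ler_wpM2l// [leRHS]ger0_norm//.
  exact: (SV y Dy).1.
have cvV : V ^~ t @ \oo --> u t.
  have -> : V ^~ t = W ^~ t by apply/funext => n; rewrite WD.
  exact: Wu.
have {}cvV : V n.+1 t @[n --> \oo] --> u t by move: cvV; rewrite -cvg_shiftS.
have cvV' : kernel_op A (V n) t @[n --> \oo] --> u t - phi t.
  under eq_fun do rewrite oV.
  by apply: cvgB => //; exact: cvg_cst.
have -> : kernel_op A u t = u t - phi t by exact: cvg_unique cvA cvV'.
by rewrite addrC subrK.
Unshelve. all: by end_near.
Qed.
End contraction.

(** * Second-kind Volterra equations in L^1 *)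

Section volterra.
Context {R : realType}.
Notation mu := (@lebesgue_measure R).
Notation intR f := (mu.-integrable setT (EFin \o f)).
Implicit Types (f g h u v : R -> R) (A B : R -> R -> R) (a : R -> R) (b c x y t : R).

Lemma measurable_exp_scale c : measurable_fun setT (fun x : R => expR (c * x)).
Proof. by apply: measurableT_comp => //; exact: measurable_funM. Qed.

Lemma norm_exp_weight_le c x y : 0 <= c -> (x <= 0 -> y = 0) ->
  `|expR (- c * x) * y| <= `|y|.
Proof.
move=> c0 xy; have [/xy ->|x0] := leP x 0; first by rewrite mulr0.
rewrite normrM ler_piMl// ger0_norm ?expR_ge0// -[leRHS]expR0 ler_expR.
by rewrite mulNr oppr_le0 mulr_ge0// ltW.
Qed.

Lemma exp_weight_integrable c f : 0 <= c -> (forall x, x <= 0 -> f x = 0) ->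
  intR f -> intR (fun x => expR (- c * x) * f x).
Proof.
move=> c0 f0 if_; have mf := intR_measurable if_; apply: le_integrable if_ => //.
  apply/measurable_EFinP; apply: measurable_funM; first exact: measurable_exp_scale.
  by [].
by move=> x _ /=; rewrite lee_fin norm_exp_weight_le//; exact: f0.
Qed.

(* The weight [exp (- c x)] turns a Volterra kernel into a contraction of L^1
   without any smallness or iteration. *)
Lemma exp_weight_small a : intR a -> (forall x, x <= 0 -> a x = 0) ->
  exists2 c, 0 <= c & \int[mu]_x (expR (- c * x) * a x) < 1.
Proof.
move=> ia a0; have ma := intR_measurable ia.
have [|||||_] := @Rintegral_dominated_cvg R (fun n x => expR (- n%:R * x) * a x) (fun=> 0)
  (fun x => `|a x|).
- by move=> n; apply: measurable_funM => //; exact: measurable_exp_scale.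
- exact: measurable_cst.
- apply: aeW => x; have [x0|x0] := leP x 0.
    by under eq_fun do rewrite a0// mulr0; exact: cvg_cst.
  rewrite -[X in _ --> X](mul0r (a x)); apply: cvgMr_tmp.
  apply/cvgrPdist_lt => e e0.
  near=> n; rewrite sub0r normrN ger0_norm ?expR_ge0// mulNr expRN.
  rewrite invf_plt ?posrE ?expR_gt0//.
  apply: (@lt_le_trans _ _ (1 + n%:R * x)); last exact: expR_ge1Dx.
  rewrite ltr_pwDl// -ler_pdivrMr//.
  by near: n; exact: nbhs_infty_ger.
- exact: integrable_norm ia.
- by apply: aeW => x n; rewrite norm_exp_weight_le//; exact: a0.
rewrite {2}/Rintegral integral0 => /cvgrPdist_lt /(_ _ ltr01) [N _ /(_ N (leqnn N))].
rewrite sub0r normrN => h; exists N%:R => //.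
exact: le_lt_trans (ler_norm _) h.
Unshelve. all: by end_near.
Qed.

(** The conjugate of the operator by multiplication with exp(-c t). Its fixed points are the
    weighted fixed points of [A], and the dominating function picks up the factor exp(-c x). *)
Definition exp_conj c A t y := expR (- c * (t - y)) * A t y.

Lemma exp_conj_dominated c A a : 0 <= c -> (forall x, x <= 0 -> a x = 0) ->
  dominated_kernel A a ->
  dominated_kernel (exp_conj c A) (fun x => expR (- c * x) * a x).
Proof.
move=> c0 a0 [mA ia Aa]; split.
- apply: measurable_funM => //; apply: measurableT_comp => //.
  apply: measurable_funM => //; exact: measurable_funB.
- exact: exp_weight_integrable.
- by move=> t y; rewrite normrM ger0_norm ?expR_ge0// ler_wpM2l// expR_ge0.
Qed.

Lemma exp_conj_op c A a u t : dominated_kernel A a -> measurable_fun setT u ->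
  kernel_op (exp_conj c A) (fun y => expR (- c * y) * u y) t =
  expR (- c * t) * kernel_op A u t.
Proof.
move=> [mA _ _] mu_; rewrite mulrC /kernel_op -Rintegral_mulr; last first.
  by apply: measurable_funM => //; exact: (@measurable_section2 _ _ _ A).
apply: eq_Rintegral => y _; rewrite /exp_conj mulrACA -expRD mulrC.
by congr (_ * expR _); ring.
Qed.

Lemma volterra_equation_unique A a b h : dominated_kernel A a ->
  (forall x, x <= 0 -> a x = 0) -> intR h -> (forall t, t \notin `]0, b[ -> h t = 0) ->
  {ae mu, forall t, t \in `]0, b[ -> h t = kernel_op A h t} ->
  {ae mu, forall t, h t = 0}.
Proof.
move=> dA a0 ih h0 hA; have [_ ia _] := dA.
have [c c0 ca] := exp_weight_small ia a0.
have mh := intR_measurable ih.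
have ihc : intR (fun y => expR (- c * y) * h y).
  apply: exp_weight_integrable => // x x0; apply: h0.
  by rewrite in_itv/= ltNge x0.
have := kernel_contraction_unique (exp_conj_dominated c0 a0 dA) ca ihc.
suff H : {ae mu, forall t, `|expR (- c * t) * h t| <=
    `|kernel_op (exp_conj c A) (fun y => expR (- c * y) * h y) t|}.
  move=> /(_ H); apply: ae_imply => t /eqP; rewrite mulf_eq0 expR_eq0/=.
  by move/eqP.
apply: ae_imply hA => t ht; rewrite (exp_conj_op _ _ dA mh).
have [/ht ->//|/h0 ->] := boolP (t \in `]0, b[).
by rewrite mulr0 normr0.
Qed.

Lemma volterra_equation_solvable A a b (phi : R -> R) :
  dominated_kernel A a -> (forall x, x <= 0 -> a x = 0) ->
  (forall t y, t \notin `]0, b[ -> A t y = 0) ->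
  intR phi -> (forall t, t \notin `]0, b[ -> phi t = 0) ->
  exists u, [/\ intR u, forall t, t \notin `]0, b[ -> u t = 0 &
    {ae mu, forall t, t \in `]0, b[ -> u t = phi t + kernel_op A u t}].
Proof.
move=> dA a0 A0 iphi phi0; have [mA ia _] := dA.
have [c c0 ca] := exp_weight_small ia a0.
have mphi := intR_measurable iphi.
have iphic : intR (fun y => expR (- c * y) * phi y).
  apply: exp_weight_integrable => // x x0; apply: phi0.
  by rewrite in_itv/= ltNge x0.
have [v iv vE] := kernel_contraction_solution (exp_conj_dominated c0 a0 dA) ca iphic.
have mv := intR_measurable iv.
pose u t := expR (c * t) * v t * \1_(`]0, b[%classic) t.
have u0 t : t \notin `]0, b[ -> u t = 0.
  by move=> tb; rewrite /u indicE memNset ?mulr0//; exact/negP.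
have uE t : t \in `]0, b[ -> u t = expR (c * t) * v t.
  by move=> tb; rewrite /u indicE mem_set ?mulr1//.
have mu_ : measurable_fun setT u.
  apply: measurable_funM; last exact: measurable_indic.
  by apply: measurable_funM => //; exact: measurable_exp_scale.
have iu : intR u.
  apply: (@le_integrable _ _ _ mu setT _ _ (EFin \o (fun x => expR (c * b) * v x))) => //.
  - exact/measurable_EFinP.
  - move=> x _ /=; rewrite lee_fin.
    have [xb|/u0 ->] := boolP (x \in `]0, b[); last by rewrite normr0.
    rewrite uE// !normrM ler_wpM2r// !ger0_norm ?expR_ge0// ler_expR ler_wpM2l//.
    by move: xb; rewrite in_itv/= => /andP[_ /ltW].
  - by have := integrableZl measurableT (expR (c * b)) iv.
exists u; split => //.
(* The cut-off loses nothing: outside the interval the kernel and the free term vanish, hence so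
   does [v] almost everywhere. *)
have v0 : {ae mu, forall t, v t = expR (- c * t) * u t}.
  apply: ae_imply vE => t vt; have [tb|tb] := boolP (t \in `]0, b[).
    by rewrite uE// mulrA -expRD mulNr addNr expR0 mul1r.
  rewrite u0// mulr0 vt phi0// mulr0 add0r /kernel_op.
  under eq_Rintegral do rewrite /exp_conj A0// mulr0 mul0r.
  by rewrite /Rintegral integral0.
apply: (ae_imply2 _ vE v0) => t vt _ tb.
rewrite uE// vt.
have -> : kernel_op (exp_conj c A) v t = expR (- c * t) * kernel_op A u t.
  rewrite -(exp_conj_op _ _ dA mu_).
  have mAt : measurable_fun setT (exp_conj c A t).
    by have [mAc _ _] := exp_conj_dominated c0 a0 dA; exact: (@measurable_section2 _ _ _ (exp_conj c A)).
  apply: ae_eq_Rintegral.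
  - exact: measurable_funM.
  - by apply: measurable_funM => //; apply: measurable_funM => //; exact: measurable_exp_scale.
  - by apply: ae_imply v0 => y ->.
by rewrite -mulrDr mulrA -expRD mulNr addrN expR0 mul1r.
Qed.

End volterra.

(** * The fundamental theorem of calculus for absolutely continuous functions *)

Section clamp.
Context {R : realType}.
Implicit Types (M x y : R).

Definition clamp M x : R := Num.max (- M) (Num.min x M).

Lemma clamp_norm M x : 0 <= M -> `|clamp M x| <= M.
Proof.
move=> M0; rewrite /clamp ler_norml le_max lexx/= ge_max ge_min lexx orbT andbT.
by lra.
Qed.

Lemma clamp_id M x : `|x| <= M -> clamp M x = x.
Proof.
by rewrite ler_norml => /andP[Mx xM]; rewrite /clamp (min_idPl xM) (max_idPr Mx).
Qed.

Lemma clamp_norm_le M x : 0 <= M -> `|clamp M x| <= `|x|.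
Proof.
move=> M0; have [/clamp_id ->//|/ltW] := leP `|x| M.
exact: le_trans (clamp_norm x M0).
Qed.

Lemma normr_clamp M x : 0 <= M -> `|clamp M x| = Num.min `|x| M.
Proof.
move=> M0; have [xM|Mx] := leP `|x| M; first by rewrite clamp_id.
move: Mx; rewrite /clamp; case: (ger0P x) => x0 xM.
  by rewrite (min_idPr (ltW xM)) max_r ?ger0_norm//; lra.
by rewrite min_l ?max_l ?normrN ?ger0_norm//; lra.
Qed.

Lemma clamp_dist M x : 0 <= M -> `|x - clamp M x| <= `|x|.
Proof.
move=> M0; have [/clamp_id ->|] := leP `|x| M; first by rewrite subrr normr0.
rewrite /clamp; case: (ger0P x) => x0 xM.
  rewrite (min_idPr (ltW xM)) max_r; last by lra.
  by rewrite ger0_norm; lra.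
rewrite min_l; last by lra.
by rewrite max_l ?opprK ?ler0_norm; lra.
Qed.

Lemma clamp_lipschitz M x y : `|clamp M x - clamp M y| <= `|x - y|.
Proof.
rewrite /clamp !maxEle !minEle ler_norml.
have := ler_norm (x - y); have := ler_norm (y - x); rewrite (distrC y).
move=> ? ?; apply/andP; case: (leP x M) => ?; case: (leP y M) => ?;
  case: (leP (- M) x) => ?; case: (leP (- M) y) => ?; case: (leP (- M) M) => ?;
  split; lra.
Qed.

Lemma clamp_cvg M (v : nat -> R) x : v @ \oo --> x ->
  clamp M (v n) @[n --> \oo] --> clamp M x.
Proof.
move=> /cvgrPdist_le vx; apply/cvgrPdist_le => e e0.
have := vx _ e0; apply: filterS => n; apply: le_trans.
exact: clamp_lipschitz.
Qed.

Lemma measurable_clamp M : measurable_fun setT (clamp M).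
Proof. by apply: measurable_maxr => //; exact: measurable_minr. Qed.

End clamp.

Lemma derivable_cvg_quotient (R : realType) (F : R -> R) (x : R) :
  derivable F x 1 ->
  h^-1 *: (F (h + x) - F x) @[h --> 0^'] --> F^`()%classic x.
Proof.
rewrite /derivable derive1E /derive.
rewrite [X in _ -> X @ _ --> _](_ : _ = fun h : R => h^-1 *: ((F \o shift x) h%:A - F x))//.
by apply/funext => h; rewrite /= [X in _ = _ *: (F (X + _) - _)]mulr1.
Qed.

Section abs_continuous_FTC.
Context {R : realType}.
Notation mu := (@lebesgue_measure R).
Notation intR f := (mu.-integrable setT (EFin \o f)).
Variables (T : R) (T0 : 0 < T).
Implicit Types (F f g : R -> R) (n : nat).

(** Uniform subdivisions of [0,T], with n + 1 cells to keep the mesh defined at n = 0. The step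
    functions with the slopes of F on the cells integrate exactly to F(T) - F(0) and tend to F'
    wherever F is differentiable; absolute continuity makes them uniformly integrable, so the limit
    passes through the integral. *)
Definition mesh n : R := T / n.+1%:R.
Definition node n (j : nat) : R := j%:R * mesh n.
Definition slope F n (j : nat) : R := (F (node n j.+1) - F (node n j)) / mesh n.

Lemma mesh_gt0 n : 0 < mesh n. Proof. by rewrite divr_gt0. Qed.

Lemma nodeS n j : node n j.+1 = node n j + mesh n.
Proof. by rewrite /node -natr1 mulrDl mul1r. Qed.

Lemma node0 n : node n 0 = 0. Proof. by rewrite /node mul0r. Qed.

Lemma node_last n : node n n.+1 = T.
Proof. by rewrite /node /mesh mulrC divfK// pnatr_eq0. Qed.

Lemma le_node n i j : (i <= j)%N -> node n i <= node n j.
Proof. by move=> ij; rewrite /node ler_pM2r ?mesh_gt0// ler_nat. Qed.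

Lemma node_bounds n (j : 'I_n.+1) : [/\ 0 <= node n j, node n j <= node n j.+1 & node n j.+1 <= T].
Proof.
split; last by rewrite -(node_last n); exact: le_node.
- by rewrite -(node0 n); exact: le_node.
- exact: le_node.
Qed.

Lemma sum_cells_lt F e d n (B : {set 'I_n.+1}) :
  (forall (n : nat) (x y : 'I_n -> R),
      (forall i, 0 <= x i /\ x i <= y i /\ y i <= T) ->
      trivIset [set: 'I_n] (fun i => `]x i, y i[%classic) ->
      \sum_(i < n) (y i - x i) < d ->
      \sum_(i < n) `|F (y i) - F (x i)| < e) ->
  #|B|%:R * mesh n < d ->
  \sum_(j in B) `|F (node n j.+1) - F (node n j)| < e.
Proof.
move=> acF Bd.
pose y (j : 'I_n.+1) := if j \in B then node n j.+1 else node n j.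
have := acF n.+1 (fun j => node n j) y.
have -> : \sum_(i < n.+1) `|F (y i) - F (node n i)| =
          \sum_(j in B) `|F (node n j.+1) - F (node n j)|.
  rewrite [RHS]big_mkcond/=; apply: eq_bigr => i _; rewrite /y.
  by case: ifP => // _; rewrite subrr normr0.
apply.
- move=> i; have [? ? ?] := node_bounds i; rewrite /y; case: ifP => // _; split => //.
  by split => //; exact: le_trans (_ : node n i <= node n i.+1) _.
- move=> i j _ _ [z [/=]]; rewrite !in_itv/= => /andP[iz zi] /andP[jz zj].
  have h k : y k <= node n k.+1.
    by rewrite /y; case: ifP => // _; have [] := node_bounds k.
  apply/val_inj => /=; apply/eqP; rewrite eqn_leq.
  apply/andP; split; rewrite leqNgt; apply/negP => /(le_node n) ij.
    by have := lt_trans iz zj; rewrite ltNge (le_trans (h _) ij).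
  by have := lt_trans jz zi; rewrite ltNge (le_trans (h _) ij).
- suff -> : \sum_(i < n.+1) (y i - node n i) = #|B|%:R * mesh n by [].
  transitivity (\sum_(j in B) mesh n); last by rewrite sumr_const mulr_natl.
  rewrite [RHS]big_mkcond/=; apply: eq_bigr => i _; rewrite /y.
  by case: ifP => // _; rewrite ?subrr// nodeS addrC addKr.
Qed.

(* Uniform integrability of the difference quotients: cells of slope above [2 e / d]
   and of total length between [d / 2] and [d] would have total increment at least
   [e], contradicting absolute continuity. *)
Lemma slope_tail F e : abs_continuous 0 T F -> 0 < e ->
  exists2 M, 0 <= M & \forall n \near \oo,
    \sum_(j < n.+1 | M < `|slope F n j|) `|F (node n j.+1) - F (node n j)| < e.
Proof.
move=> acF e0; have [d d0 /= acd] := acF _ e0.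
exists (2 * e / d); first by rewrite divr_ge0 ?mulr_ge0// ltW.
near=> n.
have md : mesh n < d / 2.
  rewrite /mesh ltr_pdivrMr//.
  rewrite -ltr_pdivrMl ?divr_gt0//.
  apply: (@lt_le_trans _ _ n%:R); last by rewrite ler_nat.
  by near: n; exact: nbhs_infty_gtr.
pose B := [set j : 'I_n.+1 | 2 * e / d < `|slope F n j|]%SET.
have -> : \sum_(j < n.+1 | 2 * e / d < `|slope F n j|) `|F (node n j.+1) - F (node n j)| =
   \sum_(j in B) `|F (node n j.+1) - F (node n j)|.
  by apply: eq_bigl => j; rewrite inE.
have m0 := mesh_gt0 n.
have [Bd|dB] := ltP (#|B|%:R * mesh n) d; first exact: sum_cells_lt acd Bd.
(* The least number of cells whose total length exceeds d / 2; since one cell is shorter than d / 2,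
   that length is still below d. Exactly m of the steep cells are then selected. *)
pose m := (Num.truncn (d / 2 / mesh n)).+1.
have /andP[tm1 tm2] : (Num.truncn (d / 2 / mesh n))%:R <= d / 2 / mesh n < m%:R.
  by rewrite truncn_itv// divr_ge0// ?divr_ge0// ltW.
have hm1 : d / 2 < m%:R * mesh n by rewrite -ltr_pdivrMr.
have hm2 : m%:R * mesh n < d.
  rewrite /m -natr1 mulrDl mul1r; rewrite ler_pdivlMr// in tm1; lra.
have mB : (m <= #|B|)%N.
  rewrite -(ler_nat R) -(ler_pM2r m0); apply: le_trans dB; exact: ltW.
have /card_geqP[s [us sm sB]] := mB.
pose B' := [set j in s]%SET.
have cB' : #|B'| = m by rewrite cardsE (card_uniqP us).
have := sum_cells_lt (B := B') acd; rewrite cB' => /(_ hm2).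
rewrite ltNge => /negP; case.
apply: (@le_trans _ _ (\sum_(j in B') (2 * e / d * mesh n))).
  rewrite sumr_const cB' -[leRHS]mulr_natl mulrCA.
  rewrite -ler_pdivrMl ?divr_gt0 ?mulr_gt0// invf_div -mulrA.
  apply: le_trans (ltW hm1); rewrite le_eqVlt; apply/orP; left; apply/eqP.
  by field; rewrite gt_eqF.
apply: ler_sum => j; rewrite inE => /sB; rewrite inE => /ltW.
by rewrite /slope normrM normfV (gtr0_norm m0) ler_pdivlMr.
Unshelve. all: by end_near.
Qed.
(** Half-open, so that the cells partition []0, T]] and each point, nodes included, has exactly one
    slope. *)
Definition cell n (j : nat) : set R := `]node n j, node n j.+1]%classic.
Definition step n (c : nat -> R) x : R := \sum_(j < n.+1) c j * \1_(cell n j) x.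

Lemma cell_exists n x : 0 < x -> x <= T -> exists j : 'I_n.+1, cell n j x.
Proof.
move=> x0 xT.
have ex : exists k, x <= node n k.+1 by exists n; rewrite node_last.
case: (ex_minnP ex) => k xk kmin.
have kn : (k < n.+1)%N by rewrite ltnS; apply: kmin; rewrite node_last.
exists (Ordinal kn); rewrite /cell /= in_itv/= xk andbT.
case: k kmin {xk kn} => [|k] kmin; first by rewrite node0.
by rewrite ltNge; apply/negP => /kmin; rewrite ltnn.
Qed.

Lemma cell_disjoint n (i j : nat) x : cell n i x -> cell n j x -> i = j.
Proof.
rewrite /cell /= !in_itv/= => /andP[ix xi] /andP[jx xj].
apply/eqP; rewrite eqn_leq.
apply/andP; split; rewrite leqNgt; apply/negP => /(le_node n) ij.
  by have := lt_le_trans ix xj; rewrite ltNge ij.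
by have := lt_le_trans jx xi; rewrite ltNge ij.
Qed.

Lemma step_cell n c (j : 'I_n.+1) x : cell n j x -> step n c x = c j.
Proof.
move=> jx; rewrite /step (bigD1 j)//= big1 ?addr0; last first.
  move=> i ij; rewrite indicE memNset ?mulr0// => ix.
  by move/eqP: ij; apply; apply/val_inj; exact: cell_disjoint ix jx.
by rewrite indicE mem_set// mulr1.
Qed.

Lemma step_out n c x : ~ `]0, T]%classic x -> step n c x = 0.
Proof.
move=> xT; rewrite /step big1// => j _; rewrite indicE memNset ?mulr0//.
move=> jx; apply: xT; move: jx; rewrite /cell /= !in_itv/= => /andP[jx xj].
have [? ? ?] := node_bounds j; rewrite (le_lt_trans _ jx)//=.
exact: le_trans xj _.
Qed.

Lemma step_comp n c x (h : R -> R) : h 0 = 0 ->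
  h (step n c x) = step n (h \o c) x.
Proof.
move=> h0; have [|xT] := pselect (`]0, T]%classic x); last by rewrite !step_out.
by rewrite /= in_itv/= => /andP[x0 xT]; have [j jx] := cell_exists n x0 xT; rewrite !(step_cell _ jx).
Qed.

Lemma measurable_cell n j : measurable (cell n j).
Proof. exact: measurable_itv. Qed.

Lemma measurable_step n c : measurable_fun setT (step n c).
Proof.
apply: measurable_sum => j; apply: measurable_funM => //.
exact: measurable_indic (measurable_cell n j).
Qed.

Lemma mu_cell n j : mu (cell n j) = (mesh n)%:E.
Proof.
rewrite /cell lebesgue_measure_itv/= lte_fin nodeS ltrDl mesh_gt0.
by rewrite -EFinB addrC addKr.
Qed.

Lemma integrable_cell n j c : intR (fun x => c * \1_(cell n j) x).
Proof.
have := @integrableZl _ _ _ mu setT measurableT c (EFin \o \1_(cell n j)); apply.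
apply/integrableP; split.
  by apply/measurable_EFinP; exact: measurable_indic (measurable_cell n j).
under eq_integral do rewrite /= ger0_norm//.
by rewrite integral_indic//= ?setIT ?mu_cell ?ltry//; exact: measurable_cell.
Qed.

Lemma integral_cell n j c :
  (\int[mu]_x (c * \1_(cell n j) x)%:E = (c * mesh n)%:E)%E.
Proof.
under eq_integral do rewrite EFinM.
rewrite integralZl//; last first.
  by have := integrable_cell n j 1; under eq_fun do rewrite mul1r.
rewrite integral_indic//; last exact: measurable_cell.
by rewrite setIT EFinM; congr (_ * _)%E; exact: mu_cell.
Qed.

Lemma Rintegral_step n c : \int[mu]_x step n c x = \sum_(j < n.+1) c j * mesh n.
Proof.
rewrite /Rintegral; under eq_integral do rewrite -sumEFin.
rewrite integral_sum//; last by move=> j; exact: integrable_cell.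
by under eq_bigr do rewrite integral_cell; rewrite sumEFin.
Qed.

(** The cell of x contains x without having it as an end in general, so the slope is not a
    difference quotient at x; it is an average of the two quotients from x to the ends of the
    cell. *)
Lemma step_slope_cvg F x : 0 < x -> x <= T -> derivable F x 1 ->
  step n (slope F n) x @[n --> \oo] --> F^`()%classic x.
Proof.
move=> x0 xT dF.
have := derivable_cvg_quotient dF.
move=> /cvgrPdist_le cv; apply/cvgrPdist_le => e e0.
have [r /= r0 hr] := cv _ e0.
near=> n.
have mr : mesh n < r.
  rewrite /mesh ltr_pdivrMr// -ltr_pdivrMl//.
  apply: (@lt_le_trans _ _ n%:R); last by rewrite ler_nat.
  by near: n; exact: nbhs_infty_gtr.
have [j jx] := cell_exists n x0 xT.
rewrite (step_cell _ jx).
set D := F^`()%classic x in hr *.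
(* Multiplied out, the estimate also covers an end of the cell equal to x, and the two one-sided
   errors add up to at most e times the mesh. *)
have straddle y : `|y - x| < r -> `|D * (y - x) - (F y - F x)| <= e * `|y - x|.
  have [->|yx] := eqVneq y x; first by rewrite !subrr mulr0 subrr normr0 mulr0.
  move=> yr; have := hr (y - x).
  rewrite /= sub0r normrN => /(_ yr); rewrite subr_eq0 => /(_ yx).
  rewrite subrK => h.
  have yx0 : 0 < `|y - x| by rewrite normr_gt0 subr_eq0.
  rewrite -ler_pdivrMr// -normfV -normrM mulrBl mulfK ?subr_eq0//.
  by rewrite [(F y - F x) / _]mulrC.
have m0 := mesh_gt0 n.
move: jx; rewrite /cell /= in_itv/= => /andP[jx xj].
rewrite nodeS in xj.
have e1 : `|node n j + mesh n - x| = node n j + mesh n - x by rewrite ger0_norm ?subr_ge0.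
have e2 : `|node n j - x| = x - node n j by rewrite ler0_norm ?opprB// subr_le0 ltW.
have := straddle (node n j + mesh n); rewrite e1 => /(_ ltac:(lra)) h1.
have := straddle (node n j); rewrite e2 => /(_ ltac:(lra)) h2.
rewrite -(ler_pM2r m0) -[X in _ * X <= _](gtr0_norm m0) -normrM mulrBl /slope divfK ?gt_eqF// nodeS.
have -> : D * mesh n - (F (node n j + mesh n) - F (node n j)) =
  (D * (node n j + mesh n - x) - (F (node n j + mesh n) - F x)) -
  (D * (node n j - x) - (F (node n j) - F x)) by ring.
apply: le_trans (ler_normB _ _) _; apply: le_trans (lerD h1 h2) _.
rewrite le_eqVlt; apply/orP; left; apply/eqP; ring.
Unshelve. all: by end_near.
Qed.

Variables (F f : R -> R).
Hypothesis acF : abs_continuous 0 T F.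
Hypothesis mf : measurable_fun setT f.
Hypothesis f0 : forall x, ~ `]0, T[%classic x -> f x = 0.
Hypothesis dF : {ae mu, forall t, `]0, T[%classic t ->
  derivable F t 1 /\ F^`()%classic t = f t}.

Let stepF n := step n (slope F n).

Lemma step_slope_ae : {ae mu, forall x, stepF n x @[n --> \oo] --> f x}.
Proof.
have nT : {ae mu, forall x, x <> T}.
  exists [set T]; split => //; first exact: lebesgue_measure_set1.
  by move=> x /= /contrapT.
apply: (ae_imply2 _ dF nT) => x xd xT.
have [xi|xi] := pselect (`]0, T[%classic x).
  have [dx <-] := xd xi; move: xi; rewrite /= in_itv/= => /andP[x0 xlT].
  by apply: step_slope_cvg => //; exact: ltW.
have xo : ~ `]0, T]%classic x.
  rewrite /= in_itv/= le_eqVlt => /andP[x0 /orP[/eqP//|xlT]].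
  by apply: xi; rewrite /= in_itv/= x0.
rewrite f0// (_ : (fun n => _) = cst 0); first exact: cvg_cst.
by apply/funext => n; rewrite /stepF step_out.
Qed.

Lemma Rintegral_step_slope n : \int[mu]_x stepF n x = F T - F 0.
Proof.
rewrite Rintegral_step; have -> : F T - F 0 = F (node n n.+1) - F (node n 0).
  by rewrite node_last node0.
rewrite -(telescope_sumr (fun j => F (node n j)) (leq0n n.+1)) big_mkord.
by apply: eq_bigr => j _; rewrite /slope divfK// gt_eqF// mesh_gt0.
Qed.

(** Truncation at a level above M0 alters only cells of slope above M0, and changes each by at most
    its increment. The remaining cells contribute at most M0 T to the L^1 norm. *)
Lemma Rintegral_clamp_step n M0 M : 0 <= M0 -> M0 <= M ->
  `|F T - F 0 - \int[mu]_x clamp M (stepF n x)| <=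
  \sum_(j < n.+1 | M0 < `|slope F n j|) `|F (node n j.+1) - F (node n j)| /\
  \int[mu]_x `|clamp M (stepF n x)| <= M0 * T +
  \sum_(j < n.+1 | M0 < `|slope F n j|) `|F (node n j.+1) - F (node n j)|.
Proof.
move=> M00 M0M; have M_0 := le_trans M00 M0M.
have c0 : clamp M 0 = 0 by apply: clamp_id; rewrite normr0.
have m0 := mesh_gt0 n.
have slopeE j : `|slope F n j| = `|F (node n j.+1) - F (node n j)| / mesh n.
  by rewrite /slope normrM normfV (gtr0_norm m0).
split.
  rewrite -(Rintegral_step_slope n).
  under [X in _ - X]eq_Rintegral do rewrite /stepF (step_comp _ _ _ c0).
  rewrite !Rintegral_step -sumrB [leRHS]big_mkcond/=.
  apply: le_trans (ler_norm_sum _ _ _) _; apply: ler_sum => j _.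
  rewrite -mulrBl normrM (gtr0_norm m0); case: ifPn => Mj.
    by rewrite -ler_pdivlMr// -slopeE; exact: clamp_dist.
  by rewrite clamp_id ?subrr ?normr0 ?mul0r//= (le_trans _ M0M)// leNgt.
have n0 : `|clamp M 0| = 0 by rewrite c0 normr0.
under eq_Rintegral do rewrite /stepF (step_comp _ _ _ (h := fun x => `|clamp M x|) n0).
rewrite Rintegral_step.
have -> : M0 * T = \sum_(j < n.+1) M0 * mesh n.
  rewrite sumr_const card_ord -mulr_natl mulrCA /mesh.
  by rewrite [n.+1%:R * _]mulrC divfK// pnatr_eq0.
rewrite [X in _ + X]big_mkcond/= -big_split/=.
apply: ler_sum => j _; case: ifPn => Mj.
  rewrite -ler_pdivlMr// mulrDl mulfK ?gt_eqF// -slopeE.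
  by rewrite ler_wpDl// clamp_norm_le.
by rewrite addr0 ler_pM2r// (le_trans (clamp_norm_le _ _))// leNgt.
Qed.

Lemma clamp_step_cvg M : 0 <= M -> [/\ intR (fun x => clamp M (f x)),
  \int[mu]_x clamp M (stepF n x) @[n --> \oo] --> \int[mu]_x clamp M (f x) &
  \int[mu]_x `|clamp M (stepF n x)| @[n --> \oo] --> \int[mu]_x `|clamp M (f x)|].
Proof.
move=> M0; have c0 : clamp M 0 = 0 by apply: clamp_id; rewrite normr0.
have iM : intR (fun x => M * \1_(`]0, T]%classic) x).
  have := @integrableZl _ _ _ mu setT measurableT M (EFin \o \1_(`]0, T]%classic)); apply.
  apply/integrableP; split.
    by apply/measurable_EFinP; exact: measurable_indic.
  under eq_integral do rewrite /= ger0_norm//.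
  by rewrite integral_indic//= setIT lebesgue_measure_itv/= lte_fin T0 -EFinB ltry.
have bd n x : `|clamp M (stepF n x)| <= M * \1_(`]0, T]%classic) x.
  have [xT|xT] := pselect (`]0, T]%classic x).
    by rewrite indicE mem_set// mulr1 clamp_norm.
  by rewrite /stepF step_out// c0 normr0 mulr_ge0.
have mc n : measurable_fun setT (fun x => clamp M (stepF n x)).
  by apply: measurableT_comp; [exact: measurable_clamp|exact: measurable_step].
have mcf : measurable_fun setT (fun x => clamp M (f x)).
  by apply: measurableT_comp => //; exact: measurable_clamp.
have [||ic cc] := @Rintegral_dominated_cvg _ _ _ _ mc mcf _ iM _.
- by apply: ae_imply step_slope_ae => x; exact: clamp_cvg.
- by apply: aeW => x n.
split=> //.
have [||||//] := @Rintegral_dominated_cvg _ (fun n x => `|clamp M (stepF n x)|)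
    (fun x => `|clamp M (f x)|) _ _ _ _ iM _.
  + by move=> n; exact: measurableT_comp.
  + exact: measurableT_comp.
  + by apply: ae_imply step_slope_ae => x cx; apply: cvg_norm; exact: clamp_cvg.
  + by apply: aeW => x n; rewrite normr_id.
Qed.

(** The mesh tends to 0 at a fixed truncation level, where dominated convergence applies. The
    threshold M0 comes from the tail estimate, and both bounds are uniform in M above it. *)
Lemma clamp_FTC e : 0 < e -> exists2 M0, 0 <= M0 & forall M, M0 <= M ->
  `|F T - F 0 - \int[mu]_x clamp M (f x)| <= e /\
  \int[mu]_x `|clamp M (f x)| <= M0 * T + e.
Proof.
move=> e0; have [M0 M00 tail] := slope_tail acF e0.
exists M0 => // M M0M; have M_0 := le_trans M00 M0M.
have [_ cv1 cv2] := clamp_step_cvg M_0.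
have [/= N _ hN] := tail.
split.
  have cv : F T - F 0 - \int[mu]_x clamp M (stepF n x) @[n --> \oo] -->
      F T - F 0 - \int[mu]_x clamp M (f x) by apply: cvgB => //; exact: cvg_cst.
  rewrite -(cvg_shiftn N) in cv.
  apply: cvg_norm_le cv _ => n.
  have [+ _] := Rintegral_clamp_step (n + N)%N M00 M0M; move/le_trans; apply.
  by apply: ltW; apply: hN; rewrite /= leq_addl.
rewrite -(cvg_shiftn N) in cv2.
apply: le_trans (ler_norm _) _; apply: cvg_norm_le cv2 _ => n.
have [_ h] := Rintegral_clamp_step (n + N)%N M00 M0M.
rewrite ger0_norm; last by apply: Rintegral_ge0.
apply: le_trans h _; rewrite lerD2l; apply: ltW; apply: hN; by rewrite /= leq_addl.
Qed.

(** The truncation level tends to infinity twice: the uniform L^1 bound and monotone convergence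
    give integrability of f, and only then dominated convergence by |f| gives the formula. *)
Lemma abs_continuous_FTC_T : intR f /\ F T - F 0 = \int[mu]_x f x.
Proof.
have cvc x : clamp n%:R (f x) @[n --> \oo] --> f x.
  apply/cvgrPdist_le => e e0; near=> n; rewrite clamp_id ?subrr ?normr0 ?ltW//.
  by near: n; exact: nbhs_infty_gtr.
have mc n : measurable_fun setT (fun x => clamp n%:R (f x)).
  by apply: measurableT_comp => //; exact: measurable_clamp.
have if_ : intR f.
  have [M0 M00 hM] := clamp_FTC ltr01.
  apply/integrableP; split; first exact/measurable_EFinP.
  apply: le_lt_trans (ltry (M0 * T + 1)).
  have /= cvm := @cvg_monotone_convergence _ _ _ mu setT measurableT
    (fun n x => `|clamp n%:R (f x)|%:E) _ _ _.
  have {}cvm : (\int[mu]_x `|clamp n%:R (f x)|%:E)%E @[n --> \oo] -->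
      (\int[mu]_x `|(f x)%:E|)%E.
    rewrite (_ : \int[mu]_x `|(f x)%:E| =
        \int[mu]_x limn (fun n => `|clamp n%:R (f x)|%:E))%E; last first.
      apply: eq_integral => x _; apply/esym/cvg_lim => //.
      by apply: cvg_EFin; [exact: nearW|apply: cvg_norm; exact: cvc].
    apply: cvm.
    - by move=> n; apply/measurable_EFinP; exact: measurableT_comp (mc n).
    - by move=> n x _; rewrite lee_fin.
    - move=> x _ n m nm; rewrite lee_fin !normr_clamp//.
      by rewrite le_min ge_min lexx/= ge_min ler_nat nm orbT.
  rewrite -(cvg_lim _ cvm)//; apply: lime_le; first by apply/cvg_ex; eexists; exact: cvm.
  near=> n.
  have Mn : M0 <= n%:R by near: n; exact: nbhs_infty_ger.
  have [_] := hM _ Mn; rewrite -lee_fin; apply: le_trans.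
  have [ic _ _] := clamp_step_cvg (ler0n _ n).
  by rewrite /Rintegral fineK//; exact: integrable_fin_num (integrable_norm ic).
split=> //.
apply/eqP; rewrite -subr_eq0 -normr_le0; apply/ler_addgt0Pr => e e0; rewrite add0r.
have [M0 M00 hM] := clamp_FTC e0.
have [||_ cv] := @Rintegral_dominated_cvg _ (fun n x => clamp n%:R (f x)) f (fun x => `|f x|) mc mf
  _ (integrable_norm if_) _.
- exact: aeW.
- by apply: aeW => x n; exact: clamp_norm_le.
have cv' : F T - F 0 - \int[mu]_x clamp n%:R (f x) @[n --> \oo] -->
      F T - F 0 - \int[mu]_x f x by apply: cvgB => //; exact: cvg_cst.
pose N := (Num.truncn M0).+1.
rewrite -(cvg_shiftn N) in cv'.
apply: cvg_norm_le cv' _ => n.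
apply: (hM _ _).1; apply: (@le_trans _ _ N%:R); last by rewrite ler_nat leq_addl.
by apply: ltW; have /andP[] := truncn_itv M00.
Unshelve. all: by end_near.
Qed.

End abs_continuous_FTC.

(** * Primitives of integrable functions *)

Section primitives.
Context {R : realType}.
Notation mu := (@lebesgue_measure R).
Notation intR f := (mu.-integrable setT (EFin \o f)).
Implicit Types (f g h r : R -> R) (c x y t T : R) (D : set R).

Definition primitive f t : R := \int[mu]_(x in `]0, t[) f x.

Lemma intRS f D : measurable D -> intR f -> mu.-integrable D (EFin \o f).
Proof. by move=> mD; exact: integrableS. Qed.

Lemma Rintegral_indicE f D : \int[mu]_(x in D) f x = \int[mu]_x (f x * \1_D x).
Proof.
rewrite Rintegral_mkcond; apply: eq_Rintegral => x _; rewrite patchE indicE.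
by case: ifPn; rewrite ?mulr1 ?mulr0.
Qed.

Lemma integrable_indic_mul f D : measurable D -> intR f ->
  intR (fun x => f x * \1_D x).
Proof.
move=> mD if_; have mf := intR_measurable if_; apply: le_integrable if_ => //.
  by apply/measurable_EFinP; apply: measurable_funM => //; exact: measurable_indic.
move=> x _ /=; rewrite lee_fin normrM ler_piMr// indicE.
by case: (_ \in _); rewrite ?normr1 ?normr0.
Qed.

Lemma integrable_fsum n (F : 'I_n -> R -> R) : (forall i, intR (F i)) ->
  intR (fun x => \sum_(i < n) F i x).
Proof.
move=> iF; have := @integrable_sum _ _ _ mu setT measurableT _ (index_enum 'I_n) xpredT
  (fun j x => (F j x)%:E) (fun j _ => iF j).
by congr (_.-integrable _ _); apply/funext => x/=; rewrite sumEFin.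
Qed.

Lemma Rintegral_sum n (F : 'I_n -> R -> R) : (forall i, intR (F i)) ->
  \int[mu]_x \sum_(i < n) F i x = \sum_(i < n) \int[mu]_x F i x.
Proof.
move=> iF; rewrite {1}/Rintegral; under eq_integral do rewrite -sumEFin.
rewrite integral_sum//.
rewrite (eq_bigr (fun i => (\int[mu]_x F i x)%:E)) ?sumEFin// => i _.
by rewrite /Rintegral fineK//; exact: integrable_fin_num (iF i).
Qed.

Lemma primitiveB f x y : intR f -> 0 <= x -> x <= y ->
  primitive f y - primitive f x = \int[mu]_(z in `]x, y[) f z.
Proof.
move=> if_ x0 xy; rewrite /primitive.
have [<-|nxy] := eqVneq x y; first by rewrite subrr set_itvoo0 Rintegral_set0.
have [x0'|x0'] := eqVneq x 0.
  by rewrite x0' set_itvoo0 Rintegral_set0 subr0.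
rewrite (@Rintegral_itv_bndo_bndc R (BRight 0) x); last exact: intRS.
rewrite Rintegral_itvB//; first exact: intRS.
by rewrite bnd_simp lt_neqAle nxy.
Qed.

Lemma le_primitiveB f x y : intR f -> 0 <= x -> x <= y ->
  `|primitive f y - primitive f x| <= \int[mu]_(z in `]x, y[) `|f z|.
Proof.
by move=> if_ x0 xy; rewrite primitiveB// le_normr_Rintegral//; exact: intRS.
Qed.

Lemma sum_Rintegral_trivIset n (I : 'I_n -> set R) f :
  intR f -> (forall i, measurable (I i)) -> trivIset setT I ->
  \sum_(i < n) \int[mu]_(x in I i) `|f x| <= \int[mu]_x `|f x|.
Proof.
move=> if_ mI tI; have inf := integrable_norm if_.
have -> : \sum_(i < n) \int[mu]_(x in I i) `|f x| =
    \int[mu]_x \sum_(i < n) (`|f x| * \1_(I i) x).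
  rewrite Rintegral_sum => [|i]; last exact: integrable_indic_mul.
  by apply: eq_bigr => i _; rewrite Rintegral_indicE.
apply: le_Rintegral => //.
  by apply: integrable_fsum => i; exact: integrable_indic_mul.
move=> x _; rewrite -mulr_sumr ler_piMr//.
have [[i Ii]|nI] := pselect (exists i, I i x); last first.
  rewrite big1// => i _; rewrite indicE memNset// => Ii; apply: nI; by exists i.
rewrite (bigD1 i)//= big1 ?addr0 ?indicE; first by case: (_ \in _).
move=> j ji; rewrite indicE memNset// => Ij; move/eqP: ji; apply.
by apply: tI => //; exists x.
Qed.

Lemma clamp_approx f e : intR f -> 0 < e ->
  exists N : nat, \int[mu]_x `|f x - clamp N%:R (f x)| < e.
Proof.
move=> if_ e0; have mf := intR_measurable if_.
have [||||_ cv] := @Rintegral_dominated_cvg R (fun n x => `|f x - clamp n%:R (f x)|)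
  (fun=> 0) (fun x => `|f x|) _ _ _ (integrable_norm if_) _.
- move=> n; apply: measurableT_comp => //; apply: measurable_funB => //.
  by apply: measurableT_comp => //; exact: measurable_clamp.
- exact: measurable_cst.
- apply: aeW => x; apply/cvgrPdist_lt => r r0; near=> n.
  rewrite clamp_id ?subrr ?normr0 ?subrr ?normr0// ltW//.
  by near: n; exact: nbhs_infty_gtr.
- by apply: aeW => x n; rewrite normr_id clamp_dist.
move: cv; rewrite {2}/Rintegral integral0 => /cvgrPdist_lt/(_ e e0).
move=> [N _ /(_ N (leqnn N))].
rewrite sub0r normrN ger0_norm; first by exists N.
by apply: Rintegral_ge0.
Unshelve. all: by end_near.
Qed.

(** Split f into a part bounded by N, whose integral is controlled by the total length of the
    intervals, and a remainder [r] of L^1 norm below e / 2, harmless because the intervals are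
    disjoint. *)
Lemma primitive_abs_continuous f T : intR f ->
  abs_continuous 0 T (primitive f).
Proof.
move=> if_ e e0; have mf := intR_measurable if_.
have [N hN] := clamp_approx if_ (divr_gt0 e0 (ltr0Sn R 1)).
pose r x := f x - clamp N%:R (f x).
have ir : intR r.
  apply: (@le_integrable _ _ _ mu setT measurableT _ (EFin \o f)) => //.
    apply/measurable_EFinP; apply: measurable_funB => //.
    by apply: measurableT_comp => //; exact: measurable_clamp.
  by move=> x _ /=; rewrite lee_fin clamp_dist.
(* The bounded part contributes at most N times the total length, below e / 2; N + 1 avoids dividing
   by zero. *)
exists (e / 2 / N.+1%:R); first by rewrite !divr_gt0.
move=> n x y xy tI sd.
have xyi i : [/\ 0 <= x i, x i <= y i & y i <= T] by have [? [? ?]] := xy i; split.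
apply: (@le_lt_trans _ _ (\sum_(i < n) (N%:R * (y i - x i) + \int[mu]_(z in `]x i, y i[) `|r z|))).
  apply: ler_sum => i _; have [x0 xyi' _] := xyi i.
  apply: le_trans (le_primitiveB if_ x0 xyi') _.
  have mxyE : mu `]x i, y i[ = (y i - x i)%:E.
    rewrite lebesgue_measure_itv/= lte_fin -EFinB; case: ltP => // yx.
    by rewrite (@le_anti _ _ (x i) (y i)) ?xyi' ?yx// subrr.
  have mxy : (mu `]x i, y i[ < +oo)%E by rewrite mxyE ltry.
  have icst : mu.-integrable `]x i, y i[ (EFin \o (fun=> N%:R : R)).
    apply/integrableP; split; first exact/measurable_EFinP/measurable_cst.
    by rewrite /= integral_cst// lte_mul_pinfty// ?lee_fin.
  have -> : N%:R * (y i - x i) = \int[mu]_(z in `]x i, y i[) N%:R.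
    transitivity (N%:R * fine (mu `]x i, y i[)); first by rewrite mxyE.
    by rewrite Rintegral_cst.
  rewrite -RintegralD//; last exact: intRS (integrable_norm ir).
  apply: le_Rintegral => //.
  - exact: intRS (integrable_norm if_).
  - exact: (integrableD _ icst (intRS _ (integrable_norm ir))).
  - move=> z _; rewrite -[f z](subrK (clamp N%:R (f z))) addrC.
    by rewrite (le_trans (ler_normD _ _))// lerD2r clamp_norm.
rewrite big_split/= -mulr_sumr.
have := sum_Rintegral_trivIset ir (fun i => measurable_itv _) tI.
move: sd hN; rewrite -/r ltr_pdivlMr// -natr1.
set A := \sum_(i < n) (y i - x i).
have : 0 <= A by apply: sumr_ge0 => i _; rewrite subr_ge0; have [] := xyi i.
rewrite mulrDr mulr1 (mulrC A).
move: (\int[mu]_x0 `|r x0|) => B.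
move: (\sum_(i < n) \int[mu]_(x0 in _) `|r x0|) => C.
move: (N%:R * A) => D'; lra.
Qed.

Lemma primitive_derivable f : intR f ->
  {ae mu, forall t, 0 < t -> derivable (primitive f) t 1 /\ (primitive f)^`()%classic t = f t}.
Proof.
move=> if_; have lf : locally_integrable setT f.
  by apply: open_integrable_locally => //; exact: openT.
have := @FTC1 R f (BRight 0) (fun y => intRS (measurable_itv _) if_) lf.
apply: ae_imply => t /= h t0.
have -> : primitive f = (fun x => \int[mu]_(t in `]0, x]) f t).
  by apply/funext => x; rewrite /primitive Rintegral_itv_bndo_bndc//; exact: intRS.
by apply: h; rewrite lte_fin.
Qed.

Lemma ae_dense (P : R -> Prop) x y : x < y -> {ae mu, forall z, P z} ->
  exists2 z, x < z < y & P z.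
Proof.
move=> xy [N [mN N0 PN]]; apply: contrapT => nz.
have : (mu `]x, y[ <= mu N)%E.
  apply: le_measure; rewrite ?inE//.
  move=> z zxy; apply: PN => Pz; apply: nz; exists z => //.
by rewrite [leRHS]N0 lebesgue_measure_itv/= lte_fin xy -EFinB lee_fin leNgt subr_gt0 xy.
Qed.

(** At a point where the primitive vanishes and has derivative r(t), zeros of the primitive
    accumulate from the right because they have full measure; the difference quotient is zero along
    them. *)
Lemma primitive_eq0 r T : intR r ->
  {ae mu, forall t, 0 < t < T -> primitive r t = 0} ->
  {ae mu, forall t, 0 < t < T -> r t = 0}.
Proof.
move=> ir pr0; apply: (ae_imply2 _ (primitive_derivable ir) pr0) => t dt pt /andP[t0 tT].
have [dr <-] := dt t0; have {}pt := pt _; rewrite t0 tT in pt; have {}pt := pt isT.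
apply/eqP; apply/negPn/negP => nz.
have := derivable_cvg_quotient dr.
move=> /cvgrPdist_lt /(_ `|(primitive r)^`()%classic t|); rewrite normr_gt0 => /(_ nz).
move=> [d /= d0 hd].
have [z /andP[tz zd] pz] : exists2 z, t < z < Num.min T (t + d) & (0 < z < T -> primitive r z = 0).
  by apply: ae_dense => //; rewrite lt_min tT ltrDl.
move: zd; rewrite lt_min => /andP[zT zd].
have := hd (z - t); rewrite /= sub0r normrN gtr0_norm ?subr_gt0// ltrBlDl => /(_ zd).
rewrite subr_eq0 gt_eqF// => /(_ isT).
by rewrite subrK pz ?zT ?(lt_trans t0 tz)// pt subrr scaler0 subr0 ltxx.
Qed.

End primitives.

(** * Everywhere differentiable functions with an integrable derivative bound *)

Section majorant.
Context {R : realType}.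
Notation mu := (@lebesgue_measure R).
Notation intR f := (mu.-integrable setT (EFin \o f)).
Implicit Types (f g h r : R -> R) (c x y t T L : R) (D : set R).

(** Continuous induction: the supremum of the points up to which the bound holds is reached by the
    local estimate on its left and passed by the one on its right, unless it is y. *)
Lemma local_increment_bound L h (Psi : R -> R) :
  (forall x y, 0 < x -> x <= y -> y < L -> Psi x <= Psi y) ->
  (forall t, 0 < t < L -> exists2 d, 0 < d & forall y, 0 < y < L ->
     `|y - t| < d -> `|h y - h t| <= `|Psi y - Psi t|) ->
  forall x y, 0 < x -> x <= y -> y < L -> `|h y - h x| <= Psi y - Psi x.
Proof.
move=> Pm loc x y x0 xy yL.
pose S := [set s | x <= s <= y /\ `|h s - h x| <= Psi s - Psi x].
have Sx : S x by split; rewrite ?lexx ?xy// !subrr normr0.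
have ubS : ubound S y by move=> s [/andP[]].
have hS : has_sup S by split; [exists x|exists y].
pose s := sup S.
have xs : x <= s by apply: ub_le_sup => //; exists y.
have sy : s <= y by apply: ge_sup => //; exists x.
have s0 : 0 < s := lt_le_trans x0 xs.
have sL : s < L := le_lt_trans sy yL.
have step u v : S u -> u <= v -> v <= y -> `|h v - h u| <= Psi v - Psi u -> S v.
  move=> [/andP[xu uy] hu] uv vy huv; split; first by rewrite (le_trans xu uv) vy.
  have -> : h v - h x = (h v - h u) + (h u - h x) by ring.
  by apply: le_trans (ler_normD _ _) _; lra.
have [d d0 hd] := loc s ltac:(by rewrite s0 sL).
have Ss : S s.
  have [u Su su] := sup_adherent d0 hS.
  have us : u <= s by apply: ub_le_sup => //; exists y.
  have [/andP[xu uy] _] := Su.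
  apply: (step u) => //.
  have u0 := lt_le_trans x0 xu.
  have := hd u; rewrite u0 (le_lt_trans uy yL) => /(_ isT).
  rewrite ler0_norm ?subr_le0// opprB ltrBlDl -ltrBlDr => /(_ su).
  rewrite distrC [leRHS]ler0_norm ?opprB// subr_le0.
  exact: Pm.
have [<-|] := eqVneq s y; first exact: Ss.2.
move=> nsy; have sy' : s < y by rewrite lt_neqAle nsy.
(* A point strictly beyond the supremum, yet within the radius d of the local estimate at s. *)
pose v := Num.min y (s + d / 2).
have sv : s < v by rewrite lt_min sy'/= ltrDl divr_gt0.
have vy : v <= y by rewrite ge_min lexx.
have Sv : S v.
  apply: (step s) => //; first exact: ltW.
  have := hd v; rewrite (lt_trans s0 sv) (le_lt_trans vy yL) => /(_ isT).
  rewrite gtr0_norm ?subr_gt0//.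
  have vd : v - s < d by rewrite ltrBlDl gt_min; apply/orP; right; lra.
  move=> /(_ vd); rewrite [leRHS]ger0_norm// subr_ge0; apply: Pm => //; first exact: ltW.
  exact: le_lt_trans vy yL.
have : v <= s by apply: ub_le_sup => //; exists y.
by rewrite leNgt sv.
Qed.

(* [psi] stands in for the lower semicontinuous majorant of Vitali-Caratheodory.
   The level set [E n] where [n <= |phi| < n + 1] is covered by an open [U n] with
   [(n + 2) mu (U n - E n) <= 2^-(n+1)], and [psi] is [|phi| + 2] plus the sum of
   [n + 2] times the indicators of [U n - E n]; near a point of [E n] it is at least
   [n + 2]. *)
Lemma derivative_majorant b (phi : R -> R) : mu.-integrable `]0, b[ (EFin \o phi) ->
  exists psi : R -> R, [/\ intR psi, forall x, 0 <= psi x &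
    forall x, 0 < x < b -> exists d c : R, [/\ 0 < d, `|phi x| + 1 <= c &
      {ae mu, forall y, 0 < y < b -> `|y - x| < d -> c <= psi y}]].
Proof.
move=> iphi; pose phi' : R -> R := phi \_ `]0, b[.
have iphi' : intR phi'.
  by rewrite /phi' -restrict_EFin -integrable_mkcond.
have mphi' := intR_measurable iphi'.
pose E (n : nat) : set R := `]0, b[ `&` (fun x => `|phi' x|) @^-1` `[n%:R, n.+1%:R[.
have mE n : measurable (E n).
  apply: measurableI => //; rewrite -[X in measurable X]setTI.
  exact: (measurableT_comp (@normr_measurable _ setT) mphi').
have muE n : (mu (E n) < +oo)%E.
  apply: (@le_lt_trans _ _ (mu `]0, b[)).
    by apply: le_measure; [apply: mem_set; exact: mE|apply: mem_set; exact: measurable_itv|exact: subIsetl].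
  by rewrite lebesgue_measure_itv/=; case: ifP => _; rewrite -?EFinB ltry.
pose e n : R := 1 / (2 ^ n.+1)%:R / n.+2%:R.
have e0 n : 0 < e n by rewrite !divr_gt0// ltr0n expn_gt0.
have /choice[U hU] : forall n, exists U : set R,
    [/\ open U, E n `<=` U & (mu (U `\` E n) < (e n)%:E)%E].
  by move=> n; exact: lebesgue_regularity_outer (mE n) (muE n) (e0 n).
have mU n : measurable (U n `\` E n).
  by apply: measurableD => //; apply: open_measurable; have [] := hU n.
pose rho (x : R) : \bar R := (\sum_(0 <= n <oo) ((n.+2%:R : R) * \1_(U n `\` E n) x)%:E)%E.
have rho0 n x : (0 <= ((n.+2%:R : R) * \1_(U n `\` E n) x)%:E)%E by rewrite lee_fin mulr_ge0.
have mrho_ n : measurable_fun setT (fun x => ((n.+2%:R : R) * \1_(U n `\` E n) x)%:E).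
  apply/measurable_EFinP; apply: measurable_funM => //; exact: measurable_indic.
have mrho : measurable_fun setT rho.
  by apply: ge0_emeasurable_sum => [n x _ _|n _]; [exact: rho0|exact: mrho_].
have irho : mu.-integrable setT rho.
  apply/integrableP; split => //.
  under eq_integral do rewrite gee0_abs ?nneseries_ge0//.
  rewrite integral_nneseries//.
  apply: (@le_lt_trans _ _ (\sum_(0 <= n <oo) (1 / (2 ^ n.+1)%:R)%:E)%E); last first.
    exact: le_lt_trans (epsilon_trick0 xpredT ler01) (ltry _).
  apply: lee_nneseries => // n _; first by move=> _; apply: integral_ge0 => x _; exact: rho0.
  under eq_integral do rewrite EFinM.
  rewrite ge0_integralZl ?lee_fin//; last first.
    by apply/measurable_EFinP; exact: measurable_indic (mU n).
  rewrite integral_indic//; last exact: mU.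
  rewrite setIT.
  have [_ _ /ltW h] := hU n.
  apply: le_trans (lee_pmul _ _ (lexx _) h) _ => //.
  by rewrite -EFinM lee_fin /e mulrC divfK.
pose psi (x : R) : R := `|phi' x| + 2 * \1_(`]0, b[%classic) x + fine (rho x).
exists psi; split.
- have i1 : intR (fun x => 2 * \1_(`]0, b[%classic) x).
    have := @integrableZl _ _ _ mu setT measurableT 2 (EFin \o \1_(`]0, b[%classic)); apply.
    apply/integrableP; split.
      by apply/measurable_EFinP; exact: measurable_indic.
    under eq_integral do rewrite /= ger0_norm//.
    rewrite integral_indic//= setIT lebesgue_measure_itv/=.
    by case: ifP => _; rewrite -?EFinB ltry.
  exact: integrableD (integrableD measurableT (integrable_norm iphi') i1) (integrable_fine irho).
- move=> x; rewrite !addr_ge0// ?mulr_ge0//; apply: fine_ge0; exact: nneseries_ge0.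
- move=> x x0b.
  pose n := Num.truncn `|phi x|.
  have /andP[n1 n2] : n%:R <= `|phi x| < n.+1%:R by exact: truncn_itv.
  have phiE y : 0 < y < b -> phi' y = phi y.
    by move=> yb; rewrite /phi' patchE mem_set//= in_itv.
  have [oU EU _] := hU n.
  have Ux : U n x.
    by apply: EU; split; rewrite /= ?in_itv//= phiE// n1 n2.
  have /nbhs_ballP[d /= d0 dU] : nbhs x (U n) by exact: open_nbhs_nbhs.
  exists d, n.+2%:R; split => //.
    by rewrite -natr1 lerD2r ltW.
  have := integrable_ae measurableT irho; apply: ae_imply => y /(_ I) fy yb yd.
  have Uy : U n y by apply: dU; rewrite /ball/= distrC.
  rewrite /psi indicE mem_set ?mulr1; last by rewrite /= in_itv.
  have rh0 : 0 <= fine (rho y) by apply: fine_ge0; exact: nneseries_ge0.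
  (* On [E n] the term |phi| is at least n and the constant 2 completes it to n + 2; on the rest of
     [U n] the sum [rho] already contributes n + 2. *)
  have [[_]|nE] := pselect (E n y).
    rewrite /= in_itv/= => /andP[h _].
    by move: h; rewrite -addn2 natrD; lra.
  have h : n.+2%:R <= fine (rho y).
    rewrite -lee_fin fineK//.
    apply: le_trans (nneseries_lim_ge n.+1 _) => //.
    rewrite big_nat_recr//= indicE mem_set// mulr1 leeDr// sume_ge0//.
  by have := normr_ge0 (phi' y); lra.
Qed.

Lemma Rintegral_itv_ge f c u v : 0 <= c -> u < v -> intR f -> (forall x, 0 <= f x) ->
  {ae mu, forall z, `]u, v[%classic z -> c <= f z} ->
  c * (v - u) <= \int[mu]_(z in `]u, v[) f z.
Proof.
move=> c0 uv if_ f0 cf; have iuv := intRS (measurable_itv `]u, v[) if_.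
rewrite -lee_fin /Rintegral fineK; last exact: integrable_fin_num iuv.
apply: (@le_trans _ _ (\int[mu]_(z in `]u, v[) c%:E)%E).
  have e : mu `]u, v[ = (v - u)%:E by rewrite lebesgue_measure_itv/= lte_fin uv -EFinB.
  by rewrite integral_cst// EFinM -e.
apply: ae_ge0_le_integral => //.
- by move=> z _; rewrite lee_fin.
- exact: measurable_int iuv.
Qed.

(** The function [psi] is fixed before L and h, so one function controls the sections for all s at
    once. Near t the slopes of h from t are at most phi(t) + 1, a value that [psi] exceeds almost
    everywhere around t. *)
Lemma derivative_bound_increment b (phi : R -> R) :
  mu.-integrable `]0, b[ (EFin \o phi) ->
  exists psi : R -> R, [/\ intR psi, forall x, 0 <= psi x &
    forall L h, L <= b -> h x @[x --> 0^'+] --> h 0 ->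
    (forall t, 0 < t < L -> derivable h t 1 /\ `|h^`()%classic t| <= phi t) ->
    forall x y, 0 <= x -> x <= y -> y < L ->
      `|h y - h x| <= primitive psi y - primitive psi x].
Proof.
move=> /derivative_majorant[psi [ipsi psi0 hpsi]]; exists psi; split=> //.
move=> L h Lb ch dh.
have pm x y : 0 <= x -> x <= y -> primitive psi x <= primitive psi y.
  by move=> x0 xy; rewrite -subr_ge0 primitiveB//; apply: Rintegral_ge0.
have inner x y : 0 < x -> x <= y -> y < L -> `|h y - h x| <= primitive psi y - primitive psi x.
  apply: local_increment_bound => [x' y' x'0 x'y' _|t /andP[t0 tL]].
    by apply: pm => //; exact: ltW.
  have [d [c [d0 phic hc]]] := hpsi t ltac:(by rewrite t0 (lt_le_trans tL Lb)).
  have [dt ht] := dh t ltac:(by rewrite t0 tL).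
  (* The tolerance 1 is exactly the margin built into [c]. *)
  have := derivable_cvg_quotient dt; move=> /cvgrPdist_le /(_ 1 ltr01)[r /= r0 hr].
  exists (Num.min d r); first by rewrite lt_min d0 r0.
  move=> {}y /andP[y0 yL]; rewrite lt_min => /andP[yd yr].
  have [->|yt] := eqVneq y t; first by rewrite !subrr normr0.
  have q : `|h y - h t| <= c * `|y - t|.
    have := hr (y - t); rewrite /= sub0r normrN => /(_ yr).
    rewrite subr_eq0 => /(_ yt); rewrite subrK => hq.
    rewrite -ler_pdivrMr ?normr_gt0 ?subr_eq0// -normfV -normrM mulrC.
    apply: le_trans phic.
    have -> : (y - t)^-1 * (h y - h t) = h^`()%classic t - (h^`()%classic t - (y - t)^-1 *: (h y - h t)).
      by rewrite subKr.
    apply: le_trans (ler_normB _ _) _; apply: lerD => //.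
    exact: le_trans ht (ler_norm _).
  apply: le_trans q _.
  have c_le u v : 0 < u -> u < v -> v < L -> `|u - t| < d -> `|v - t| < d ->
      c * (v - u) <= primitive psi v - primitive psi u.
    move=> u0 uv vL ud vd; rewrite (primitiveB ipsi (ltW u0) (ltW uv)).
    apply: Rintegral_itv_ge => //; first by apply: le_trans phic; rewrite addr_ge0.
    apply: ae_imply hc => z hz; rewrite /= in_itv/= => /andP[uz zv]; apply: hz.
      by rewrite (lt_trans u0 uz) (lt_le_trans (lt_trans zv vL) Lb).
    move: ud vd; rewrite !ltr_distl => /andP[? ?] /andP[? ?].
    by rewrite (lt_trans _ uz)// (lt_trans zv).
  have [yt'|ty] := ltP y t.
    rewrite distrC [leRHS]distrC gtr0_norm ?subr_gt0//.
    apply: le_trans (ler_norm _); apply: c_le => //.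
    by rewrite subrr normr0.
  have ty' : t < y by rewrite lt_neqAle eq_sym yt.
  rewrite gtr0_norm ?subr_gt0//.
  apply: le_trans (ler_norm _); apply: c_le => //.
  by rewrite subrr normr0.
move=> x y; rewrite le_eqVlt => /orP[/eqP<-|x0]; last exact: inner.
rewrite le_eqVlt => /orP[/eqP<-|y0 yL]; first by rewrite !subrr normr0.
have -> : primitive psi y - primitive psi 0 = primitive psi y.
  by rewrite /primitive set_itvoo0 Rintegral_set0 subr0.
have L0 : 0 < L := lt_trans y0 yL.
(* Nothing is known about the derivative at 0; that end is reached by right continuity of h, up to
   an arbitrary e. *)
apply/ler_addgt0Pr => e e0.
move: ch => /cvgrPdist_le /(_ _ e0) h0.
have [z [z0 zy hz]] : exists z, [/\ 0 < z, z < y & `|h 0 - h z| <= e].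
  near (0:R)^'+ => z; exists z; split => //.
  by near: z.
have -> : h y - h 0 = (h y - h z) - (h 0 - h z) by ring.
apply: le_trans (ler_normB _ _) _; apply: lerD => //.
apply: le_trans (inner _ _ z0 (ltW zy) yL) _.
by rewrite lerBlDr lerDl; apply: Rintegral_ge0.
Unshelve. all: by end_near.
Qed.

End majorant.

(** * Calculus on intervals for functions extended by zero *)

Section wrappers.
Context {R : realType}.
Notation mu := (@lebesgue_measure R).
Notation intR f := (mu.-integrable setT (EFin \o f)).
Implicit Types (f g h r : R -> R) (c x y t T L b : R) (D : set R).

Lemma integrable_patch D f : measurable D ->
  mu.-integrable D (EFin \o f) <-> intR (f \_ D).
Proof. by move=> mD; rewrite -restrict_EFin -integrable_mkcond. Qed.

Lemma has_integralP D f c : measurable D ->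
  has_integral D f c <-> intR (f \_ D) /\ \int[mu]_x (f \_ D) x = c.
Proof.
by move=> mD; rewrite /has_integral (integrable_patch _ mD) -Rintegral_mkcond.
Qed.

Lemma primitive_patch f T t : t <= T -> primitive (f \_ `]0, T[) t = primitive f t.
Proof.
move=> tT; apply: eq_Rintegral => x; rewrite inE/= in_itv/= => /andP[x0 xt].
by rewrite patchE mem_set//= in_itv/= x0 (lt_le_trans xt tT).
Qed.

Lemma abs_continuous_FTC T F f : 0 < T -> abs_continuous 0 T F ->
  measurable_fun `]0, T[ f ->
  {ae mu, forall t, `]0, T[%classic t -> derivable F t 1 /\ F^`()%classic t = f t} ->
  mu.-integrable `]0, T[ (EFin \o f) /\ F T - F 0 = primitive f T.
Proof.
move=> T0 acF mf dF.
have mf' : measurable_fun setT (f \_ `]0, T[) by apply/(measurable_restrictT _ _).1.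
have [||i e] := @abs_continuous_FTC_T R T T0 F (f \_ `]0, T[) acF mf'.
- by move=> x xT; rewrite patchE memNset.
- by apply: ae_imply dF => t dt tT; rewrite patchE mem_set//; exact: dt.
split; first exact/integrable_patch.
by rewrite e /primitive -Rintegral_mkcond.
Qed.

(** A limit of difference quotients with step 1 / (n + 1). The extension by zero defines them on the
    whole line and does not affect the limit, since x + 1 / (n + 1) < L eventually. *)
Lemma measurable_derive1 L h : (forall t, 0 < t < L -> derivable h t 1) ->
  measurable_fun `]0, L[ h^`()%classic.
Proof.
move=> dh.
have ch : measurable_fun `]0, L[ h.
  apply: open_continuous_measurable_fun; first exact: interval_open.
  move=> x; rewrite inE/= in_itv/= => xL; apply: differentiable_continuous.
  exact/derivable1_diffP/dh.
pose h_ := h \_ `]0, L[.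
have mh : measurable_fun setT h_ by apply/(measurable_restrictT _ _).1.
apply: (@measurable_fun_cvg _ _ _ _ (fun n x => n.+1%:R * (h_ (x + n.+1%:R^-1) - h_ x))).
  move=> n; apply: (@measurable_funS _ _ _ _ setT) => //.
  apply: measurable_funM => //; apply: measurable_funB => //.
  by apply: measurableT_comp => //; exact: measurable_funD.
move=> x; rewrite /= in_itv/= => /andP[x0 xL].
have := derivable_cvg_quotient (dh x ltac:(by rewrite x0 xL)).
move=> /cvgrPdist_le hq; apply/cvgrPdist_le => e e0.
have [d /= d0 hd] := hq e e0.
near=> n.
have nd : (n.+1%:R)^-1 < Num.min d (L - x).
  near: n.
  have m0 : 0 < Num.min d (L - x) by rewrite lt_min d0 subr_gt0.
  have [N _ hN] := near_infty_natSinv_lt (PosNum m0).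
  by exists N.
have n0 : 0 < (n.+1%:R : R)^-1 by rewrite invr_gt0.
move: nd; rewrite lt_min => /andP[nd nL].
have := hd (n.+1%:R)^-1; rewrite /= sub0r normrN gtr0_norm// => /(_ nd).
rewrite gt_eqF// => /(_ isT).
rewrite invrK /h_ !patchE !mem_set ?[_ + x]addrC//= in_itv/=.
  by rewrite x0 xL.
by rewrite addr_gt0//= -ltrBrDl.
Unshelve. all: by end_near.
Qed.

(** Increments of h are dominated by those of a primitive of an integrable function, so h inherits
    its absolute continuity. *)
Lemma dominated_derivative_FTC b L h (phi : R -> R) :
  mu.-integrable `]0, b[ (EFin \o phi) -> L <= b ->
  h x @[x --> 0^'+] --> h 0 ->
  (forall t, 0 < t < L -> derivable h t 1 /\ `|h^`()%classic t| <= phi t) ->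
  forall t, 0 < t -> t < L -> primitive h^`()%classic t = h t - h 0.
Proof.
move=> iphi Lb ch dh t t0 tL.
have [psi [ipsi psi0 hpsi]] := derivative_bound_increment iphi.
have [] := @abs_continuous_FTC t h h^`()%classic t0 _ _ _; last by move=> _ ->.
- move=> e e0; have [d d0 hd] := primitive_abs_continuous t ipsi e0; exists d => //.
  move=> n x y xy tI sd; apply: le_lt_trans (hd n x y xy tI sd).
  apply: ler_sum => i _; have [x0 [xyi yt]] := xy i.
  apply: le_trans (ler_norm _); apply: (hpsi L) => //.
  exact: le_lt_trans yt tL.
- apply: measurable_derive1 => x /andP[x0 xt]; apply: (dh x _).1.
  by rewrite x0 (lt_trans xt tL).
- apply: aeW => x; rewrite /= in_itv/= => /andP[x0 xt]; split=> //.
  by apply: (dh x _).1; rewrite x0 (lt_trans xt tL).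
Qed.

End wrappers.

(** * Convolution and triangular kernels *)

Section convolution.
Context {R : realType}.
Notation mu := (@lebesgue_measure R).
Notation intR f := (mu.-integrable setT (EFin \o f)).
Implicit Types (f g h r p q u : R -> R) (c x y s t T L b : R) (D : set R).

Lemma Rintegral_shift c f : measurable_fun setT f ->
  \int[mu]_x f (x + c) = \int[mu]_x f x.
Proof.
move=> mf; congr fine; apply: (@integral_shift _ c (EFin \o f)).
exact/measurable_EFinP.
Qed.

Lemma Rintegral_reflect c f : measurable_fun setT f ->
  \int[mu]_x f (c - x) = \int[mu]_x f x.
Proof.
move=> mf; congr fine; apply: (@integral_reflect _ c (EFin \o f)).
exact/measurable_EFinP.
Qed.

Definition conv_kernel p t y : R := p (t - y).

Lemma conv_kernel_dominated p : intR p -> dominated_kernel (conv_kernel p) (fun x => `|p x|).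
Proof.
move=> ip; have mp := intR_measurable ip; split => //; last exact: integrable_norm ip.
by apply: measurableT_comp => //; exact: measurable_funB.
Qed.

Lemma measurable_conv_kernel2 p t : measurable_fun setT p -> measurable_fun setT (conv_kernel p t).
Proof. by move=> mp; apply: measurableT_comp => //; exact: measurable_funB. Qed.

Lemma convC p q t : measurable_fun setT p -> measurable_fun setT q ->
  kernel_op (conv_kernel p) q t = kernel_op (conv_kernel q) p t.
Proof.
move=> mp mq; rewrite /kernel_op -(Rintegral_reflect t).
  by apply: eq_Rintegral => y _; rewrite /conv_kernel subKr mulrC.
by apply: measurable_funM => //; exact: measurable_conv_kernel2.
Qed.

(** The substitution y -> y + s; it preserves default values too, so the identity holds for every t
    and s. *)
Lemma conv_kernel_comp p q t s : measurable_fun setT p -> measurable_fun setT q ->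
  \int[mu]_y (conv_kernel p t y * conv_kernel q y s) =
  conv_kernel (kernel_op (conv_kernel p) q) t s.
Proof.
move=> mp mq; rewrite -(Rintegral_shift s).
  apply: eq_Rintegral => y _; rewrite /conv_kernel addrK.
  by congr (p _ * _); ring.
apply: measurable_funM; first exact: measurable_conv_kernel2.
by apply: measurableT_comp => //; exact: measurable_funB.
Qed.

Lemma conv_op_swap p q u : intR p -> intR q -> intR u ->
  {ae mu, forall t, kernel_op (conv_kernel p) (kernel_op (conv_kernel q) u) t =
                    kernel_op (conv_kernel q) (kernel_op (conv_kernel p) u) t}.
Proof.
move=> ip iq iu; have mp := intR_measurable ip; have mq := intR_measurable iq.
have dp := conv_kernel_dominated ip; have dq := conv_kernel_dominated iq.
apply: (ae_imply2 _ (kernel_op_comp dp dq iu) (kernel_op_comp dq dp iu)) => t [_ _ ->] [_ _ ->].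
apply: eq_Rintegral => s _; congr (_ * _).
rewrite !conv_kernel_comp//; exact: convC.
Qed.

(** Integration from 0 as a convolution: the constant 1 is cut at b to become an integrable, hence
    dominated, kernel. *)
Definition unit_kernel b : R -> R -> R := conv_kernel (\1_(`]0, b[%classic)).

Lemma integrable_indic_oo b : intR (\1_(`]0, b[%classic) : R -> R).
Proof.
apply/integrableP; split.
  by apply/measurable_EFinP; exact: measurable_indic.
under eq_integral do rewrite /= ger0_norm//.
rewrite integral_indic//= setIT lebesgue_measure_itv/=.
by case: ifP => _; rewrite -?EFinB ltry.
Qed.

Lemma unit_kernel_op b r t : (forall x, x <= 0 -> r x = 0) -> t <= b ->
  kernel_op (unit_kernel b) r t = primitive r t.
Proof.
move=> r0 tb; rewrite /primitive Rintegral_indicE; apply: eq_Rintegral => y _.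
rewrite /unit_kernel /conv_kernel mulrC !indicE.
have [y0|y0] := leP y 0; first by rewrite r0// !mul0r.
congr (_ * _%:R); congr nat_of_bool; apply/idP/idP; rewrite !inE/= !in_itv/= => /andP[h1 h2].
- by rewrite y0/= -subr_gt0.
- by rewrite subr_gt0 h2/= ltrBlDr (le_lt_trans tb)// ltrDl.
Qed.

Lemma kernel_opD A u v t :
  intR (fun y => A t y * u y) -> intR (fun y => A t y * v y) ->
  kernel_op A (fun y => u y + v y) t = kernel_op A u t + kernel_op A v t.
Proof.
move=> iu iv; rewrite /kernel_op -RintegralD//.
by apply: eq_Rintegral => y _; rewrite mulrDr.
Qed.

Lemma kernel_opB A u v t :
  intR (fun y => A t y * u y) -> intR (fun y => A t y * v y) ->
  kernel_op A (fun y => u y - v y) t = kernel_op A u t - kernel_op A v t.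
Proof.
move=> iu iv; rewrite /kernel_op -RintegralB//.
by apply: eq_Rintegral => y _; rewrite mulrBr.
Qed.

Lemma kernel_opZ A c u t : intR (fun y => A t y * u y) ->
  kernel_op A (fun y => c * u y) t = c * kernel_op A u t.
Proof.
move=> iu; rewrite /kernel_op -RintegralZl//.
by apply: eq_Rintegral => y _; rewrite mulrCA.
Qed.

Lemma integrable_bounded_mul p u c : measurable_fun setT p -> (forall x, `|p x| <= c) ->
  intR u -> intR (fun x => p x * u x).
Proof.
move=> mp pc iu; have mu_ := intR_measurable iu.
have c0 : 0 <= c := le_trans (normr_ge0 (p 0)) (pc 0).
apply: (@le_integrable _ _ _ mu setT measurableT _ (EFin \o (fun x => c * u x))) => //.
- by apply/measurable_EFinP; exact: measurable_funM.
- by move=> x _; rewrite /= lee_fin !normrM (ger0_norm c0) ler_wpM2r.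
- by have := integrableZl measurableT c iu.
Qed.

Lemma unit_kernel_integrable b u t : intR u -> intR (fun y => unit_kernel b t y * u y).
Proof.
apply: (@integrable_bounded_mul _ _ 1).
  by apply: measurable_conv_kernel2; exact: measurable_indic.
by move=> x; rewrite /unit_kernel /conv_kernel indicE; case: (_ \in _); rewrite ?normr1 ?normr0.
Qed.

End convolution.

Section triangle.
Context {R : realType}.
Implicit Types (b : R).

(** Points are (t, s), time first as in a kernel, opposite to the argument order of [w]. *)
Definition triangle b : set (R * R) := [set p | 0 < p.2 /\ p.2 < p.1 /\ p.1 < b].

Lemma measurable_triangle b : measurable (triangle b).
Proof.
have -> : triangle b = (fun p : R * R => (0 < p.2) && ((p.2 < p.1) && (p.1 < b))) @^-1` [set true].
  by apply/seteqP; split => p /=; [move=> [-> [-> ->]]|move=> /andP[? /andP[? ?]]].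
rewrite -[X in measurable X]setTI.
apply: (_ : measurable_fun setT _) => //.
apply: measurable_and; first exact: measurable_fun_ltr.
by apply: measurable_and; exact: measurable_fun_ltr.
Qed.

Lemma triangle_patch b (F : R -> R -> R) t s :
  0 < t < b -> ((fun p => F p.1 p.2) \_ (triangle b)) (t, s) = if s \in `]0, t[ then F t s else 0.
Proof.
move=> /andP[t0 tb]; rewrite patchE; case: ifPn.
  by rewrite inE => -[/= s0 [st _]]; rewrite in_itv/= s0 st.
rewrite notin_setE => nt; case: ifPn => //; rewrite in_itv/= => /andP[s0 st].
by exfalso; apply: nt.
Qed.

End triangle.

Section triangular_kernels.
Context {R : realType}.
Notation mu := (@lebesgue_measure R).
Notation intR f := (mu.-integrable setT (EFin \o f)).
Implicit Types (F : R -> R -> R) (a f h : R -> R) (b c s t x y z : R).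

Definition tri_kernel b F t s : R := ((fun p => F p.1 p.2) \_ (triangle b)) (t, s).

Lemma tri_kernelE b F t s : 0 < t < b ->
  tri_kernel b F t s = if s \in `]0, t[ then F t s else 0.
Proof. exact: triangle_patch. Qed.

Lemma tri_kernel0 b F t s : ~~ (0 < t < b) -> tri_kernel b F t s = 0.
Proof.
move=> tb; rewrite /tri_kernel patchE memNset// => -[/= s0 [st tlb]].
by move: tb; rewrite tlb (lt_trans s0 st).
Qed.

Lemma measurable_tri_kernel b F :
  measurable_fun (triangle b) (fun p : R * R => F p.1 p.2) ->
  measurable_fun setT (fun p : R * R => tri_kernel b F p.1 p.2).
Proof.
move=> mF; rewrite (_ : (fun p => _) = (fun p : R * R => F p.1 p.2) \_ (triangle b)).
  exact: (measurable_restrictT _ (measurable_triangle b)).1 mF.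
by apply/funext => -[t s].
Qed.

Lemma tri_kernel_dominated b F a :
  measurable_fun (triangle b) (fun p : R * R => F p.1 p.2) -> intR a ->
  (forall x, 0 <= a x) ->
  (forall t s, 0 < s -> s < t -> t < b -> `|F t s| <= a (t - s)) ->
  dominated_kernel (tri_kernel b F) a.
Proof.
move=> mF ia a0 Fa; split => //; first exact: measurable_tri_kernel.
move=> t s; have [tb|tb] := boolP (0 < t < b); last by rewrite tri_kernel0// normr0.
rewrite tri_kernelE//; case: ifPn => [|_]; last by rewrite normr0.
by rewrite in_itv/= => /andP[s0 st]; apply: Fa => //; case/andP: tb.
Qed.

(** By Tonelli the integrals of the positive and negative parts are measurable in the parameter, and
    so is their extended difference. *)
Lemma measurable_Rintegral_param d (T : measurableType d) (f : T -> R -> R) :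
  measurable_fun setT (fun p : T * R => f p.1 p.2) ->
  measurable_fun setT (fun p => \int[mu]_y f p y).
Proof.
move=> mf; apply: measurableT_comp => //.
have mf' : measurable_fun setT (fun p : T * measurableTypeR R => (f p.1 p.2)%:E).
  exact/measurable_EFinP.
pose G := fun p : T * measurableTypeR R => (f p.1 p.2)%:E.
have -> : (fun p => \int[mu]_y (f p y)%:E)%E =
    (fun p => \int[mu]_y G^\+ (p, y) - \int[mu]_y G^\- (p, y))%E.
  apply/funext => p; rewrite integralE.
  by congr (_ - _)%E; apply: eq_integral => y _; rewrite ?funeposE ?funenegE.
apply: emeasurable_funB.
- have := @measurable_fun_fubini_tonelli_F _ _ T (measurableTypeR R) R mu (G^\+)%E.
  by apply => //; exact: measurable_funepos.
- have := @measurable_fun_fubini_tonelli_F _ _ T (measurableTypeR R) R mu (G^\-)%E.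
  by apply => //; exact: measurable_funeneg.
Qed.

End triangular_kernels.

(** * The Sonine condition *)

Section sonine.
Context {R : realType}.
Notation mu := (@lebesgue_measure R).
Notation intR f := (mu.-integrable setT (EFin \o f)).
Variables (b : R) (w : R -> R -> R).
Hypothesis hw : weight_conditions b w.
Implicit Types (c s t x y z : R).

(** The diagonal value is bounded by mu_hi, and the increment away from it by the integral of [psi].
    Shifting each section so that the diagonal sits at 0 turns the bound wbar(t - s) into one that
    does not depend on s. *)
Lemma weight_bounded : exists2 M, 0 <= M &
  forall s t, 0 <= s -> s < t -> t < b -> `|w s t| <= M.
Proof.
have [_ [mlo [mhi [mlo0 mlohi hm]]] cw dw [wb iwb hwb]] := hw.
have [psi [ipsi psi0 hpsi]] := derivative_bound_increment iwb.
exists (mhi + \int[mu]_x psi x).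
  by rewrite addr_ge0// ?(le_trans (ltW mlo0) mlohi)// Rintegral_ge0.
move=> s t s0 st tb.
have sb : s < b := lt_trans st tb.
have c0 : w s (x + s) @[x --> 0^'+] --> w s (0 + s).
  rewrite add0r.
  have [_ + _] := (continuous_within_itvP (w s) sb).1 (cw s ltac:(by rewrite s0 ltW)).
  move=> /cvgrPdist_le h; apply/cvgrPdist_le => e e0.
  have [d /= d0 hd] := h e e0; exists d => // x /= xd x0.
  apply: hd; last by rewrite ltrDr.
  by move: xd; rewrite /= sub0r normrN opprD addrCA subrr addr0 normrN.
have dh x : 0 < x < b - s -> derivable (fun y => w s (y + s)) x 1 /\
    `|(fun y => w s (y + s))^`()%classic x| <= wb x.
  move=> /andP[x0 xbs].
  have xsb : x + s < b by rewrite -ltrBrDr.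
  have sxs : s < x + s by rewrite ltrDr.
  have dxs := dw s (x + s) s0 sxs xsb.
  have e : (fun h : R => h^-1 *: (((fun y => w s (y + s)) \o shift x) h%:A - w s (x + s))) =
         (fun h : R => h^-1 *: ((w s \o shift (x + s)) h%:A - w s (x + s))).
    by apply/funext => h /=; rewrite -addrA.
  split; first by move: dxs; rewrite /derivable e.
  rewrite derive1E /derive e -/(derive (w s) (x + s) 1) -derive1E.
  by have := hwb s (x + s) s0 sxs xsb; rewrite addrK.
have := hpsi (b - s) (fun y => w s (y + s)) ltac:(by rewrite gerBl) c0 dh 0 (t - s)
  (lexx _) ltac:(by rewrite subr_ge0 ltW) ltac:(by rewrite ltrD2r).
rewrite /= subrK add0r => h.
rewrite -[w s t](subrK (w s s)) addrC.
apply: le_trans (ler_normD _ _) _; apply: lerD.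
  by have [_ [_ ->]] := hm s ltac:(by rewrite s0 ltW).
apply: le_trans h _; rewrite primitiveB ?subr_ge0 ?(ltW st)//.
rewrite Rintegral_indicE; apply: le_Rintegral => //; first exact: integrable_indic_mul.
by move=> x _; rewrite indicE ler_piMr//; case: (_ \in _).
Qed.

Lemma measurable_weight : measurable_fun (triangle b) (fun p : R * R => w p.2 p.1).
Proof.
have [mw _ _ _ _] := hw.
apply: (measurable_comp _ _ mw (_ : measurable_fun _ (fun p : R * R => (p.2, p.1)))).
- have -> : [set p : R * R | 0 <= p.1 /\ p.1 <= p.2 /\ p.2 <= b] =
      (fun p : R * R => (0 <= p.1) && ((p.1 <= p.2) && (p.2 <= b))) @^-1` [set true].
    by apply/seteqP; split => p /=; [move=> [-> [-> ->]]|move=> /andP[? /andP[? ?]]].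
  rewrite -[X in measurable X]setTI; apply: (_ : measurable_fun setT _) => //.
  apply: measurable_and; first exact: measurable_fun_ler.
  by apply: measurable_and; exact: measurable_fun_ler.
- by move=> _ [p [p0 [pp pb]] <-] /=; rewrite !ltW.
- apply: (@measurable_funS _ _ _ _ setT) => //.
  exact: (measurable_fun_pair measurable_snd measurable_fst).
Qed.

Variables (k K : R -> R) (g : R -> R -> R).
Hypothesis hK : WSC1 b w k K g.

Definition zero_ext (p : R -> R) : R -> R := p \_ `]0, b[.

Local Notation extk := (zero_ext k).
Local Notation extK := (zero_ext K).

Lemma extk_integrable : intR extk.
Proof. by have [[ik _ _] _ _ _ _] := hK; exact: (integrable_patch k (measurable_itv _)).1 ik. Qed.

Lemma extK_integrable : intR extK.
Proof. by have [[_ iK _] _ _ _ _] := hK; exact: (integrable_patch K (measurable_itv _)).1 iK. Qed.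

Lemma extE (p : R -> R) x : 0 < x < b -> (p \_ `]0, b[) x = p x.
Proof. by move=> xb; rewrite patchE mem_set//= in_itv. Qed.

Lemma ext0 (p : R -> R) x : ~~ (0 < x < b) -> (p \_ `]0, b[) x = 0.
Proof. by move=> xb; rewrite patchE memNset//= in_itv/=; exact/negP. Qed.

Definition assoc_kernel := conv_kernel extK.
Definition weighted_kernel := tri_kernel b (fun t s => w s t * k (t - s)).
Definition sonine_kernel := tri_kernel b (fun t s => g s (t - s)).
Definition sonine_kernel_dt := tri_kernel b (fun t s => (g s)^`()%classic (t - s)).

Lemma measurable_weighted_kernel_pre :
  measurable_fun (triangle b) (fun p : R * R => w p.2 p.1 * k (p.1 - p.2)).
Proof.
apply: measurable_funM; first exact: measurable_weight.
apply: (@eq_measurable_fun _ _ _ _ _ (fun p : R * R => extk (p.1 - p.2))).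
  move=> p; rewrite inE => -[p0 [pp pb]]; rewrite /zero_ext extE// subr_gt0 pp/=.
  by rewrite ltrBlDr (lt_trans pb)// ltrDl.
apply: (@measurable_funS _ _ _ _ setT) => //.
apply: measurableT_comp; first exact: intR_measurable extk_integrable.
exact: measurable_funB.
Qed.

Lemma weighted_kernel_dominated : exists a,
  dominated_kernel weighted_kernel a /\ forall x, x <= 0 -> a x = 0.
Proof.
have [M M0 hM] := weight_bounded.
exists (fun x => M * `|extk x|); split; last first.
  by move=> x x0; rewrite /zero_ext ext0 ?normr0 ?mulr0// ltNge x0.
apply: tri_kernel_dominated.
- exact: measurable_weighted_kernel_pre.
- by have := integrableZl measurableT M (integrable_norm extk_integrable).
- by move=> x; rewrite mulr_ge0.
- move=> t s s0 st tb; rewrite /zero_ext extE ?subr_gt0 ?st/=.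
    by rewrite normrM ler_wpM2r// hM// ltW.
  by rewrite ltrBlDr (lt_trans tb)// ltrDl.
Qed.

(** The Sonine identity at (s, t - s), after the substitution y = z + s: it says what the
    composition of the two operators has as kernel. *)
Lemma assoc_weighted_kernel t s : 0 < t < b ->
  \int[mu]_y (assoc_kernel t y * weighted_kernel y s) = sonine_kernel t s.
Proof.
move=> /andP[t0 tb]; rewrite /sonine_kernel tri_kernelE ?t0//; case: ifPn => [|st].
  rewrite in_itv/= => /andP[s0 st].
  have [[_ _ +] _ _ _ _] := hK.
  move=> /(_ s (t - s) (ltW s0)); rewrite subr_gt0 => /(_ st).
  rewrite addrC subrK => /(_ (ltW tb)) /has_integralP[//|iF <-].
  rewrite -(Rintegral_shift (- s)); last exact: intR_measurable iF.
  apply: eq_Rintegral => y _; rewrite /assoc_kernel /conv_kernel.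
  have [ys|sy] := leP y s.
    rewrite patchE memNset/= ?in_itv/= ?subr_gt0 ?[s < y]ltNge ?ys//.
    have [yb|yb] := boolP (0 < y < b); last by rewrite /weighted_kernel tri_kernel0// mulr0.
    by rewrite /weighted_kernel tri_kernelE// in_itv/= [s < y]ltNge ys andbF mulr0.
  have [ty|yt] := leP t y.
    rewrite /zero_ext ext0 ?mul0r ?subr_gt0 ?[y < t]ltNge ?ty//.
    by rewrite patchE memNset//= in_itv/= ltrD2r [y < t]ltNge ty andbF.
  rewrite patchE mem_set/=; last by rewrite in_itv/= subr_gt0 sy ltrD2r.
  have y0 := lt_trans s0 sy; have yb := lt_trans yt tb.
  rewrite /weighted_kernel tri_kernelE ?y0// in_itv/= s0 sy /zero_ext extE; last first.
    by rewrite subr_gt0 yt ltrBlDr (lt_trans tb)// ltrDl.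
  rewrite subrK (_ : t - s - (y - s) = t - y); last by ring.
  by rewrite mulrCA mulrA.
rewrite /Rintegral (eq_integral (cst 0%E)) ?integral0// => y _ /=.
congr EFin; rewrite /assoc_kernel /conv_kernel.
have [yb|yb] := boolP (0 < y < b); last by rewrite /weighted_kernel tri_kernel0// mulr0.
rewrite /weighted_kernel tri_kernelE//; case: ifPn; last by rewrite mulr0.
rewrite in_itv/= => /andP[s0 sy].
have [ty|yt] := leP t y; first by rewrite /zero_ext ext0 ?mul0r// subr_gt0 ltNge ty.
by move: st; rewrite in_itv/= s0 (lt_trans sy yt).
Qed.

Lemma measurable_sonine_kernel : measurable_fun setT (fun p : R * R => sonine_kernel p.1 p.2).
Proof.
apply: measurable_tri_kernel.
apply: (@eq_measurable_fun _ _ _ _ _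
  (fun p : R * R => \int[mu]_y (assoc_kernel p.1 y * weighted_kernel y p.2))).
  move=> [t s]; rewrite inE => -[/= s0 [st tb]].
  rewrite assoc_weighted_kernel ?(lt_trans s0 st)//= /sonine_kernel.
  by rewrite tri_kernelE ?(lt_trans s0 st)// in_itv/= s0 st.
apply: (@measurable_funS _ _ _ _ setT) => //.
apply: (@measurable_Rintegral_param _ _ _ (fun p y => assoc_kernel p.1 y * weighted_kernel y p.2)).
apply: measurable_funM.
- apply: measurableT_comp; first exact: intR_measurable extK_integrable.
  apply: measurable_funB => //; first exact: measurableT_comp.
- have [a [[mW _ _] _]] := weighted_kernel_dominated.
  apply: (measurableT_comp mW (_ : measurable_fun _ (fun p : (R * R) * R => (p.2, p.1.2)))).
  apply: measurable_fun_pair => //; exact: measurableT_comp.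
Qed.

Lemma sonine_cvg0 s : 0 <= s -> s < b -> g s x @[x --> 0^'+] --> g s 0.
Proof.
move=> s0 sb; have [_ _ cg _ _] := hK.
have bs : 0 < b - s by rewrite subr_gt0.
by have [_ + _] := (continuous_within_itvP (g s) bs).1 (cg s ltac:(by rewrite s0 ltW)).
Qed.

Lemma natSinv_lt e : 0 < e -> \forall n \near \oo, (n.+1%:R : R)^-1 < e.
Proof. by move=> e0; exact: (near_infty_natSinv_lt (PosNum e0)). Qed.

Definition sonine_diag : R -> R := (g ^~ 0) \_ `]0, b[.

(* Measurability in [s] of [g s 0] and of [g_2] is not assumed: it follows from that
   of [sonine_kernel], an integral with parameters, by passing to the limit in
   [g s x] and in difference quotients. *)
Lemma measurable_sonine_diag : measurable_fun setT sonine_diag.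
Proof.
apply/(measurable_restrictT _ _).1 => //.
apply: (@measurable_fun_cvg _ _ _ _ (fun n s => sonine_kernel (s + n.+1%:R^-1) s)).
  move=> n; apply: (@measurable_funS _ _ _ _ setT) => //.
  apply: (measurableT_comp measurable_sonine_kernel
    (_ : measurable_fun _ (fun s : R => (s + n.+1%:R^-1, s)))).
  by apply: measurable_fun_pair => //; exact: measurable_funD.
move=> s; rewrite /= in_itv/= => /andP[s0 sb].
have := sonine_cvg0 (ltW s0) sb.
move=> /cvgrPdist_le h; apply/cvgrPdist_le => e e0; have [d /= d0 hd] := h e e0.
have m0 : 0 < Num.min d (b - s) by rewrite lt_min d0 subr_gt0.
have := natSinv_lt m0; apply: filterS => n; rewrite lt_min => /andP[nd nb].
have n0 : 0 < (n.+1%:R : R)^-1 by rewrite invr_gt0.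
rewrite /sonine_kernel tri_kernelE ?addr_gt0//= -?ltrBrDl// in_itv/= s0 ltrDl n0.
rewrite [s + _]addrC addrK; apply: hd => //=.
by rewrite sub0r normrN gtr0_norm.
Qed.

Lemma measurable_sonine_kernel_dt_pre :
  measurable_fun (triangle b) (fun p : R * R => (g p.2)^`()%classic (p.1 - p.2)).
Proof.
apply: (@measurable_fun_cvg _ _ _ _
  (fun n (p : R * R) => n.+1%:R * (sonine_kernel (p.1 + n.+1%:R^-1) p.2 - sonine_kernel p.1 p.2))).
  move=> n; apply: (@measurable_funS _ _ _ _ setT) => //.
  apply: measurable_funM => //; apply: measurable_funB; last exact: measurable_sonine_kernel.
  apply: (measurableT_comp measurable_sonine_kernel
    (_ : measurable_fun _ (fun p : R * R => (p.1 + n.+1%:R^-1, p.2)))).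
  by apply: measurable_fun_pair => //; exact: measurable_funD.
move=> [t s] [/= s0 [st tb]].
have [_ _ _ dg _] := hK.
have ts : 0 < t - s by rewrite subr_gt0.
have := derivable_cvg_quotient (dg s (t - s) (ltW s0) ts ltac:(by rewrite addrC subrK)).
move=> /cvgrPdist_le hq; apply/cvgrPdist_le => e e0.
have [d /= d0 hd] := hq e e0.
have m0 : 0 < Num.min d (b - t) by rewrite lt_min d0 subr_gt0.
have := natSinv_lt m0; apply: filterS => n; rewrite lt_min => /andP[nd nb].
have n0 : 0 < (n.+1%:R : R)^-1 by rewrite invr_gt0.
have t0 := lt_trans s0 st.
have := hd (n.+1%:R)^-1; rewrite /= sub0r normrN gtr0_norm// => /(_ nd).
rewrite gt_eqF// invrK => /(_ isT).
rewrite /sonine_kernel !tri_kernelE ?t0 ?addr_gt0//= -?ltrBrDl// !in_itv/= s0 st.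
rewrite (lt_trans st) ?ltrDl//.
by rewrite (_ : t + n.+1%:R^-1 - s = n.+1%:R^-1 + (t - s)); last by ring.
Qed.

Lemma sonine_kernel_dt_dominated : exists a,
  dominated_kernel sonine_kernel_dt a /\ forall x, x <= 0 -> a x = 0.
Proof.
have [_ _ _ _ [gb igb hgb]] := hK.
exists (fun x => `|(gb \_ `]0, b[) x|); split; last first.
  by move=> x x0; rewrite ext0 ?normr0// ltNge x0.
apply: tri_kernel_dominated => //.
- exact: measurable_sonine_kernel_dt_pre.
- exact: integrable_norm ((integrable_patch gb (measurable_itv _)).1 igb).
- move=> t s s0 st tb; rewrite extE ?subr_gt0 ?st/=.
    apply: le_trans (ler_norm _); apply: hgb; rewrite ?subr_gt0// ?ltW//.
    by rewrite addrC subrK.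
  by rewrite ltrBlDr (lt_trans tb)// ltrDl.
Qed.

Lemma sonine_FTC s x : 0 <= s -> 0 < x -> s + x < b ->
  primitive (g s)^`()%classic x = g s x - g s 0.
Proof.
move=> s0 x0 sxb; have [_ _ _ dg [gb igb hgb]] := hK.
have sb : s < b by apply: lt_trans sxb; rewrite ltrDl.
apply: (dominated_derivative_FTC igb (L := b - s)) => //.
- by rewrite gerBl.
- exact: sonine_cvg0.
- move=> t /andP[t0 ts]; have stb : s + t < b by rewrite addrC -ltrBrDr.
  by split; [exact: dg|exact: hgb].
- by rewrite ltrBrDl.
Qed.

End sonine.

Lemma ae_conj (R : realType) (P Q : R -> Prop) :
  {ae @lebesgue_measure R, forall x, P x} -> {ae @lebesgue_measure R, forall x, Q x} ->
  {ae @lebesgue_measure R, forall x, P x /\ Q x}.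
Proof. by apply: ae_imply2. Qed.

Section integrable_arith.
Context {R : realType}.
Notation intR f := ((@lebesgue_measure R).-integrable setT (EFin \o f)).
Implicit Types u v : R -> R.

Lemma intRD u v : intR u -> intR v -> intR (fun x => u x + v x).
Proof. exact: integrableD. Qed.

Lemma intRB u v : intR u -> intR v -> intR (fun x => u x - v x).
Proof. exact: integrableB. Qed.

Lemma intRZ (c : R) u : intR u -> intR (fun x => c * u x).
Proof. exact: integrableZl. Qed.

End integrable_arith.

(** * The identity between the two defects *)

Section core.
Context {R : realType}.
Notation mu := (@lebesgue_measure R).
Notation intR f := (mu.-integrable setT (EFin \o f)).
Variables (b : R) (w : R -> R -> R).
Hypothesis hw : weight_conditions b w.
Variables (k K : R -> R) (g : R -> R -> R).
Hypothesis hK : WSC1 b w k K g.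
Implicit Types (c s t x y z T : R) (u f H : R -> R).

Local Notation kerK := (assoc_kernel b K).
Local Notation kerW := (weighted_kernel b w k).
Local Notation kerG := (sonine_kernel_dt b g).
Local Notation g0 := (sonine_diag b g).
Local Notation extK := (zero_ext b K).
Local Notation extk := (zero_ext b k).
Local Notation oneb := (\1_(`]0, b[%classic) : R -> R).
Local Notation ker1 := (unit_kernel b).

Let iK : intR extK := extK_integrable hK.
Let ik : intR extk := extk_integrable hK.

Lemma assoc_kernel_dominated : dominated_kernel kerK (fun x => `|extK x|).
Proof. exact: conv_kernel_dominated. Qed.

Lemma unit_kernel_dominated : dominated_kernel ker1 (fun x => `|oneb x|).
Proof. by apply: conv_kernel_dominated; exact: integrable_indic_oo. Qed.

Lemma unit_kernelE t y : 0 < t < b -> 0 < y -> ker1 t y = (y < t)%R%:R.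
Proof.
move=> /andP[t0 tb] y0; rewrite /unit_kernel /conv_kernel indicE; congr (_ _).
congr nat_of_bool; apply/idP/idP; rewrite inE/= in_itv/= subr_gt0.
  by case/andP.
by move=> ->; rewrite ltrBlDr (lt_trans tb)// ltrDl.
Qed.

(** For fixed s this is the fundamental theorem of calculus for the section [g s]; causality of both
    kernels gives 0 when s is not in []0, t[]. *)
Lemma unit_sonine_kernel_dt t s : 0 < t < b ->
  \int[mu]_y (ker1 t y * kerG y s) = if s \in `]0, t[ then g s (t - s) - g s 0 else 0.
Proof.
move=> tb; have /andP[t0 tltb] := tb; case: ifPn => [|st].
  rewrite in_itv/= => /andP[s0 st].
  have ts0 : 0 < t - s by rewrite subr_gt0.
  rewrite -(sonine_FTC hK (ltW s0) ts0) ?[s + _]addrC ?subrK//.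
  rewrite /primitive Rintegral_mkcond.
  rewrite -(Rintegral_shift (- s)); last first.
    apply/(measurable_restrictT _ _).1 => //; apply: measurable_derive1 => x /andP[x0 xts].
    have [_ _ _ dg _] := hK; apply: dg => //; first exact: ltW.
    by rewrite addrC (lt_trans _ tltb)// -ltrBrDr.
  apply: eq_Rintegral => y _; rewrite patchE.
  have [ys|sy] := leP y s.
    rewrite memNset/= ?in_itv/= ?subr_gt0 ?[s < y]ltNge ?ys//.
    have [yb|yb] := boolP (0 < y < b); last by rewrite /sonine_kernel_dt tri_kernel0// mulr0.
    by rewrite /sonine_kernel_dt tri_kernelE// in_itv/= [s < y]ltNge ys andbF mulr0.
  have y0 := lt_trans s0 sy.
  rewrite unit_kernelE//; have [yt|ty] := ltP y t.
    rewrite mem_set/=; last by rewrite in_itv/= subr_gt0 sy ltrD2r.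
    by rewrite mul1r /sonine_kernel_dt tri_kernelE ?y0 ?(lt_trans yt)// in_itv/= s0 sy.
  by rewrite mul0r memNset//= in_itv/= ltrD2r [y < t]ltNge ty andbF.
rewrite /Rintegral (eq_integral (cst 0%E)) ?integral0// => y _ /=.
congr EFin.
have [yb|yb] := boolP (0 < y < b); last by rewrite /sonine_kernel_dt tri_kernel0// mulr0.
have /andP[y0 _] := yb.
rewrite /sonine_kernel_dt tri_kernelE//; case: ifPn; last by rewrite mulr0.
rewrite in_itv/= => /andP[s0 sy]; rewrite unit_kernelE//; have [yt|ty] := ltP y t.
  by move: st; rewrite in_itv/= s0 (lt_trans sy yt).
by rewrite mul0r.
Qed.

Lemma sonine_diag_bounded : exists c, forall x, `|g0 x| <= c.
Proof.
have [_ [nlo [nhi [nlo0 nlohi hn]]] _ _ _] := hK; exists nhi => x.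
have [xb|xb] := boolP (0 < x < b); last first.
  by rewrite /sonine_diag ext0// normr0 (le_trans (ltW nlo0)).
rewrite /sonine_diag extE//; have /andP[x0 xltb] := xb.
by have [_ [_ ->]] := hn x ltac:(by rewrite !ltW).
Qed.

Lemma sonine_diag_mul_integrable u : intR u -> intR (fun x => g0 x * u x).
Proof.
have [c hc] := sonine_diag_bounded; apply: (@integrable_bounded_mul _ _ _ c) => //.
exact: (measurable_sonine_diag hw hK).
Qed.

Section residual.
Variables (u f : R -> R) (c : R).
Hypotheses (iu : intR u) (u0 : forall x, ~~ (0 < x < b) -> u x = 0).
Hypotheses (if_ : intR f) (f0 : forall x, x <= 0 -> f x = 0).

(* [u] solves the nonlocal problem (resp. the Volterra equation) when its first-kind
   (resp. second-kind) defect vanishes almost everywhere; the functions [u] and [f]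
   are extended by zero. *)
Definition first_kind_defect y : R :=
  kernel_op kerW u y - (c * oneb y + kernel_op ker1 f y).

Definition second_kind_defect y : R :=
  (g0 y * u y + kernel_op kerG u y) - (c * extK y + kernel_op kerK f y).

Lemma first_kind_defect_integrable : intR first_kind_defect.
Proof.
have [a [dW _]] := weighted_kernel_dominated hw hK.
apply: intRB; first exact: kernel_op_integrable dW iu.
apply: intRD; first exact: intRZ (integrable_indic_oo b).
exact: kernel_op_integrable unit_kernel_dominated if_.
Qed.

Lemma second_kind_defect_integrable : intR second_kind_defect.
Proof.
have [a [dG _]] := sonine_kernel_dt_dominated hw hK.
apply: intRB; apply: intRD.
- exact: sonine_diag_mul_integrable.
- exact: kernel_op_integrable dG iu.
- exact: intRZ.
- exact: kernel_op_integrable assoc_kernel_dominated if_.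
Qed.

Lemma assoc_kernel_op0 h x : (forall z, z <= 0 -> h z = 0) -> x <= 0 -> kernel_op kerK h x = 0.
Proof.
move=> h0 x0; rewrite /kernel_op /Rintegral (eq_integral (cst 0%E)) ?integral0// => y _ /=.
congr EFin; have [y0|y0] := leP y 0; first by rewrite h0// mulr0.
by rewrite /assoc_kernel /conv_kernel /zero_ext ext0 ?mul0r// subr_gt0 ltNge (le_trans x0 (ltW y0)).
Qed.

Lemma tri_kernel_op0 (F : R -> R -> R) h x : x <= 0 -> kernel_op (tri_kernel b F) h x = 0.
Proof.
move=> x0; rewrite /kernel_op /Rintegral (eq_integral (cst 0%E)) ?integral0// => y _ /=.
by rewrite tri_kernel0 ?mul0r// ltNge x0.
Qed.

Lemma second_kind_defect0 x : x <= 0 -> second_kind_defect x = 0.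
Proof.
move=> x0; have nx : ~~ (0 < x < b) by rewrite ltNge x0.
rewrite /second_kind_defect u0// mulr0 /sonine_kernel_dt tri_kernel_op0// assoc_kernel_op0//.
by rewrite /zero_ext ext0// mulr0 !addr0 subrr.
Qed.

(** Both sides are compared term by term: those in c and f agree because convolutions commute, and
    those in u because their kernels satisfy g(s,t-s) = g(s,0) + (g(s,t-s) - g(s,0)). *)
Lemma assoc_kernel_first_kind_defect :
  {ae mu, forall t, 0 < t < b -> kernel_op kerK first_kind_defect t = primitive second_kind_defect t}.
Proof.
have [aW [dW _]] := weighted_kernel_dominated hw hK.
have [aG [dG _]] := sonine_kernel_dt_dominated hw hK.
have dK := assoc_kernel_dominated; have d1 := unit_kernel_dominated.
have i1 := integrable_indic_oo b.
have iUf := kernel_op_integrable d1 if_.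
have iKf := kernel_op_integrable dK if_.
have iGu := kernel_op_integrable dG iu.
have ig0u := sonine_diag_mul_integrable iu.
have E1 := kernel_op_comp dK dW iu.
have E2 := kernel_op_comp d1 dG iu.
have E3 := conv_op_swap iK i1 if_.
have E4 := kernel_op_ae dK i1.
have E5 := kernel_op_ae dK iUf.
apply: ae_imply (ae_conj E1 (ae_conj E2 (ae_conj E3 (ae_conj E4 E5)))) => t.
move=> [[iKW iKWu eKW] [[i1G i1Gu e1G] [e3 [iK1 iK1f]]]] tb.
have /andP[t0 tlb] := tb.
have iU h : intR h -> intR (fun y => ker1 t y * h y) by exact: unit_kernel_integrable.
rewrite /first_kind_defect kernel_opB//; last first.
  under eq_fun do rewrite mulrDr mulrCA.
  by apply: intRD => //; exact: intRZ.
rewrite kernel_opD//; last first.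
  under eq_fun do rewrite mulrCA.
  exact: intRZ.
rewrite kernel_opZ// e3 eKW.
rewrite -(unit_kernel_op second_kind_defect0 (ltW tlb)) /second_kind_defect.
have icK : intR (fun y => c * extK y) := intRZ c iK.
rewrite kernel_opB; last 2 first.
  by apply: iU; exact: intRD.
  by apply: iU; exact: intRD.
rewrite !kernel_opD; last 4 first.
  all: try exact: iU.
rewrite kernel_opZ; last exact: iU.
rewrite (convC _ (intR_measurable iK) (intR_measurable i1)).
congr (_ - _).
rewrite e1G /kernel_op -(RintegralD measurableT (iU _ ig0u) i1Gu).
apply: eq_Rintegral => s _.
rewrite (assoc_weighted_kernel hK)// unit_sonine_kernel_dt// /sonine_kernel tri_kernelE//.
have [sb|sb] := boolP (0 < s < b); last first.
  by rewrite u0// !mulr0 addr0.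
have /andP[s0 slb] := sb.
rewrite unit_kernelE// in_itv/= s0/=; case: ifPn => st; last by rewrite !mul0r addr0.
by rewrite mul1r /sonine_diag extE//; ring.
Qed.

End residual.

End core.

(** * Injectivity of the convolution with [K] *)

Section inverse.
Context {R : realType}.
Notation mu := (@lebesgue_measure R).
Notation intR f := (mu.-integrable setT (EFin \o f)).
Variables (b : R) (b0 : 0 < b) (w : R -> R -> R).
Hypothesis hw : weight_conditions b w.
Variables (k K : R -> R) (g : R -> R -> R).
Hypothesis hK : WSC1 b w k K g.
Implicit Types (c s t x y z T : R) (u f H : R -> R).

Local Notation kerK := (assoc_kernel b K).
Local Notation extK := (zero_ext b K).
Local Notation extk := (zero_ext b k).
Local Notation ker1 := (unit_kernel b).

Let iK : intR extK := extK_integrable hK.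
Let ik : intR extk := extk_integrable hK.

(** At s = 0 the weight depends on the integration variable alone and is absorbed into k, so the
    Sonine condition becomes a genuine convolution identity. *)
Definition k0 : R -> R := (fun x => w 0 x * k x) \_ `]0, b[.
Definition g20 : R -> R := (g 0)^`()%classic \_ `]0, b[.

Lemma k0_integrable : intR k0.
Proof.
have [M M0 hM] := weight_bounded hw.
have mw : measurable_fun setT ((w 0) \_ `]0, b[).
  apply/(measurable_restrictT _ _).1 => //.
  apply: open_continuous_measurable_fun; first exact: interval_open.
  move=> x; rewrite inE/= in_itv/= => /andP[x0 xb]; apply: differentiable_continuous.
  by apply/derivable1_diffP; have [_ _ _ dw _] := hw; exact: dw.
have -> : k0 = fun x => ((w 0) \_ `]0, b[) x * extk x.
  apply/funext => x; have [xb|xb] := boolP (0 < x < b).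
    by rewrite /k0 /zero_ext !extE.
  by rewrite /k0 /zero_ext !ext0// mulr0.
apply: (integrable_bounded_mul mw (c := M)) => // x.
have [xb|xb] := boolP (0 < x < b); last by rewrite ext0// normr0.
by rewrite extE//; case/andP: xb => x0 xb; exact: hM.
Qed.

Lemma g20_integrable : intR g20.
Proof.
have [_ _ _ dg [gb igb hgb]] := hK.
have ig := (integrable_patch gb (measurable_itv `]0, b[)).1 igb.
apply: le_integrable ig => //.
  apply/measurable_EFinP; apply/(measurable_restrictT _ _).1 => //.
  by apply: measurable_derive1 => t /andP[t0 tb]; apply: dg; rewrite ?add0r.
move=> x _; rewrite /= lee_fin; have [xb|xb] := boolP (0 < x < b).
  rewrite /g20 !extE//; apply: le_trans (ler_norm _).
  by case/andP: xb => x0 xb; apply: hgb; rewrite ?add0r.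
by rewrite /g20 !ext0.
Qed.

Lemma conv_k0_K t : 0 < t < b -> kernel_op (conv_kernel k0) extK t = g 0 t.
Proof.
move=> /andP[t0 tb].
have [[_ _ +] _ _ _ _] := hK; move=> /(_ 0 t (lexx _) t0).
rewrite add0r => /(_ (ltW tb)) /has_integralP[//|iF <-].
rewrite (convC _ (intR_measurable k0_integrable) (intR_measurable iK)).
apply: eq_Rintegral => z _; rewrite /conv_kernel patchE.
have [z0|z0] := leP z 0.
  by rewrite memNset/= ?in_itv/= ?ltNge ?z0// /k0 ext0 ?mulr0// ltNge z0.
have [zt|tz] := ltP z t; last first.
  rewrite memNset/= ?in_itv/= ?[z < t]ltNge ?tz ?andbF//.
  by rewrite /zero_ext ext0 ?mul0r// subr_gt0 ltNge tz.
rewrite mem_set/= ?in_itv/= ?z0// /k0 extE ?z0 ?(lt_trans zt)//.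
rewrite /zero_ext extE ?addr0; first by rewrite mulrCA mulrA.
by rewrite subr_gt0 zt/= ltrBlDr (lt_trans tb)// ltrDl.
Qed.

Lemma primitive_g20 t : 0 < t < b -> kernel_op ker1 g20 t = g 0 t - g 0 0.
Proof.
move=> /andP[t0 tb]; rewrite unit_kernel_op ?ltW//.
  by rewrite /g20 primitive_patch ?(ltW tb)// (sonine_FTC hK)// add0r.
by move=> x x0; rewrite /g20 ext0// ltNge x0.
Qed.

Lemma conv_op0 p q t : (forall x, x <= 0 -> p x = 0) -> (forall x, x <= 0 -> q x = 0) ->
  t <= 0 -> kernel_op (conv_kernel p) q t = 0.
Proof.
move=> p0 q0 t0; rewrite /kernel_op /Rintegral (eq_integral (cst 0%E)) ?integral0// => y _ /=.
congr EFin; have [y0|y0] := leP y 0; first by rewrite q0// mulr0.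
by rewrite /conv_kernel p0 ?mul0r// subr_le0 (le_trans t0 (ltW y0)).
Qed.

(* The case [s = 0] of the Sonine condition gives [k0 * K = g (0, 0) + 1 * g20]
   (convolutions), so that [K * H = 0] implies that
   [r = g (0, 0) H + g20 * H] has zero primitive; then [H] solves a homogeneous
   second-kind equation. *)
Lemma assoc_kernel_injective H T : T <= b -> intR H -> (forall x, ~~ (0 < x < T) -> H x = 0) ->
  {ae mu, forall t, 0 < t < T -> kernel_op kerK H t = 0} ->
  {ae mu, forall t, H t = 0}.
Proof.
move=> Tb iH H0 KH0.
have i0 := k0_integrable; have i20 := g20_integrable.
have d0 := conv_kernel_dominated i0; have d20 := conv_kernel_dominated i20.
have dK := assoc_kernel_dominated hK; have d1 := @unit_kernel_dominated R b.
have K0 x : x <= 0 -> extK x = 0 by move=> x0; rewrite /zero_ext ext0// ltNge x0.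
have k00 x : x <= 0 -> k0 x = 0 by move=> x0; rewrite /k0 ext0// ltNge x0.
have g200 x : x <= 0 -> g20 x = 0 by move=> x0; rewrite /g20 ext0// ltNge x0.
have H00 x : x <= 0 -> H x = 0 by move=> x0; rewrite H0// ltNge x0.
have g00 : g 0 0 != 0.
  have [_ [nlo [nhi [_ _ hn]]] _ _ _] := hK.
  by have [] := hn 0 ltac:(by rewrite lexx ltW).
pose r x := g 0 0 * H x + kernel_op (conv_kernel g20) H x.
have i20H := kernel_op_integrable d20 iH.
have ir : intR r by apply: intRD => //; exact: intRZ.
have r0 x : x <= 0 -> r x = 0.
  by move=> x0; rewrite /r H00// mulr0 add0r conv_op0.
have pr : {ae mu, forall t, 0 < t < T -> primitive r t = 0}.
  have E1 := kernel_op_comp d0 dK iH.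
  have E2 := kernel_op_comp d1 d20 iH.
  apply: ae_imply (ae_conj E1 E2) => t [[i0K i0KH e0K] [i1G i1GH e1G]] /andP[t0 tT].
  have tb := lt_le_trans tT Tb.
  rewrite -(unit_kernel_op r0 (ltW tb)) /r kernel_opD; last 2 first.
  - by apply: unit_kernel_integrable; exact: intRZ.
  - exact: unit_kernel_integrable.
  rewrite e1G.
  (* The hypothesis speaks of y in []0, T[] only; [k0] kills y >= t, and the inner convolution
     vanishes for y <= 0. *)
  have z0 : kernel_op (conv_kernel k0) (kernel_op kerK H) t = 0.
    rewrite /kernel_op -[RHS](_ : \int[mu]_y (0 : R) = 0); last first.
      by rewrite /Rintegral integral0.
    apply: ae_eq_Rintegral => //; first exact: intR_measurable i0K.
    apply: ae_imply KH0 => y yT.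
    have [y0|y0] := leP y 0; first by rewrite [X in _ * X]conv_op0// mulr0.
    have [yt|ty] := ltP y t; last by rewrite /conv_kernel k00 ?mul0r// subr_le0.
    by rewrite [X in _ * X]yT ?mulr0// y0 (lt_trans yt tT).
  rewrite -[RHS]z0 e0K [kernel_op ker1 (fun=> _) t]/kernel_op.
  rewrite -(RintegralD measurableT (unit_kernel_integrable b t (intRZ (g 0 0) iH)) i1GH).
  apply: eq_Rintegral => s _.
  have [sT|sT] := boolP (0 < s < T); last by rewrite H0// !mulr0 addr0.
  have /andP[s0 slT] := sT.
  have m0 := intR_measurable i0; have mK := intR_measurable iK.
  have m20 := intR_measurable i20.
  rewrite (conv_kernel_comp _ _ m0 mK).
  have -> : \int[mu]_y (ker1 t y * conv_kernel g20 y s) = conv_kernel (kernel_op ker1 g20) t s.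
    by rewrite conv_kernel_comp//; exact: measurable_indic.
  set P := kernel_op (conv_kernel k0) extK; set Q := kernel_op ker1 g20.
  rewrite unit_kernelE ?t0// /conv_kernel.
  have [st|ts] := ltP s t; last first.
    rewrite /P conv_op0 ?subr_le0// /Q conv_op0 ?subr_le0//.
      by rewrite !mul0r addr0.
    by move=> x x0; rewrite indicE memNset//= in_itv/= ltNge x0.
  have tsb : 0 < t - s < b by rewrite subr_gt0 st ltrBlDr (lt_trans tb)// ltrDl.
  by rewrite /P conv_k0_K// /Q primitive_g20// mul1r; ring.
have := primitive_eq0 ir pr => rT.
have iA : intR (fun x => - (g 0 0)^-1 * g20 x) by exact: intRZ.
apply: (volterra_equation_unique (conv_kernel_dominated iA) (b := T)) => //.
- by move=> x x0; rewrite g200// mulr0 normr0.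
- apply: ae_imply (ae_conj rT (kernel_op_ae d20 iH)) => t [rt it]; rewrite in_itv/= => /rt.
  rewrite /r => /eqP; rewrite addr_eq0 => /eqP e.
  have -> : kernel_op (conv_kernel (fun x => - (g 0 0)^-1 * g20 x)) H t =
      - (g 0 0)^-1 * kernel_op (conv_kernel g20) H t.
    rewrite /kernel_op -RintegralZl//; apply: eq_Rintegral => y _.
    by rewrite /conv_kernel mulrA.
  by rewrite mulNr -mulrN -e mulKf.
Qed.

(* If [K] vanished near 0, so would [k0 * K = g (0, .)], against [g (0, 0) <> 0]. *)
Lemma extK_nontrivial d : 0 < d -> d <= b -> 0 < \int[mu]_(x in `]0, d[) `|extK x|.
Proof.
move=> d0 db; rewrite lt_neqAle Rintegral_ge0// andbT; apply/negP => /eqP/esym.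
rewrite Rintegral_indicE => i0.
have iKd : intR (fun x => extK x * \1_(`]0, d[%classic) x) by exact: integrable_indic_mul.
have {}i0 : \int[mu]_x `|extK x * \1_(`]0, d[%classic) x| = 0.
  rewrite -[RHS]i0; apply: eq_Rintegral => x _; rewrite normrM; congr (_ * _).
  by rewrite ger0_norm.
have K0 := Rintegral_norm_eq0 iKd i0.
have g0t t : 0 < t < d -> g 0 t = 0.
  move=> /andP[t0 td]; have tb := lt_le_trans td db.
  rewrite -conv_k0_K ?t0//.
  rewrite (convC _ (intR_measurable k0_integrable) (intR_measurable iK)).
  (* After reflection the argument of [K] is the integration variable itself, so its vanishing
     almost everywhere can be used. *)
  rewrite /kernel_op -(@Rintegral_reflect _ t); last first.
    apply: measurable_funM; last exact: intR_measurable k0_integrable.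
    by apply: measurable_conv_kernel2; exact: intR_measurable iK.
  rewrite -[RHS](_ : \int[mu]_y (0 : R) = 0); last by rewrite /Rintegral integral0.
  apply: ae_eq_Rintegral => //.
    rewrite /conv_kernel; apply: measurable_funM.
      under eq_fun do rewrite subKr; exact: intR_measurable iK.
    apply: measurableT_comp; first exact: intR_measurable k0_integrable.
    exact: measurable_funB.
  apply: ae_imply K0 => x; rewrite /conv_kernel subKr indicE.
  have [xd|xd] := boolP (x \in `]0, d[%classic); first by rewrite mulr1 => ->; rewrite mul0r.
  move=> _; have [x0|x0] := leP x 0; first by rewrite /zero_ext ext0 ?mul0r// ltNge x0.
  have tx : t <= x.
    move: xd; rewrite notin_setE/= in_itv/= x0/= => /negP; rewrite -leNgt.
    exact: le_trans (ltW td).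
  by rewrite /k0 ext0 ?mulr0// subr_gt0 [x < t]ltNge tx.
have := sonine_cvg0 hK (lexx 0) b0.
have [_ [nlo [nhi [_ _ hn]]] _ _ _] := hK.
have [g00 _] := hn 0 ltac:(by rewrite lexx ltW).
move=> /cvgrPdist_lt /(_ `|g 0 0|); rewrite normr_gt0 => /(_ g00)[e /= e0 he].
(* Here g(0,x) = 0 since x < d, while x < e forces g(0,x) to be closer to g(0,0) than |g(0,0)|. *)
pose x := Num.min (d / 2) (e / 2).
have x0 : 0 < x by rewrite lt_min !divr_gt0.
have xd : x < d by rewrite gt_min; apply/orP; left; lra.
have xe : x < e by rewrite gt_min; apply/orP; right; lra.
have := he x; rewrite /= sub0r normrN (gtr0_norm x0) => /(_ xe x0).
by rewrite (g0t x) ?x0// subr0 ltxx.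
Qed.

End inverse.

(** * Local integrability of the right-hand side *)

Section deconvolution.
Context {R : realType}.
Notation mu := (@lebesgue_measure R).
Notation intR f := (mu.-integrable setT (EFin \o f)).
Implicit Types (c s t x y z T d b : R) (q f : R -> R).

Lemma intR_shift c f : intR f -> intR (fun x => f (x + c)).
Proof.
move=> if_; have mf := intR_measurable if_; apply/integrableP; split.
  by apply/measurable_EFinP; apply: measurableT_comp => //; exact: measurable_funD.
rewrite (@integral_shift _ c (fun x => `|(f x)%:E|%E)).
  by case/integrableP : if_.
by apply: measurableT_comp => //; exact/measurable_EFinP.
Qed.

(* On the set [A N] of the [t] for which the integral is at most [N], integrate in
   [t] and exchange: [y] is weighted by the mass of [|q|] on [A N - y], which is
   bounded below uniformly in [y] once [A N] misses little of [`]0, b[]. *)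
Lemma conv_finite_integrable q f b d : intR q -> measurable_fun setT f ->
  0 < d -> d < b -> (forall x, ~~ (0 < x < b - d) -> f x = 0) ->
  0 < \int[mu]_(x in `]0, d[) `|q x| ->
  {ae mu, forall t, 0 < t < b -> (\int[mu]_y `|(q (t - y) * f y)%:E| < +oo)%E} ->
  intR f.
Proof.
move=> iq mf d0 db f0 kap0 finPhi.
have mq := intR_measurable iq.
pose p (x : R) : R := `|q x| * \1_(`]0, d[%classic) x.
have ip : intR p by apply: integrable_indic_mul => //; exact: integrable_norm.
have mp := intR_measurable ip.
have p0 x : 0 <= p x by rewrite mulr_ge0.
set kap := \int[mu]_(x in `]0, d[) `|q x| in kap0.
have kapE : \int[mu]_x p x = kap by exact/esym/Rintegral_indicE.
pose Phi (t : R) : \bar R := (\int[mu]_y `|(q (t - y) * f y)%:E|)%E.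
have Phi0 t : (0 <= Phi t)%E by exact: integral_ge0.
have mqf : measurable_fun setT (fun z : R * R => `|(q (z.1 - z.2) * f z.2)%:E|%E).
  apply: measurableT_comp => //; apply/measurable_EFinP; apply: measurable_funM.
    by apply: measurableT_comp => //; exact: measurable_funB.
  exact: measurableT_comp.
have mPhi : measurable_fun setT Phi.
  exact: (@ge0_measurable_integral2 _ (fun t y => `|(q (t - y) * f y)%:E|%E)).
pose B (N : nat) : set R := `]0, b[ `&` [set t | (N%:R%:E < Phi t)%E].
pose A (N : nat) : set R := `]0, b[ `&` [set t | (Phi t <= N%:R%:E)%E].
have mB N : measurable (B N).
  apply: measurableI => //; rewrite -[X in measurable X]setTI.
  exact: emeasurable_fun_o_infty.
have mA N : measurable (A N).
  apply: measurableI => //; rewrite -[X in measurable X]setTI.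
  exact: emeasurable_fun_infty_c.
have ioo := integrable_indic_oo b.
have B_le N x : \1_(B N) x <= \1_(`]0, b[%classic) x :> R.
  rewrite !indicE ler_nat; case: (boolP (x \in B N)) => //.
  by rewrite inE => -[xb _]; rewrite mem_set.
have [||_ cvB] := @Rintegral_dominated_cvg R (fun N => \1_(B N)) (fun=> 0) (\1_(`]0, b[%classic))
  (fun N => measurable_indic (mB N)) (measurable_cst _) _ ioo _.
- apply: ae_imply finPhi => t ht; apply/cvgrPdist_lt => e e0.
  have [tb|tb] := boolP (0 < t < b); last first.
    near=> N; rewrite indicE memNset ?subrr ?normr0//.
    by move=> [+ _]; rewrite /= in_itv/=; exact/negP.
  have Phifin : Phi t \is a fin_num by rewrite ge0_fin_numE//; exact: ht.
  near=> N; rewrite indicE memNset ?subrr ?normr0//.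
  move=> [_] /=; rewrite -(fineK Phifin) lte_fin; apply/negP; rewrite -leNgt.
  by near: N; exact: nbhs_infty_ger.
- by apply: aeW => x N; rewrite ger0_norm.
have kap4 : 0 < kap / 4 by rewrite divr_gt0.
(* On the bad set [B N] the part of [p] below m has mass at most m mu(B N) < kap / 4, and the
   remainder has mass below kap / 4; so at least kap / 2 stays on [A N]. *)
have [m hm] := clamp_approx ip kap4.
have [N hN] : exists N, m%:R * \int[mu]_x \1_(B N) x < kap / 4.
  have km : 0 < kap / 4 / m.+1%:R by rewrite divr_gt0.
  move: cvB; rewrite {2}/Rintegral integral0 => /cvgrPdist_lt/(_ _ km)[N _ /(_ N (leqnn N))].
  have I0 : 0 <= \int[mu]_x (\1_(B N) x : R) by apply: Rintegral_ge0.
  rewrite sub0r normrN ger0_norm// ltr_pdivlMr// => h; exists N.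
  apply: le_lt_trans h; rewrite mulrC ler_wpM2l// ler_nat; exact: leqnSn.
have iB : intR (\1_(B N)).
  apply: le_integrable ioo => //.
    by apply/measurable_EFinP; exact: measurable_indic (mB N).
  by move=> x _; rewrite /= lee_fin !ger0_norm.
have m1A : measurable_fun setT (\1_(A N) : R -> R) := measurable_indic (mA N).
have ipy y : intR (fun t => p (t - y)) by exact: intR_shift.
have iAp y : intR (fun t => \1_(A N) t * p (t - y)).
  apply: (integrable_bounded_mul m1A (c := 1)) => // x.
  by rewrite indicE; case: (_ \in _); rewrite ?normr1 ?normr0.
pose r (x : R) : R := p x - clamp m%:R (p x).
have ir : intR r.
  apply: (@le_integrable _ _ _ mu setT measurableT _ (EFin \o p)) => //.
    apply/measurable_EFinP; apply: measurable_funB => //.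
    by apply: measurableT_comp => //; exact: measurable_clamp.
  by move=> x _ /=; rewrite lee_fin clamp_dist.
have inr := integrable_norm ir.
have iry y : intR (fun t => `|r (t - y)|) by exact: (intR_shift (- y) inr).
have imB : intR (fun t => m%:R * \1_(B N) t) by exact: (integrableZl measurableT m%:R iB).
have lower y : 0 < y < b - d -> kap / 2 <= \int[mu]_t (\1_(A N) t * p (t - y)).
  move=> /andP[y0 ybd].
  have : kap <= \int[mu]_t (\1_(A N) t * p (t - y)) +
      (m%:R * \int[mu]_x \1_(B N) x + \int[mu]_x `|r x|).
    rewrite -kapE -(Rintegral_shift (- y) mp) -(Rintegral_shift (- y) (intR_measurable inr)).
    rewrite -RintegralZl//.
    rewrite -(RintegralD measurableT imB (iry y)).
    rewrite -(RintegralD measurableT (iAp y) (integrableD measurableT imB (iry y))).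
    apply: le_Rintegral => //.
      exact: (integrableD measurableT (iAp y) (integrableD measurableT imB (iry y))).
    move=> t _.
    (* For 0 < y < b - d the translate of [p] by y lives in []y, y + d[], inside []0, b[], so no
       mass escapes. *)
    have [tb|tb] := boolP (0 < t < b); last first.
      have -> : p (t - y) = 0.
        rewrite /p indicE memNset ?mulr0// /= in_itv/= subr_gt0 => /andP[yt tyd].
        move/negP: tb; apply; rewrite (lt_trans y0 yt)/=.
        by rewrite ltrBlDr in tyd; rewrite (lt_trans tyd)// addrC -ltrBrDr.
      by rewrite mulr0 add0r addr_ge0// mulr_ge0.
    have [tA|tB] := leP (Phi t) N%:R%:E.
      rewrite [X in X * _]indicE mem_set ?mul1r; last by split => //; rewrite /= in_itv.
      by rewrite lerDl addr_ge0// mulr_ge0.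
    rewrite [X in X * _]indicE memNset; last by move=> [_ /=]; rewrite leNgt tB.
    rewrite mul0r add0r [X in _ * X]indicE mem_set; last by split => //; rewrite /= in_itv.
    rewrite mulr1 -[p (t - y)](subrK (clamp m%:R (p (t - y)))) [leRHS]addrC.
    apply: lerD; first exact: ler_norm.
    by rewrite (le_trans (ler_norm _))// clamp_norm.
  move: hm hN; rewrite -/(r _).
  set X1 := \int[mu]_t (\1_(A N) t * p (t - y)).
  set X2 := m%:R * _; set X3 := \int[mu]_x `|p x - _|.
  by clearbody X1 X2 X3; move: kap0; clear; move=> *; lra.
apply/integrableP; split; first exact/measurable_EFinP.
have mAp : measurable_fun setT (fun z : R * R => (\1_(A N) z.2 * p (z.2 - z.1) * `|f z.1|)%:E).
  apply/measurable_EFinP; apply: measurable_funM; last by do 2! apply: measurableT_comp => //.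
  apply: measurable_funM; first exact: measurableT_comp.
  by apply: measurableT_comp => //; exact: measurable_funB.
have Ap0 y t : (0 <= (\1_(A N) t * p (t - y) * `|f y|)%:E)%E.
  by rewrite lee_fin !mulr_ge0.
have h1 : ((kap / 2)%:E * \int[mu]_y `|(f y)%:E| <=
    \int[mu]_y \int[mu]_t (\1_(A N) t * p (t - y) * `|f y|)%:E)%E.
  rewrite -ge0_integralZl//; last 2 first.
  - by apply: measurableT_comp => //; exact/measurable_EFinP.
  - by rewrite lee_fin divr_ge0// ltW.
  apply: ge0_le_integral => //.
  - by move=> y _; rewrite mule_ge0// lee_fin divr_ge0// ltW.
  - by apply: measurable_funeM; apply: measurableT_comp => //; exact/measurable_EFinP.
  - exact: (@ge0_measurable_integral2 _ (fun y t => (\1_(A N) t * p (t - y) * `|f y|)%:E)).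
  move=> y _; have [yb|yb] := boolP (0 < y < b - d); last first.
    by rewrite [in leLHS]f0// abse0 mule0; apply: integral_ge0 => t _; exact: Ap0.
  under eq_integral do rewrite EFinM.
  rewrite ge0_integralZr//; last 2 first.
  - by apply/measurable_EFinP; exact: intR_measurable (iAp y).
  - by move=> t _; rewrite lee_fin mulr_ge0.
  apply: lee_wpmul2r => //.
  rewrite -[leRHS]fineK; last exact: integrable_fin_num (iAp y).
  by rewrite lee_fin; exact: lower.
have h2 : (\int[mu]_y \int[mu]_t (\1_(A N) t * p (t - y) * `|f y|)%:E <= (N%:R * b)%:E)%E.
  rewrite (@ge0_integral_swap _ (fun y t => (\1_(A N) t * p (t - y) * `|f y|)%:E))//.
  apply: (@le_trans _ _ (\int[mu]_(t in `]0%R, b[) N%:R%:E)%E); last first.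
    have e : mu `]0, b[ = b%:E.
      by rewrite lebesgue_measure_itv/= lte_fin (lt_trans d0 db) sube0.
    by rewrite integral_cst// EFinM -e.
  rewrite [leRHS]integral_mkcond; apply: ge0_le_integral => //.
  - by move=> t _; exact: integral_ge0.
  - exact: (@ge0_measurable_integral1 _ (fun y t => (\1_(A N) t * p (t - y) * `|f y|)%:E)).
  - by apply/(measurable_restrictT _ _).1.
  move=> t _; rewrite patchE.
  have [tA|tA] := pselect (A N t); last first.
    under eq_integral do rewrite indicE memNset// !mul0r.
    by rewrite integral0; case: ifP => _ //; rewrite lee_fin.
  rewrite mem_set; last by case: tA.
  apply: le_trans (_ : Phi t <= _)%E; last by case: tA.
  apply: ge0_le_integral => //.
  - exact: (@measurable_section1 _ _ _ (fun y t => (\1_(A N) t * p (t - y) * `|f y|)%:E)).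
  - exact: (@measurable_section2 _ _ _ (fun t y => `|(q (t - y) * f y)%:E|%E)).
  move=> y _; rewrite /= lee_fin normrM ler_wpM2r// indicE mem_set// mul1r.
  by rewrite /p ler_piMr// indicE; case: (_ \in _).
have := le_lt_trans (le_trans h1 h2) (ltry _).
rewrite ltNge => /negP; rewrite ltNge => h; apply/negP => foo; apply: h.
by move: foo; rewrite leye_eq => /eqP ->; rewrite mulry gtr0_sg ?divr_gt0// mul1e.
Unshelve. all: by end_near.
Qed.

End deconvolution.

(** The countably many values T = b - 1 / (n + 1) exhaust the interval, and a countable union of
    null sets is null. *)
Lemma ae_exhaust (R : realType) (b : R) (P : R -> Prop) :
  (forall T, 0 < T -> T < b -> {ae @lebesgue_measure R, forall t, 0 < t < T -> P t}) ->
  {ae @lebesgue_measure R, forall t, 0 < t < b -> P t}.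
Proof.
move=> h.
have hn (n : nat) : {ae @lebesgue_measure R, forall t, 0 < t < b - n.+1%:R^-1 -> P t}.
  have [T0|T0] := leP (b - n.+1%:R^-1) 0.
    by apply: aeW => t /andP[t0 /(lt_trans t0)]; rewrite ltNge T0.
  by apply: h => //; rewrite gtrBl invr_gt0.
apply: ae_imply (ae_foralln hn) => t ht /andP[t0 tb].
have bt : 0 < b - t by rewrite subr_gt0.
have [N _ /(_ N (leqnn N)) hN] := natSinv_lt bt.
by apply: (ht N); rewrite t0/= ltrBrDr addrC -ltrBrDr.
Qed.

(** * Both equations as vanishing defects *)

Section equivalence.
Context {R : realType}.
Notation mu := (@lebesgue_measure R).
Notation intR f := (mu.-integrable setT (EFin \o f)).
Variables (b : R) (b0 : 0 < b) (w : R -> R -> R).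
Hypothesis hw : weight_conditions b w.
Variables (k K : R -> R) (g : R -> R -> R).
Hypothesis hK : WSC1 b w k K g.
Variables (f : R -> R) (c : R).
Hypothesis mf : measurable_fun `]0, b[ f.
Implicit Types (s t x y z T : R) (u v : R -> R).

Local Notation kerK := (assoc_kernel b K).
Local Notation kerW := (weighted_kernel b w k).
Local Notation kerG := (sonine_kernel_dt b g).

Lemma tri_kernel_patch (F : R -> R -> R) u t : 0 < t < b ->
  (fun y => tri_kernel b F t y * (u \_ `]0, b[) y) = (fun y => F t y * u y) \_ `]0, t[.
Proof.
move=> tb; have /andP[t0 tltb] := tb; apply/funext => y; rewrite [RHS]patchE tri_kernelE//.
have [yt|yt] := boolP (y \in `]0, t[).
  rewrite [in RHS]mem_set//; move: yt; rewrite in_itv/= => /andP[y0 yt].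
  by rewrite extE// y0 (lt_trans yt).
by rewrite mul0r [in RHS]memNset//; exact/negP.
Qed.

Lemma assoc_kernel_patch T t : 0 < t < b -> t <= T ->
  (fun y => kerK t y * (f \_ `]0, T[) y) = (fun y => K (t - y) * f y) \_ `]0, t[.
Proof.
move=> /andP[t0 tb] tT; apply/funext => y; rewrite [RHS]patchE.
rewrite /assoc_kernel /conv_kernel.
have [yt|yt] := boolP (y \in `]0, t[).
  rewrite [in RHS]mem_set//; move: yt; rewrite in_itv/= => /andP[y0 yt].
  rewrite extE ?y0 ?(lt_le_trans yt)// /zero_ext extE// subr_gt0 yt.
  by rewrite ltrBlDr (lt_trans tb)// ltrDl.
rewrite [in RHS]memNset; last exact/negP.
have [y0|y0] := leP y 0; first by rewrite ext0 ?mulr0// ltNge y0.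
move: yt; rewrite in_itv/= y0/= -leNgt => ty.
by rewrite /zero_ext ext0 ?mul0r// subr_gt0 ltNge ty.
Qed.

Lemma has_integral_tri_kernel (F : R -> R -> R) u t z : 0 < t < b ->
  has_integral `]0, t[ (fun s => F t s * u s) z <->
  intR (fun s => tri_kernel b F t s * (u \_ `]0, b[) s) /\
  kernel_op (tri_kernel b F) (u \_ `]0, b[) t = z.
Proof. by move=> tb; rewrite has_integralP// /kernel_op -tri_kernel_patch. Qed.

Lemma has_integral_assoc_kernel T t z : 0 < t < b -> t <= T ->
  has_integral `]0, t[ (fun y => K (t - y) * f y) z <->
  intR (fun s => kerK t s * (f \_ `]0, T[) s) /\ kernel_op kerK (f \_ `]0, T[) t = z.
Proof. by move=> tb tT; rewrite has_integralP// /kernel_op -(assoc_kernel_patch tb tT). Qed.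

(** What either equation forces on f; integrability may fail at b, which is why the defects are
    formed with f cut at T < b. *)
Definition locally_L1 := forall T, 0 < T -> T < b -> mu.-integrable `]0, T[ (EFin \o f).

Lemma locally_L1_patch T : locally_L1 -> 0 < T -> T < b -> intR (f \_ `]0, T[).
Proof. by move=> Lf T0 Tb; exact: (integrable_patch f (measurable_itv _)).1 (Lf T T0 Tb). Qed.

Lemma L1_patch u : L1 b u -> intR (u \_ `]0, b[).
Proof. by move=> Lu; exact: (integrable_patch u (measurable_itv _)).1 Lu. Qed.

(** The version F is forced to be c plus the primitive of f, by the fundamental theorem on each
    [0,t]; conversely that function serves as F. *)
Lemma nonlocal_solutionP u : L1 b u -> nonlocal_solution b w k f c u <->
  locally_L1 /\ forall T, 0 < T -> T < b -> {ae mu, forall t, 0 < t < T ->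
    first_kind_defect b w k (u \_ `]0, b[) (f \_ `]0, T[) c t = 0}.
Proof.
move=> Lu; have iu := L1_patch Lu.
have [aW [dW _]] := weighted_kernel_dominated hw hK.
have fT0 T x : x <= 0 -> (f \_ `]0, T[) x = 0 by move=> x0; rewrite ext0// ltNge x0.
have defE T t : 0 < t -> t < T -> T < b -> first_kind_defect b w k (u \_ `]0, b[) (f \_ `]0, T[) c t =
    kernel_op kerW (u \_ `]0, b[) t - (c + primitive f t).
  move=> t0 tT Tb; rewrite /first_kind_defect.
  have tb := lt_trans tT Tb.
  rewrite indicE mem_set ?mulr1/= ?in_itv/= ?t0//.
  by rewrite (unit_kernel_op (fT0 T) (ltW tb)) primitive_patch ?ltW.
have mf' T : T <= b -> measurable_fun `]0, T[ f.
  move=> Tb; apply: measurable_funS mf => // x; rewrite /= !in_itv/= => /andP[-> xT].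
  exact: lt_le_trans xT Tb.
split.
  move=> [F [acF F0 hF dF]].
  have FTC t : 0 < t -> t < b -> mu.-integrable `]0, t[ (EFin \o f) /\ F t = c + primitive f t.
    move=> t0 tb; have [||i e] := @abs_continuous_FTC R t F f t0 (acF t t0 tb).
    - exact: mf' (ltW tb).
    - apply: ae_imply dF => x dx; rewrite /= in_itv/= => /andP[x0 xt]; apply: dx.
      by rewrite /= in_itv/= x0 (lt_trans xt tb).
    by rewrite -e F0; split => //; ring.
  split=> [T T0 Tb|T T0 Tb]; first by have [] := FTC T T0 Tb.
  apply: ae_imply hF => t ht /andP[t0 tT]; have tb := lt_trans tT Tb.
  have := ht ltac:(by rewrite /= in_itv/= t0 tb).
  move=> /(has_integral_tri_kernel (fun t s => w s t * k (t - s)) _ _ (introT andP (conj t0 tb)))[_ e].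
  by rewrite defE// /weighted_kernel e (FTC t t0 tb).2 subrr.
move=> [Lf hT]; exists (fun t => c + primitive f t); split.
- move=> t t0 tb e e0.
  have [d d0 hd] := primitive_abs_continuous t (locally_L1_patch Lf t0 tb) e0.
  exists d => // n x y xy tI sd; apply: le_lt_trans (hd n x y xy tI sd).
  apply: ler_sum => i _; have [x0 [xyi yt]] := xy i.
  by rewrite !primitive_patch// ?(le_trans xyi yt)// opprD addrACA subrr add0r.
- by rewrite /primitive set_itvoo0 Rintegral_set0 addr0.
- have : {ae mu, forall t, 0 < t < b ->
      has_integral `]0, t[ (fun s => w s t * k (t - s) * u s) (c + primitive f t)}.
    apply: ae_exhaust => T T0 Tb.
    apply: ae_imply (ae_conj (hT T T0 Tb) (kernel_op_ae dW iu)) => t [ht it] /andP[t0 tT].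
    have tb := lt_trans tT Tb.
    apply/(has_integral_tri_kernel (fun t s => w s t * k (t - s)) _ _
      (introT andP (conj t0 tb))); split => //.
    have := ht ltac:(by rewrite t0 tT); rewrite defE// => /eqP.
    by rewrite subr_eq0 => /eqP.
  by apply: ae_imply => t ht; rewrite /= in_itv/=; exact: ht.
- have : {ae mu, forall t, 0 < t < b -> derivable (fun t => c + primitive f t) t 1 /\
      (fun t => c + primitive f t)^`()%classic t = f t}.
    apply: ae_exhaust => T T0 Tb.
    apply: ae_imply (primitive_derivable (locally_L1_patch Lf T0 Tb)) => t dt /andP[t0 tT].
    have [dp pE] := dt t0.
    have idp : is_derive t 1 (primitive (f \_ `]0, T[)) (f t).
      by apply: DeriveDef => //; rewrite -derive1E pE extE// t0 tT.
    have idc : is_derive t 1 (fun x => c + primitive f x) (0 + f t).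
      apply: is_deriveD.
      apply: (@near_eq_is_derive _ _ _ (primitive (f \_ `]0, T[))) => //.
      near=> x; rewrite primitive_patch//; apply: ltW; near: x; exact: lt_nbhsl.
    by split; [exact: ex_derive|rewrite derive1E derive_val add0r].
  by apply: ae_imply => t ht; rewrite /= in_itv/=; exact: ht.
Unshelve. all: by end_near.
Qed.

(* The Volterra equation only presupposes that [K (t - .) f] is integrable for almost
   every [t]. *)
Lemma volterra_locally_L1 u : volterra_solution b g K f c u -> locally_L1.
Proof.
move=> vu T T0 Tb; apply/integrable_patch => //.
have iK := extK_integrable hK.
have mfT : measurable_fun setT (f \_ `]0, T[).
  apply/(measurable_restrictT _ _).1 => //; apply: measurable_funS mf => // x.
  by rewrite /= !in_itv/= => /andP[-> xT]; exact: lt_trans xT Tb.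
have d0 : 0 < b - T by rewrite subr_gt0.
(* With d = b - T, the function f cut at T is supported in []0, b - d[], and [K] has positive mass
   on []0, d[]. *)
apply: (conv_finite_integrable iK mfT d0 (b := b)).
- by rewrite gtrBl.
- by move=> x; rewrite subKr => xT; rewrite ext0.
- by apply: (extK_nontrivial b0 hw hK) => //; rewrite gerBl ltW.
- apply: ae_imply vu => t vt tb.
  have [I [J [_ hJ _]]] := vt ltac:(by rewrite /= in_itv).
  have /andP[t0 tltb] := tb.
  have [iJ _] := (has_integral_assoc_kernel _ tb (lexx t)).1 hJ.
  have /integrableP[_] := iJ; apply: le_lt_trans.
  apply: ge0_le_integral => //.
  - apply: measurableT_comp => //; apply/measurable_EFinP; apply: measurable_funM => //.
    by apply: measurable_conv_kernel2; exact: intR_measurable iK.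
  - by apply: measurableT_comp => //; exact: measurable_int iJ.
  move=> y _; rewrite /= lee_fin !normrM /assoc_kernel /conv_kernel.
  have [y0|y0] := leP y 0; first by rewrite !ext0// ltNge y0.
  have [yt|ty] := ltP y t; last by rewrite /zero_ext ext0 ?normr0 ?mul0r// subr_gt0 ltNge ty.
  rewrite ler_wpM2l// [in leRHS]patchE mem_set/= ?in_itv/= ?y0//.
  by rewrite patchE; case: ifP => _; rewrite ?normr0.
Qed.

(** Multiplication by g(t,0), nonzero on the interval, turns the equation into the vanishing of the
    defect; cutting f at T > t does not change the integral at t. *)
Lemma volterra_solutionP u : L1 b u -> volterra_solution b g K f c u <->
  locally_L1 /\ forall T, 0 < T -> T < b -> {ae mu, forall t, 0 < t < T ->
    second_kind_defect b K g (u \_ `]0, b[) (f \_ `]0, T[) c t = 0}.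
Proof.
move=> Lu; have iu := L1_patch Lu.
have [aG [dG _]] := sonine_kernel_dt_dominated hw hK.
have dK := assoc_kernel_dominated hK.
have gt0 t : 0 < t < b -> g t 0 != 0.
  move=> /andP[t0 tb]; have [_ [nlo [nhi [_ _ hn]]] _ _ _] := hK.
  by have [] := hn t ltac:(by rewrite !ltW).
have defE T t I J : 0 < t -> t < T -> T < b ->
    kernel_op kerG (u \_ `]0, b[) t = I -> kernel_op kerK (f \_ `]0, T[) t = J ->
    (second_kind_defect b K g (u \_ `]0, b[) (f \_ `]0, T[) c t = 0 <->
     u t + 1 / g t 0 * I = c * (K t / g t 0) + 1 / g t 0 * J).
  move=> t0 tT Tb eI eJ; have tb := lt_trans tT Tb.
  have gt := gt0 t ltac:(by rewrite t0 tb).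
  rewrite /second_kind_defect eI eJ /sonine_diag /zero_ext !extE ?t0//.
  have -> : u t + 1 / g t 0 * I = (g t 0 * u t + I) / g t 0 by field.
  have -> : c * (K t / g t 0) + 1 / g t 0 * J = (c * K t + J) / g t 0 by field.
  split=> [/eqP|/(divIf gt)->]; last by rewrite subrr.
  by rewrite subr_eq0 => /eqP ->.
split.
  move=> vu; split; first exact: volterra_locally_L1 vu.
  move=> T T0 Tb; apply: ae_imply vu => t vt /andP[t0 tT]; have tb := lt_trans tT Tb.
  have t0b : 0 < t < b by rewrite t0 tb.
  have [I [J [hI hJ e]]] := vt ltac:(by rewrite /= in_itv).
  have [_ eI] := (has_integral_tri_kernel (fun t s => (g s)^`()%classic (t - s)) _ _ t0b).1 hI.
  have [_ eJ] := (has_integral_assoc_kernel _ t0b (ltW tT)).1 hJ.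
  exact/(defE T t I J).
move=> [Lf hT].
suff : {ae mu, forall t, 0 < t < b -> exists I J : R,
      [/\ has_integral `]0, t[ (fun y => (g y)^`()%classic (t - y) * u y) I,
          has_integral `]0, t[ (fun y => K (t - y) * f y) J &
          u t + 1 / g t 0 * I = c * (K t / g t 0) + 1 / g t 0 * J]}.
  by apply: ae_imply => t ht; rewrite /= in_itv/=; exact: ht.
apply: ae_exhaust => T T0 Tb.
have iK := kernel_op_ae dK (locally_L1_patch Lf T0 Tb).
have iG := kernel_op_ae dG iu.
apply: ae_imply (ae_conj (hT T T0 Tb) (ae_conj iK iG)) => t [ht [iKt iGt]] /andP[t0 tT].
have tb := lt_trans tT Tb; have t0b : 0 < t < b by rewrite t0 tb.
exists (kernel_op kerG (u \_ `]0, b[) t), (kernel_op kerK (f \_ `]0, T[) t); split.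
- exact/(has_integral_tri_kernel (fun t s => (g s)^`()%classic (t - s)) _ _ t0b).
- exact/(has_integral_assoc_kernel _ t0b (ltW tT)).
- by apply/(defE T t) => //; apply: ht; rewrite t0 tT.
Qed.

Lemma defect_equiv u T : L1 b u -> locally_L1 -> 0 < T -> T < b ->
  {ae mu, forall t, 0 < t < T -> first_kind_defect b w k (u \_ `]0, b[) (f \_ `]0, T[) c t = 0} <->
  {ae mu, forall t, 0 < t < T -> second_kind_defect b K g (u \_ `]0, b[) (f \_ `]0, T[) c t = 0}.
Proof.
move=> Lu Lf T0 Tb; have iu := L1_patch Lu; have iT := locally_L1_patch Lf T0 Tb.
have u0 x : ~~ (0 < x < b) -> (u \_ `]0, b[) x = 0 by exact: ext0.
have f0 x : x <= 0 -> (f \_ `]0, T[) x = 0 by move=> x0; rewrite ext0// ltNge x0.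
have core := assoc_kernel_first_kind_defect hw hK c iu u0 iT f0.
have iF := first_kind_defect_integrable hw hK c iu iT.
have iV := second_kind_defect_integrable hw hK c iu iT.
set F := first_kind_defect _ _ _ _ _ _ in core iF *.
set V := second_kind_defect _ _ _ _ _ _ in core iV *.
have F0 x : x <= 0 -> F x = 0.
  move=> x0; rewrite /F /first_kind_defect /weighted_kernel tri_kernel_op0//.
  rewrite indicE memNset ?mulr0; last by rewrite /= in_itv/= ltNge x0.
  by rewrite /unit_kernel conv_op0// ?addr0 ?subrr// => z z0; rewrite indicE memNset//= in_itv/= ltNge z0.
split=> h.
  apply: primitive_eq0 iV _; apply: ae_imply core => t ct /andP[t0 tT].
  rewrite -ct ?t0 ?(lt_trans tT)//.
  rewrite /kernel_op (ae_eq_Rintegral _ _ (_ : {ae mu, forall y, kerK t y * F y = cst 0 y})) //.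
  - by rewrite /Rintegral integral0.
  - apply: measurable_funM; last exact: intR_measurable iF.
    exact: measurable_conv_kernel2 (intR_measurable (extK_integrable hK)).
  apply: ae_imply h => y Fy; have [y0|y0] := leP y 0; first by rewrite F0// mulr0.
  have [yt|ty] := ltP y t; first by rewrite Fy ?mulr0// y0 (lt_trans yt).
  by rewrite /assoc_kernel /conv_kernel /zero_ext ext0 ?mul0r// subr_gt0 ltNge ty.
(* Injectivity is stated for functions supported in []0, T[]; by causality the cut does not alter
   the convolution with [K] before T. *)
pose H x := F x * \1_(`]0, T[%classic) x.
have iH : intR H by exact: integrable_indic_mul.
have H0 x : ~~ (0 < x < T) -> H x = 0.
  by move=> xT; rewrite /H indicE memNset ?mulr0//= in_itv/=; exact/negP.
have HF t : t < T -> kernel_op kerK H t = kernel_op kerK F t.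
  move=> tT; apply: eq_Rintegral => y _; have [y0|y0] := leP y 0.
    by rewrite F0// H0// ltNge y0.
  have [yt|ty] := ltP y t.
    by rewrite /H indicE mem_set/= ?in_itv/= ?y0 ?(lt_trans yt)// mulr1.
  by rewrite /assoc_kernel /conv_kernel /zero_ext ext0 ?mul0r// subr_gt0 ltNge ty.
have : {ae mu, forall t, H t = 0}.
  apply: (assoc_kernel_injective b0 hw hK (ltW Tb) iH H0).
  apply: ae_imply core => t ct /andP[t0 tT].
  rewrite HF// ct ?t0 ?(lt_trans tT)// /primitive Rintegral_indicE.
  rewrite (ae_eq_Rintegral _ _ (_ : {ae mu, forall y, V y * \1_(`]0, t[%classic) y = cst 0 y})) //.
  - by rewrite /Rintegral integral0.
  - exact: intR_measurable (integrable_indic_mul _ iV).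
  apply: ae_imply h => y Vy; rewrite indicE.
  have [|yt] := boolP (y \in `]0, t[%classic); last by rewrite mulr0.
  by rewrite inE/= in_itv/= => /andP[y0 yt]; rewrite Vy ?mul0r// y0 (lt_trans yt).
apply: ae_imply => t + tT.
by rewrite /H indicE mem_set ?mulr1//= in_itv.
Qed.

End equivalence.

Lemma measurable_inv (R : realType) : measurable_fun setT (@GRing.inv R).
Proof.
(* The square makes the base of the real power nonnegative; at x = 0 both sides are 0 by
   convention. *)
rewrite (_ : GRing.inv = fun x : R => x * (x ^+ 2) `^ (- 1)); last first.
  apply/funext => x; rewrite powR_inv1 ?sqr_ge0//.
  by have [->|x0] := eqVneq x 0; [rewrite invr0 mul0r|field].
apply: measurable_funM => //.
exact: (measurableT_comp (measurable_powR (- 1)) (measurable_funX 2 _)).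
Qed.

(** * Equivalence and solvability *)

Section solve.
Context {R : realType}.
Notation mu := (@lebesgue_measure R).
Notation intR f := (mu.-integrable setT (EFin \o f)).
Variables (b : R) (b0 : 0 < b) (w : R -> R -> R).
Hypothesis hw : weight_conditions b w.
Variables (k K : R -> R) (g : R -> R -> R).
Hypothesis hK : WSC1 b w k K g.
Variables (f : R -> R) (c : R).
Hypothesis mf : measurable_fun `]0, b[ f.
Implicit Types (s t x y z T : R) (u v : R -> R).

Local Notation kerK := (assoc_kernel b K).
Local Notation kerG := (sonine_kernel_dt b g).
Local Notation g0 := (sonine_diag b g).
Local Notation extK := (zero_ext b K).

Lemma nonlocal_volterra u : L1 b u ->
  nonlocal_solution b w k f c u <-> volterra_solution b g K f c u.
Proof.
move=> Lu.
have nP := nonlocal_solutionP hw hK c mf Lu; have vP := volterra_solutionP b0 hw hK c mf Lu.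
have dE T (Lf : locally_L1 b f) := @defect_equiv _ _ b0 _ hw _ _ _ hK f c u T Lu Lf.
by split=> [/nP|/vP] [Lf hT]; [apply/vP|apply/nP]; split => // T T0 Tb; apply/dE => //; exact: hT.
Qed.

(** The kernel of the Volterra equation solved for u, not a series of iterated kernels. Outside []0,
    b[] the convention 0^-1 = 0 makes the factor vanish. *)
Definition resolvent_kernel t y := - (g0 t)^-1 * kerG t y.

Lemma sonine_diag_inv_bounded : exists C, forall x, `|- (g0 x)^-1| <= C.
Proof.
have [_ [nlo [nhi [nlo0 nlohi hn]]] _ _ _] := hK; exists nlo^-1 => x.
rewrite normrN normfV.
have [xb|xb] := boolP (0 < x < b); last by rewrite /sonine_diag ext0// normr0 invr0 invr_ge0 ltW.
rewrite /sonine_diag extE//; have /andP[x0 xltb] := xb.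
have [_ [h _]] := hn x ltac:(by rewrite !ltW).
by rewrite lef_pV2// posrE (lt_le_trans nlo0).
Qed.

Lemma measurable_sonine_diag_inv : measurable_fun setT (fun x => - (g0 x)^-1).
Proof.
apply: measurableT_comp => //; apply: (measurableT_comp (@measurable_inv R)).
exact: (measurable_sonine_diag hw hK).
Qed.

Lemma resolvent_kernel_dominated : exists a,
  dominated_kernel resolvent_kernel a /\ forall x, x <= 0 -> a x = 0.
Proof.
have [a [[mG ia aG] a0]] := sonine_kernel_dt_dominated hw hK; have [C hC] := sonine_diag_inv_bounded.
have C0 : 0 <= C := le_trans (normr_ge0 _) (hC 0).
exists (fun x => C * a x); split; last by move=> x x0; rewrite a0 ?mulr0.
split; last by move=> t y; rewrite /resolvent_kernel normrM ler_pM.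
- apply: measurable_funM mG; apply: (measurableT_comp measurable_sonine_diag_inv).
  exact: measurable_fst.
- exact: intRZ.
Qed.

Lemma second_kind_defectE u (p : R -> R) t : 0 < t < b -> intR (fun y => kerG t y * u y) ->
  second_kind_defect b K g u p c t =
  g0 t * (u t - ((g0 t)^-1 * (c * extK t + kernel_op kerK p t) + kernel_op resolvent_kernel u t)).
Proof.
move=> tb iu.
have -> : kernel_op resolvent_kernel u t = - (g0 t)^-1 * kernel_op kerG u t.
  by rewrite /kernel_op -RintegralZl//; apply: eq_Rintegral => y _; rewrite mulrA.
have gt : g0 t != 0.
  have [_ [nlo [nhi [_ _ hn]]] _ _ _] := hK; have /andP[t0 tltb] := tb.
  by rewrite /sonine_diag extE//; have [] := hn t ltac:(by rewrite !ltW).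
by rewrite /second_kind_defect; field.
Qed.

(** The free term carries f on all of []0, b[], which makes it independent of T and lets the
    equations for different T be glued; before T both cuts of f give the same convolution. *)
Lemma volterra_solution_fixpoint u T : intR u -> 0 < T -> T < b ->
  {ae mu, forall t, 0 < t < T -> second_kind_defect b K g u (f \_ `]0, T[) c t = 0} <->
  {ae mu, forall t, 0 < t < T ->
    u t = (g0 t)^-1 * (c * extK t + kernel_op kerK (f \_ `]0, b[) t) +
          kernel_op resolvent_kernel u t}.
Proof.
move=> iu T0 Tb; have [a [dG _]] := sonine_kernel_dt_dominated hw hK.
have gt t : 0 < t < b -> g0 t != 0.
  have [_ [nlo [nhi [_ _ hn]]] _ _ _] := hK; move=> tb; have /andP[t0 tltb] := tb.
  by rewrite /sonine_diag extE//; have [] := hn t ltac:(by rewrite !ltW).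
have eK t : 0 < t < T -> kernel_op kerK (f \_ `]0, T[) t = kernel_op kerK (f \_ `]0, b[) t.
  move=> /andP[t0 tT]; have tb : 0 < t < b by rewrite t0 (lt_trans tT).
  by rewrite /kernel_op !(assoc_kernel_patch K f tb) ?ltW// (lt_trans tT).
by split=> h; apply: ae_imply (ae_conj h (kernel_op_ae dG iu)) => t [ht it] tT;
  have tb : 0 < t < b by [have /andP[-> /lt_trans->] := tT];
  have := ht tT; rewrite second_kind_defectE ?eK//;
  [move=> /eqP; rewrite mulf_eq0 (negPf (gt t tb)) subr_eq0 => /eqP|move=> <-; rewrite subrr mulr0].
Qed.

Lemma nonlocal_unique u v : L1 b u -> L1 b v ->
  nonlocal_solution b w k f c u -> nonlocal_solution b w k f c v ->
  {ae mu, forall t, `]0, b[%classic t -> v t = u t}.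
Proof.
move=> Lu Lv /(nonlocal_volterra Lu) /(volterra_solutionP b0 hw hK c mf Lu)[_ hu].
move=> /(nonlocal_volterra Lv) /(volterra_solutionP b0 hw hK c mf Lv)[_ hv].
have iu := L1_patch Lu; have iv := L1_patch Lv.
have [a [dA a0]] := resolvent_kernel_dominated.
pose h x := (v \_ `]0, b[) x - (u \_ `]0, b[) x.
have ih : intR h by exact: intRB.
have h0 t : t \notin `]0, b[ -> h t = 0.
  by rewrite in_itv/= => tb; rewrite /h !ext0// subrr.
have : {ae mu, forall t, h t = 0}.
  apply: (volterra_equation_unique dA a0 ih h0).
  suff : {ae mu, forall t, 0 < t < b -> h t = kernel_op resolvent_kernel h t}.
    by apply: ae_imply => t ht; rewrite in_itv.
  apply: ae_exhaust => T T0 Tb.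
  have {}hu := (volterra_solution_fixpoint iu T0 Tb).1 (hu T T0 Tb).
  have {}hv := (volterra_solution_fixpoint iv T0 Tb).1 (hv T T0 Tb).
  apply: ae_imply (ae_conj (ae_conj hu hv) (ae_conj (kernel_op_ae dA iu) (kernel_op_ae dA iv))).
  move=> t [[hut hvt] [iut ivt]] tT.
  by rewrite kernel_opB// {1}/h hut// hvt//; ring.
apply: ae_imply => t ht; rewrite /= in_itv/= => tb; apply/eqP.
by rewrite -subr_eq0 -(extE v tb) -(extE u tb); apply/eqP.
Qed.

Lemma nonlocal_exists : L1 b f -> exists2 u, L1 b u & nonlocal_solution b w k f c u.
Proof.
move=> Lf; have iff := L1_patch Lf.
have [a [dA a0]] := resolvent_kernel_dominated.
have [C hC] := sonine_diag_inv_bounded.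
pose phi t := (g0 t)^-1 * (c * extK t + kernel_op kerK (f \_ `]0, b[) t).
have iphi : intR phi.
  rewrite (_ : phi = fun t => - (g0 t)^-1 * (- 1 * (c * extK t + kernel_op kerK (f \_ `]0, b[) t))).
    apply: (integrable_bounded_mul measurable_sonine_diag_inv hC); apply: intRZ; apply: intRD.
      exact: intRZ (extK_integrable hK).
    exact: kernel_op_integrable (assoc_kernel_dominated hK) iff.
  by apply/funext => t; rewrite mulrA mulrN1 opprK.
have g00 t : t \notin `]0, b[ -> g0 t = 0 by rewrite in_itv/= => tb; rewrite /sonine_diag ext0.
have A0 t y : t \notin `]0, b[ -> resolvent_kernel t y = 0.
  by move=> tb; rewrite /resolvent_kernel g00// invr0 oppr0 mul0r.
have phi0 t : t \notin `]0, b[ -> phi t = 0.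
  by move=> tb; rewrite /phi g00// invr0 mul0r.
have [u [iu u0 hu]] := volterra_equation_solvable dA a0 A0 iphi phi0.
have up : u \_ `]0, b[ = u.
  by apply/funext => t; rewrite patchE; case: ifPn => // tb; rewrite u0// in_itv/=;
    apply: contra tb; rewrite inE/= in_itv.
have Lu : L1 b u by apply/(integrable_patch u (measurable_itv _)); rewrite up.
exists u => //; apply/(nonlocal_volterra Lu)/(volterra_solutionP b0 hw hK c mf Lu).
split=> [T T0 Tb|T T0 Tb].
  by apply: integrableS Lf => // x; rewrite /= !in_itv/= => /andP[-> /lt_trans->].
rewrite up; apply/(volterra_solution_fixpoint iu T0 Tb).
apply: ae_imply hu => t ht /andP[t0 tT]; apply: ht.
by rewrite in_itv/= t0 (lt_trans tT).
Qed.

End solve.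

Theorem theorem3p4 (R : realType) (b : R) (hb : 0 < b)
    (w : R -> R -> R) (hw : weight_conditions b w)
    (k K : R -> R) (g : R -> R -> R) (hWSC : WSC1 b w k K g)
    (c : R) (f : R -> R) (hf : measurable_fun `]0, b[ f) :
  (forall u : R -> R, L1 b u ->
     (nonlocal_solution b w k f c u <-> volterra_solution b g K f c u)) /\
  (forall sigma Q : R, 0 < sigma < 1 -> 0 < Q -> L1 b f ->
     (forall s t : R, 0 <= s -> 0 < t -> s + t < b ->
        `|derive1 (g s) t| <= Q * t `^ (- sigma)) ->
     exists2 u : R -> R, L1 b u /\ nonlocal_solution b w k f c u &
       forall v : R -> R, L1 b v -> nonlocal_solution b w k f c v ->
         {ae lebesgue_measure, forall t, `]0, b[%classic t -> v t = u t}).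
Proof.
split=> [u|sigma Q _ _ Lf _]; first exact: (nonlocal_volterra hb hw hWSC).
have [u Lu hu] := nonlocal_exists hb hw hWSC c hf Lf.
by exists u => // v Lv hv; exact: (nonlocal_unique hb hw hWSC hf Lu Lv hu hv).
Qed.
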